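(* Let $0\le n_1<n$ and $0\le n_2<n$. Consider a family of $n\times n$ switches operating under the MaxWeight scheduling algorithm, parameterized by $0<\epsilon<1$, with arrival processes $a^{(\epsilon)}(t)$ whose components are bounded by $a_{\max}$ (not depending on $\epsilon$). Suppose the mean arrival rate vector is $\lambda^{(\epsilon)}=\nu-\epsilon k$, where $\nu\in\mathrm{Relint}(\mathcal F_{n_1n_2})$ satisfies $\nu_{\min}=\min_{i,j}\nu_{ij}>0$, and $k\in\mathbb R_+^{n^2}$ satisfies $\langle k,\mathbf 1\rangle=n$, with $\kappa_i>0$ for $i\le n_1$ and $\tilde\kappa_j>0$ for $j\le n_2$. Suppose the variance vector $(\sigma^{(\epsilon)})^2$ of the arrivals satisfies $\|\sigma^{(\epsilon)}\|^2\le\tilde\sigma^2$ for some $\tilde\sigma^2$ not depending on $\epsilon$. The queue length process $q^{(\epsilon)}(t)$ of each system is positive recurrent and converges in distribution to a steady-state random vector $\bar q^{(\epsilon)}$. Let $\alpha\in\mathbb R^{n^2}$ be any fixed weight vector (entries may be negative) with $\langle\alpha,e^{(i)}\rangle=n\kappa_i$ for all $i\le n_1$ and $\langle\alpha,\tilde e^{(j)}\rangle=n\tilde\kappa_j$ for all $j\le n_2$. Then for every $\epsilon$ with $0<\epsilon\le\nu'_{\min}/(2\|k\|)$, $$\frac1{2\epsilon}\big\langle(\sigma^{(\epsilon)})^2,\zeta\big\rangle-B_1(\epsilon)\;\le\;\mathbb E\big[\langle\bar q^{(\epsilon)},\alpha\rangle\big]\;\le\;\frac1{2\epsilon}\big\langle(\sigma^{(\epsilon)})^2,\zeta\big\rangle+B_2(\epsilon),$$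 where $B_1,B_2$ are functions with $\lim_{\epsilon\to0}\epsilon B_1(\epsilon)=\lim_{\epsilon\to0}\epsilon B_2(\epsilon)=0$, and $\zeta\in\mathbb R^{n^2}$ is defined by $$\zeta_{ij}=\begin{cases}2-\frac{2n-n_1-n_2}{n^2-n_1n_2}& i\le n_1,\ j\le n_2\\[2pt] 1+\frac{n_2}{n^2-n_1n_2}& i\le n_1,\ j>n_2\\[2pt] 1+\frac{n_1}{n^2-n_1n_2}& i>n_1,\ j\le n_2\\[2pt] 0& i>n_1,\ j>n_2.\end{cases}$$ Consequently, if $(\sigma^{(\epsilon)})^2\to\sigma^2$ as $\epsilon\downarrow0$, then $$\lim_{\epsilon\to0}\epsilon\,\mathbb E\big[\langle\bar q^{(\epsilon)},\alpha\rangle\big]=\tfrac12\langle\sigma^2,\zeta\rangle .$$ Moreover, for all $i>n_1$ and $j>n_2$, $\lim_{\epsilon\to0}\epsilon\,\mathbb E[\bar q^{(\epsilon)}_{ij}]=0$.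
   Context: Notation. Elements of $\mathbb R^{n^2}$ are written as $n\times n$ matrices $x=(x_{ij})$, with $\langle x,y\rangle=\sum_{i,j}x_{ij}y_{ij}$ and $\|x\|=\sqrt{\langle x,x\rangle}$. $\mathbf 1$ is the all-ones matrix; $e^{(i)}$ is the matrix with $i$-th row all ones and zeros elsewhere; $\tilde e^{(j)}$ is the matrix with $j$-th column all ones and zeros elsewhere. $\sigma^2=(\sigma_{ij}^2)_{ij}$ is the vector of variances and $\|\sigma\|^2=\sum_{i,j}\sigma_{ij}^2$. Switch model (discrete time). There are $n^2$ queues with nonnegative integer lengths $q_{ij}(t)$. In each slot $t$, $a_{ij}(t)$ packets (a nonnegative integer $\le a_{\max}$) arrive to queue $(i,j)$; the arrivals are i.i.d. over $t$, independent across queues, independent of queue lengths and schedules, with mean $\lambda_{ij}$ and variance $\sigma_{ij}^2$. A schedule is $s\in\mathcal S=\{s\in\{0,1\}^{n^2}:\sum_i s_{ij}\le1\ \forall j,\ \sum_j s_{ij}\le1\ \forall i\}$. Given $q(t)$, a schedule $s(t)$ is chosen, then arrivals occur, and $q_{ij}(t+1)=\max(0,q_{ij}(t)+a_{ij}(t)-s_{ij}(t))$. The MaxWeight algorithm chooses $s(t)\in\arg\max_{s\in\mathcal S}\langle q(t),s\rangle$, ties broken uniformly at random (without changing the dynamics, one takes $s(t)$ to be maximal, i.e. a permutation matrix, since links added to complete a maximum-weight schedule have zero queue length). Capacity region: $\mathcal C=\{\lambda\in\mathbb R_+^{n^2}:\langle\lambda,e^{(i)}\rangle\le1,\ \langle\lambda,\tilde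 e^{(j)}\rangle\le1\ \forall i,j\}$. Face: $\mathcal F_{n_1n_2}=\{\nu\in\mathcal C:\langle\nu,e^{(i)}\rangle=1\ \forall i\le n_1,\ \langle\nu,\tilde e^{(j)}\rangle=1\ \forall j\le n_2\}$. For $\nu\in\mathrm{Relint}(\mathcal F_{n_1n_2})$ (relative interior) one has $\langle\nu,e^{(i)}\rangle<1$ for $i>n_1$ and $\langle\nu,\tilde e^{(j)}\rangle<1$ for $j>n_2$. Rows $i\le n_1$ and columns $j\le n_2$ are called saturated. $\kappa_i=\langle k,e^{(i)}\rangle$, $\tilde\kappa_j=\langle k,\tilde e^{(j)}\rangle$. $\nu'_{\min}=\min\{\nu_{\min},\ \min_{i>n_1}(1-\langle\nu,e^{(i)}\rangle),\ \min_{j>n_2}(1-\langle\nu,\tilde e^{(j)}\rangle)\}$. Only those $\epsilon$ are considered for which $\lambda^{(\epsilon)}$ is a nonnegative vector. *)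

(* Defs.v *)
From HB Require Import structures.
From mathcomp Require Import all_boot all_order all_algebra.
From mathcomp Require Import all_classical all_reals all_analysis.

Set Implicit Arguments.
Unset Strict Implicit.
Unset Printing Implicit Defensive.

Import Order.TTheory GRing.Theory Num.Theory.
Import numFieldNormedType.Exports.

Local Open Scope classical_set_scope.
Local Open Scope ring_scope.

(* Rows and columns are indexed from 0: row [i] is saturated iff [i < n1],
   column [j] iff [j < n2]. *)

Section Vectors.
Variables (R : realType) (n : nat).
Implicit Types (x y : 'M[R]_n).

Definition mxdot x y : R := \sum_i \sum_j x i j * y i j.

Definition mxnorm2 x : R := Num.sqrt (mxdot x x).

Definition row_ones (i0 : 'I_n) : 'M[R]_n := \matrix_(i, j) (i == i0)%:R.

Definition col_ones (j0 : 'I_n) : 'M[R]_n := \matrix_(i, j) (j == j0)%:R.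

Definition natmx (q : 'M[nat]_n) : 'M[R]_n := map_mx (fun m : nat => m%:R) q.

End Vectors.

Section RelativeInterior.
Variables (R : realType) (n : nat).

Definition affine_hull (A : set 'M[R]_n) : set 'M[R]_n :=
  [set x : 'M[R]_n | exists m (c : 'I_m -> R) (p : 'I_m -> 'M[R]_n),
     [/\ forall l, A (p l), \sum_l c l = 1 & x = \sum_l c l *: p l]].

Definition relint (A : set 'M[R]_n) : set 'M[R]_n :=
  [set x : 'M[R]_n | A x /\ \forall y \near x, affine_hull A y -> A y].

End RelativeInterior.

Section Capacity.
Variables (R : realType) (n : nat).
Implicit Types nu : 'M[R]_n.

Definition capacity_region : set 'M[R]_n :=
  [set nu : 'M[R]_n | [/\ forall i j, 0 <= nu i j,
                forall i, mxdot nu (row_ones R i) <= 1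
              & forall j, mxdot nu (col_ones R j) <= 1]].

Definition face (n1 n2 : nat) : set 'M[R]_n :=
  [set nu : 'M[R]_n | [/\ capacity_region nu,
                forall i : 'I_n, (i < n1)%N -> mxdot nu (row_ones R i) = 1
              & forall j : 'I_n, (j < n2)%N -> mxdot nu (col_ones R j) = 1]].

(* The sets below are finite and, for [n1, n2 < n], nonempty: each [inf] is a
   minimum. *)
Definition nu_min nu : R := inf [set r : R | exists i j, r = nu i j].

Definition nu_min' (n1 n2 : nat) nu : R :=
  Num.min (nu_min nu)
    (Num.min
       (inf [set r : R | exists2 i : 'I_n, (n1 <= i)%N
                     & r = 1 - mxdot nu (row_ones R i)])
       (inf [set r : R | exists2 j : 'I_n, (n2 <= j)%N
                     & r = 1 - mxdot nu (col_ones R j)])).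

Definition zeta (n1 n2 : nat) : 'M[R]_n :=
  let D : R := n%:R ^+ 2 - n1%:R * n2%:R in
  \matrix_(i, j)
    if (i < n1)%N then
      if (j < n2)%N then 2 - (2 * n%:R - n1%:R - n2%:R) / D
      else 1 + n2%:R / D
    else
      if (j < n2)%N then 1 + n1%:R / D else 0.

Definition admissible nu (k : 'M[R]_n) (e : R) : Prop :=
  0 < e < 1 /\ forall i j, 0 <= (nu - e *: k) i j.

End Capacity.

Section Schedules.
Variable n : nat.
Implicit Types (s : 'M[bool]_n) (S : {set 'M[bool]_n}) (q a : 'M[nat]_n).

Definition schedules : {set 'M[bool]_n} :=
  [set s : 'M[bool]_n | [forall i, (\sum_j s i j <= 1)%N]
                     && [forall j, (\sum_i s i j <= 1)%N]].

(* The maximal schedules, i.e. the permutation matrices: completing a schedule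
   of maximum weight with links of empty queues keeps its weight. *)
Definition full_schedules : {set 'M[bool]_n} :=
  [set s : 'M[bool]_n | [forall i, (\sum_j s i j == 1)%N]
                     && [forall j, (\sum_i s i j == 1)%N]].

Definition weight q s : nat := (\sum_i \sum_j q i j * s i j)%N.

Definition maxweight S q : {set 'M[bool]_n} :=
  [set s in S | [forall s' in S, (weight q s' <= weight q s)%N]].

(* Truncated subtraction provides the max with 0. *)
Definition next_queue q a s : 'M[nat]_n :=
  \matrix_(i, j) (q i j + a i j - s i j)%N.

End Schedules.

Section Switch.
Context {d : measure_display} {T : measurableType d} {R : realType}.
Variables (P : probability T R) (n : nat).

Definition nat_random_matrix (X : T -> 'M[nat]_n) : Prop :=
  forall i j, measurable_fun [set: T] (fun w => X w i j).

Section Histories.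
Variables (q a : nat -> T -> 'M[nat]_n) (s : nat -> T -> 'M[bool]_n).
Variables (x z : nat -> 'M[nat]_n) (y : nat -> 'M[bool]_n).

(* A prescribed past, up to just before the schedule of slot [t] is chosen. *)
Definition past_before_schedule (t : nat) : set T :=
  [set w | (forall u, (u <= t)%N -> q u w = x u) /\
           (forall u, (u < t)%N -> s u w = y u /\ a u w = z u)].

(* A prescribed past, up to just before the arrivals of slot [t]. *)
Definition past_before_arrivals (t : nat) : set T :=
  past_before_schedule t `&` [set w | s t w = y t].

End Histories.

(* [S] is the set of schedules MaxWeight optimises over; [q] may start from any
   random initial queue lengths. All the variables being discrete, the two
   conditional laws are expressed on the atoms of the past: given the past,
   the schedule is uniform among the MaxWeight ones for the current queue
   lengths, and the arrivals follow a fixed product law. *)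
Record maxweight_switch (S : {set 'M[bool]_n}) (amax : nat)
    (lambda sigma2 : 'M[R]_n)
    (q a : nat -> T -> 'M[nat]_n) (s : nat -> T -> 'M[bool]_n) : Prop :=
  MaxWeightSwitch {
    queues_random : forall t, nat_random_matrix (q t);
    arrivals_random : forall t, nat_random_matrix (a t);
    schedules_random :
      forall t i j, measurable_fun [set: T] (fun w => s t w i j);
    arrivals_bounded : forall t w i j, (a t w i j <= amax)%N;
    arrivals_stationary : forall t i j m,
      P [set w | a t w i j = m] = P [set w | a 0%N w i j = m];
    arrivals_mean : forall t i j,
      ('E_P[fun w => (a t w i j)%:R] = (lambda i j)%:E)%E;
    arrivals_variance : forall t i j,
      ('V_P[fun w => (a t w i j)%:R] = (sigma2 i j)%:E)%E;
    arrivals_independent : forall t x z y (m : 'M[nat]_n),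
      P (past_before_arrivals q a s x z y t `&` [set w | a t w = m]) =
      (P (past_before_arrivals q a s x z y t) *
         \prod_i \prod_j P [set w | a t w i j = m i j])%E;
    schedules_maxweight : forall t x z y (s0 : 'M[bool]_n),
      P (past_before_schedule q a s x z y t `&` [set w | s t w = s0]) =
      (P (past_before_schedule q a s x z y t) *
         (if s0 \in maxweight S (x t) then
            (#|maxweight S (x t)|%:R^-1)%:E else 0))%E;
    queues_step : forall t w, q t.+1 w = next_queue (q t w) (a t w) (s t w)
  }.

Definition queue_kernel (S : {set 'M[bool]_n}) (a : nat -> T -> 'M[nat]_n)
    (x y : 'M[nat]_n) : \bar R :=
  (\sum_(s in maxweight S x)
     (#|maxweight S x|%:R^-1)%:E * P [set w | next_queue x (a 0%N w) s = y])%E.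

End Switch.

Section MarkovChains.
Variables (R : realType) (X : choiceType) (K : X -> X -> \bar R).
Local Open Scope ereal_scope.

Definition reachable (x y : X) : Prop :=
  exists p : seq X, path (fun u v => 0 < K u v) x p /\ last x p = y.

(* Probability, starting from [x], that the hitting time
   inf {t >= 1 | X_t \in A} exceeds [t]. *)
Fixpoint avoidance (A : set X) (t : nat) (x : X) : \bar R :=
  if t is t'.+1 then \esum_(y in ~` A) (K x y * avoidance A t' y) else 1.

Definition mean_return_time (x : X) : \bar R :=
  \sum_(0 <= t <oo) avoidance [set x] t x.

(* The queue lengths may have transient states (e.g. when some arrival rate is
   0), so that irreducibility is only asked of an almost surely absorbing
   class, and positive recurrence of the states of that class. *)
Definition positive_recurrent : Prop :=
  exists C : set X,
    [/\ C !=set0,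
        forall x y, C x -> (reachable x y <-> C y),
        forall x, C x -> mean_return_time x < +oo
      & forall x, avoidance C t x @[t --> \oo] --> 0].

End MarkovChains.

Section SteadyState.
Context {R : realType} {n : nat}.
Local Open Scope ereal_scope.

Definition stationary_for (K : 'M[nat]_n -> 'M[nat]_n -> \bar R)
    {d} {T : measurableType d} (P : probability T R) (X : T -> 'M[nat]_n) :=
  forall y, P [set w | X w = y] =
            \esum_(x in [set: 'M[nat]_n]) (P [set w | X w = x] * K x y).

Definition cvg_in_distribution
    {d} {T : measurableType d} (P : probability T R) (X : nat -> T -> 'M[R]_n)
    {d'} {T' : measurableType d'} (P' : probability T' R) (Y : T' -> 'M[R]_n) :=
  forall f : 'M[R]_n -> R,
    continuous f -> (exists M, forall x, `|f x| <= M)%R ->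
    'E_P[fun w => f (X t w)] @[t --> \oo] --> 'E_P'[fun w => f (Y w)].

End SteadyState.

(* Main.v *)
(* The steady state is encoded by the functional [pi f = lim_t K^t f], for [K]
   the transition operator and [f] of growth at most [|q|^4]. It exists because
   MaxWeight makes [exp (th * |q|)] a Lyapunov function and slots without
   arrivals empty the queues, so that two independent copies of the chain meet
   at a geometric rate.

   For the heavy traffic limit, let [Phi (x, y) = <x, Theta y>] with [Theta]
   equal to [n] times the orthogonal projection on the span of the saturated
   rows and columns, so that [Phi (E_ij, E_ij) = zeta_ij]. A completed schedule
   has the saturated sums of [nu], so that equating to 0 the steady drift of
   [Phi (q, q)] gives
   [2 eps E Phi (q, k) = <sigma^2, zeta> + eps^2 Phi (k, k)
      + E (2 Phi (q', u) - Phi (u, u))]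
   for [u] the unused service. The distance from [q] to the cone of the
   saturated rows and columns has a second moment bounded uniformly in [eps]
   (state space collapse), and [<q, alpha> = Phi (q, k)] on that cone. Since
   [q'] is bounded where [u > 0] and the saturated sums of [u] have mean
   [O(eps)], the last term is [O(eps)] up to products of [u] with that
   distance, hence [O(sqrt eps)]. *)
Require Import Defs.
From HB Require Import structures.
From mathcomp Require Import all_boot all_order all_algebra all_fingroup.
From mathcomp Require Import all_classical all_reals all_analysis.
From mathcomp Require Import zify ring lra.

Set Implicit Arguments.
Unset Strict Implicit.
Unset Printing Implicit Defensive.

Import Order.TTheory GRing.Theory Num.Theory.
Import numFieldNormedType.Exports.

Local Open Scope ring_scope.

(** * Schedules of maximal weight *)

Section Birkhoff.
Variables (R : realFieldType) (n : nat).
Implicit Types x d q : 'M[R]_n.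

Definition doubly_stochastic x :=
  [/\ forall i j, 0 <= x i j, forall i, \sum_j x i j = 1
    & forall j, \sum_i x i j = 1].

Definition fractional x : {set 'I_n * 'I_n} :=
  [set c | 0 < x c.1 c.2 < 1].

Lemma doubly_stochastic_le1 x i j : doubly_stochastic x -> x i j <= 1.
Proof.
case=> x0 r1 _; rewrite -(r1 i) (bigD1 j)//= lerDl.
by apply: sumr_ge0 => k _.
Qed.

Lemma doubly_stochastic_tr x : doubly_stochastic x -> doubly_stochastic x^T.
Proof.
case=> x0 r1 c1; split=> [i j|i|j]; first by rewrite mxE.
  by under eq_bigr do rewrite mxE; apply: c1.
by under eq_bigr do rewrite mxE; apply: r1.
Qed.

(** The row sums to 1: an entry 1 beside [x i j > 0] would exceed it, and zeros everywhere else
    would force [x i j = 1]. *)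
Lemma fractional_row_other x i j : doubly_stochastic x ->
  (i, j) \in fractional x -> exists2 j', j' != j & (i, j') \in fractional x.
Proof.
move=> dx; have [x0 r1 _] := dx; rewrite inE /= => /andP[x_gt0 x_lt1].
apply/exists_inP; apply: contraT; rewrite negb_exists_in => /forall_inP noj.
have zero j' : j' != j -> x i j' = 0.
  move=> jj'; have := noj _ jj'; rewrite inE /= negb_and -!leNgt.
  case/orP => [|ge1]; first by have := x0 i j'; lra.
  have: x i j + x i j' <= 1.
    rewrite -(r1 i) (bigD1 j)//= (bigD1 j')//= addrA lerDl.
    by apply: sumr_ge0 => k _.
  by lra.
by have := r1 i; rewrite (bigD1 j)//= big1 => [|k /zero//]; lra.
Qed.

Lemma fractional_rows x : doubly_stochastic x ->
  (#|[set c.1 | c in fractional x]| * 2 <= #|fractional x|)%N.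
Proof.
move=> dx; set F := fractional x; set RF := [set c.1 | c in F].
rewrite -sum_nat_const -[leqRHS]sum1_card.
rewrite (partition_big (fun c : 'I_n * 'I_n => c.1) (mem RF)) /=; last first.
  by move=> c cF; apply: imset_f.
apply: leq_sum => i /imsetP[[i' j] /= cF ->].
have [j' jj' cF'] := fractional_row_other dx cF.
rewrite (bigD1 (i', j)) /=; last by rewrite cF /=.
by rewrite (bigD1 (i', j')) //= cF' /= eqxx /= xpair_eqE negb_and jj' orbT.
Qed.

Lemma fractional_tr x :
  #|[set c.2 | c in fractional x]| = #|[set c.1 | c in fractional x^T]|
  /\ #|fractional x| = #|fractional x^T|.
Proof.
pose sw (c : 'I_n * 'I_n) := (c.2, c.1).
have swK : involutive sw by case.
have -> : fractional x^T = sw @: fractional x.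
  apply/setP => c; rewrite -[c]swK mem_imset; last exact: inv_inj.
  by rewrite !inE /= mxE.
split; last by rewrite card_imset//; exact: inv_inj.
by rewrite -imset_comp.
Qed.

Lemma fractional_columns x : doubly_stochastic x ->
  (#|[set c.2 | c in fractional x]| * 2 <= #|fractional x|)%N.
Proof.
move=> dx; have [-> ->] := fractional_tr x.
exact/fractional_rows/doubly_stochastic_tr.
Qed.

(* There are at least as many fractional entries as rows and columns meeting
   them, and the row and column equations are dependent. *)
Lemma fractional_direction x : doubly_stochastic x -> fractional x != finset.set0 ->
  exists d, [/\ d != 0, forall i j, (i, j) \notin fractional x -> d i j = 0,
    forall i, \sum_j d i j = 0 & forall j, \sum_i d i j = 0].
Proof.
move=> dx /finset.set0Pn[c0 c0F]; set F := fractional x.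
pose RF := [set c.1 | c in F]; pose CF := [set c.2 | c in F] :\ c0.2.
pose A : 'M[R]_(#|F|, #|RF|) := \matrix_(e, a)
  ((enum_val e).1 == enum_val a)%:R.
pose B : 'M[R]_(#|F|, #|CF|) := \matrix_(e, b)
  ((enum_val e).2 == enum_val b)%:R.
(* [2 * #|RF| <= #|F|] and [2 * (#|CF| + 1) <= #|F|], so there are fewer equations than unknowns. *)
have : kermx (row_mx A B) != 0.
  rewrite -mxrank_eq0 mxrank_ker -lt0n subn_gt0.
  apply: leq_ltn_trans (rank_leq_col _) _.
  have := fractional_rows dx; have := fractional_columns dx.
  by rewrite (cardsD1 c0.2) imset_f // -/F -/RF -/CF; lia.
case/rowV0Pn => v /sub_kermxP; rewrite mul_mx_row -row_mx0.
case/eq_row_mx => vA vB v0.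
pose d := \matrix_(i, j) \sum_(e < #|F|) v 0 e * (enum_val e == (i, j))%:R.
have sumd1 i : \sum_j d i j = \sum_e v 0 e * ((enum_val e).1 == i)%:R.
  under eq_bigr do rewrite mxE; rewrite exchange_big /=.
  apply: eq_bigr => e _; rewrite -mulr_sumr; congr (_ * _).
  case: (enum_val e) => i' j' /=; under eq_bigr do rewrite xpair_eqE.
  rewrite (bigD1 j') //= eqxx andbT big1 ?addr0// => k /negPf.
  by rewrite eq_sym => ->; rewrite andbF.
have sumd2 j : \sum_i d i j = \sum_e v 0 e * ((enum_val e).2 == j)%:R.
  under eq_bigr do rewrite mxE; rewrite exchange_big /=.
  apply: eq_bigr => e _; rewrite -mulr_sumr; congr (_ * _).
  case: (enum_val e) => i' j' /=; under eq_bigr do rewrite xpair_eqE.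
  rewrite (bigD1 i') //= eqxx /= big1 ?addr0// => k /negPf.
  by rewrite eq_sym => ->.
have rows i : \sum_j d i j = 0.
  rewrite sumd1; have [iR|iR] := boolP (i \in RF).
    have := congr1 (fun M : 'rV_#|RF| => M 0 (enum_rank_in iR i)) vA.
    rewrite mxE [RHS]mxE => E; rewrite -[RHS]E; apply: eq_bigr => e _.
    by rewrite mxE enum_rankK_in.
  rewrite big1 // => e _; case: eqP => [ei|]; last by rewrite mulr0.
  by rewrite -ei imset_f ?enum_valP in iR.
have cols' j : j != c0.2 -> \sum_i d i j = 0.
  move=> jc; rewrite sumd2; have [jC|jC] := boolP (j \in CF).
    have := congr1 (fun M : 'rV_#|CF| => M 0 (enum_rank_in jC j)) vB.
    rewrite mxE [RHS]mxE => E; rewrite -[RHS]E; apply: eq_bigr => e _.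
    by rewrite mxE enum_rankK_in.
  rewrite big1 // => e _; case: eqP => [ei|]; last by rewrite mulr0.
  by rewrite -ei finset.in_setD1 ei jc -ei imset_f ?enum_valP in jC.
exists d; split=> //.
- apply: contraNneq v0 => d0; apply/eqP/rowP => e.
  have := congr1 (fun A : 'M[R]_n => A (enum_val e).1 (enum_val e).2) d0.
  rewrite !mxE (bigD1 e) //= -surjective_pairing eqxx mulr1 big1 ?addr0//.
  move=> e' /negPf e'e; rewrite (inj_eq enum_val_inj) e'e mulr0//.
- move=> i j ijF; rewrite mxE big1 // => e _.
  case: eqP => [ei|]; last by rewrite mulr0.
  by rewrite -ei enum_valP in ijF.
(* The dropped column: all columns together sum to 0 by the row equations. *)
- move=> j; have [->|/cols'//] := eqVneq j c0.2.
  have : \sum_j \sum_i d i j = 0 by rewrite exchange_big big1.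
  by rewrite (bigD1 c0.2) //= [X in _ + X]big1 ?addr0.
Qed.

Lemma doubly_stochastic_integral x : doubly_stochastic x ->
  fractional x = finset.set0 ->
  exists s : {perm 'I_n}, forall i j, x i j = (s i == j)%:R.
Proof.
move=> dx F0; have [x0 r1 c1] := dx.
have x01 i j : x i j = 0 \/ x i j = 1.
  have := finset.in_set0 (i, j); rewrite -F0 inE /= => /negbT.
  rewrite negb_and -!leNgt; have := x0 i j; have := doubly_stochastic_le1 i j dx.
  by move=> ? ? /orP; case=> ?; [left|right]; lra.
have ex1 i : exists j, x i j == 1.
  apply/existsP; apply: contraT; rewrite negb_exists => /forallP no.
  have := r1 i; rewrite big1 => [|j _]; first by lra.
  by case: (x01 i j) (no j) => // ->; rewrite eqxx.
pose f i := xchoose (ex1 i).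
have fE i : x i (f i) = 1 by apply/eqP/(xchooseP (ex1 i)).
have f_inj : injective f.
  move=> i i' ff; apply/eqP; apply: contraT => ii'.
  have := c1 (f i); rewrite (bigD1 i) //= (bigD1 i') /=; last by rewrite eq_sym.
  rewrite {2}ff !fE.
  have : 0 <= \sum_(k | (k != i) && (k != i')) x k (f i) by apply: sumr_ge0.
  lra.
exists (perm f_inj) => i j; rewrite permE.
have [<-|fj] := eqVneq (f i) j; first by rewrite fE.
case: (x01 i j) => // x1; have := r1 i.
rewrite (bigD1 j) //= (bigD1 (f i)) //= x1 fE.
have : 0 <= \sum_(k | (k != j) && (k != f i)) x i k by apply: sumr_ge0.
lra.
Qed.

(** Ratio test: a nonzero direction with zero row sums has a negative entry, and the step is the
    largest one that keeps every entry nonnegative. The minimising entry becomes 0, while the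
    entries outside the fractional support do not move. *)
Lemma doubly_stochastic_move x d : doubly_stochastic x -> d != 0 ->
  (forall i j, (i, j) \notin fractional x -> d i j = 0) ->
  (forall i, \sum_j d i j = 0) -> (forall j, \sum_i d i j = 0) ->
  exists2 t, 0 <= t & doubly_stochastic (x + t *: d) /\
    (#|fractional (x + t *: d)%R| < #|fractional x|)%N.
Proof.
move=> dx d0 dF rows cols; have [x0 r1 c1] := dx.
have [c cneg] : exists c : 'I_n * 'I_n, d c.1 c.2 < 0.
  apply/existsP; apply: contraNT d0; rewrite negb_exists => /forallP no.
  have dpos i j : 0 <= d i j by rewrite leNgt; exact: (no (i, j)).
  apply/eqP/matrixP => i j; rewrite mxE; apply/eqP.
  by have /eqP := rows i; rewrite psumr_eq0 => [/allP/(_ j)|//]; apply; rewrite mem_index_enum.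
pose r (c : 'I_n * 'I_n) := x c.1 c.2 / - d c.1 c.2.
case: (@Order.TotalTheory.arg_minP _ _ _ c (fun c => d c.1 c.2 < 0) r cneg).
move=> m mneg mmin; exists (r m).
  by rewrite divr_ge0 // oppr_ge0 ltW.
have F_m : m \in fractional x.
  by apply: contraTT mneg => mF; rewrite dF -?surjective_pairing// ltxx.
split; first split.
- move=> i j; rewrite !mxE; have [dn|dp] := ltP (d i j) 0; last first.
    by rewrite addr_ge0 // mulr_ge0 // divr_ge0 // oppr_ge0 ltW.
  have := mmin (i, j) dn; rewrite /r /= ler_pdivlMr ?oppr_gt0 //; lra.
- move=> i; under eq_bigr do rewrite !mxE.
  by rewrite big_split /= -mulr_sumr rows r1 mulr0 addr0.
- move=> j; under eq_bigr do rewrite !mxE.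
  by rewrite big_split /= -mulr_sumr cols c1 mulr0 addr0.
apply: proper_card; apply/properP; split.
  apply/fintype.subsetP => -[i j]; apply: contraLR => ijF.
  by move: (ijF); rewrite !inE /= !mxE dF // mulr0 addr0.
exists m => //; rewrite inE !mxE /r.
suff -> : x m.1 m.2 + x m.1 m.2 / - d m.1 m.2 * d m.1 m.2 = 0 by rewrite ltxx.
by field; rewrite lt_eqF.
Qed.

(* Move along sum-preserving directions of the fractional support that do not
   decrease the weight until the matrix is integral. *)
Lemma birkhoff q x : doubly_stochastic x ->
  exists s : {perm 'I_n},
    \sum_i \sum_j q i j * x i j <= \sum_i q i (s i).
Proof.
have [m] := ubnP #|fractional x|; elim: m x => // m IH x xm dx.
have [F0|F0] := eqVneq (fractional x) finset.set0.
  have [s sE] := doubly_stochastic_integral dx F0; exists s.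
  apply: ler_sum => i _; rewrite (bigD1 (s i)) //= sE eqxx mulr1.
  by rewrite big1 ?addr0 // => j /negPf; rewrite eq_sym sE => ->; rewrite mulr0.
have [d [d0 dF rows cols]] := fractional_direction dx F0.
wlog dq : d d0 dF rows cols / 0 <= \sum_i \sum_j q i j * d i j => [H|].
  have [dq|/ltW dq] := leP 0 (\sum_i \sum_j q i j * d i j); first exact: (H d).
  apply: (H (- d)); rewrite ?oppr_eq0 //.
  - by move=> i j /dF; rewrite mxE => ->; rewrite oppr0.
  - by move=> i; under eq_bigr do rewrite mxE; rewrite sumrN rows oppr0.
  - by move=> j; under eq_bigr do rewrite mxE; rewrite sumrN cols oppr0.
  - under eq_bigr do (under eq_bigr do rewrite mxE mulrN; rewrite sumrN).
    by rewrite sumrN oppr_ge0.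
have [t t0 [dx' lt]] := doubly_stochastic_move dx d0 dF rows cols.
have [s sP] := IH _ (leq_trans lt (ltnSE xm)) dx'; exists s.
apply: le_trans sP.
have -> : \sum_i \sum_j q i j * (x + t *: d) i j =
    \sum_i \sum_j q i j * x i j + t * \sum_i \sum_j q i j * d i j.
  rewrite mulr_sumr -big_split; apply: eq_bigr => i _ /=.
  rewrite mulr_sumr -big_split; apply: eq_bigr => j _ /=.
  by rewrite !mxE mulrDr mulrCA.
by rewrite lerDl mulr_ge0.
Qed.

End Birkhoff.

Local Open Scope classical_set_scope.
Local Open Scope ring_scope.

Lemma sumr_ord (R : pzSemiRingType) m (c : R) : \sum_(i < m) c = m%:R * c.
Proof. by rewrite sumr_const card_ord mulr_natl. Qed.

(** * The inner product of matrices *)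

Section Mxdot.
Variables (R : realType) (n : nat).
Implicit Types x y z : 'M[R]_n.

Lemma mxdotC x y : mxdot x y = mxdot y x.
Proof. by apply: eq_bigr => i _; apply: eq_bigr => j _; rewrite mulrC. Qed.

Lemma mxdotDl x y z : mxdot (x + y) z = mxdot x z + mxdot y z.
Proof.
rewrite /mxdot -big_split; apply: eq_bigr => i _ /=; rewrite -big_split.
by apply: eq_bigr => j _; rewrite mxE mulrDl.
Qed.

Lemma mxdotZl c x z : mxdot (c *: x) z = c * mxdot x z.
Proof.
rewrite /mxdot mulr_sumr; apply: eq_bigr => i _ /=; rewrite mulr_sumr.
by apply: eq_bigr => j _; rewrite mxE mulrA.
Qed.

Lemma mxdotDr x y z : mxdot z (x + y) = mxdot z x + mxdot z y.
Proof. by rewrite mxdotC mxdotDl !(mxdotC z). Qed.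

Lemma mxdotZr c x z : mxdot z (c *: x) = c * mxdot z x.
Proof. by rewrite mxdotC mxdotZl (mxdotC z). Qed.

Lemma mxdotNl x z : mxdot (- x) z = - mxdot x z.
Proof. by rewrite -scaleN1r mxdotZl mulN1r. Qed.

Lemma mxdotNr x z : mxdot z (- x) = - mxdot z x.
Proof. by rewrite mxdotC mxdotNl mxdotC. Qed.

Lemma mxdotBl x y z : mxdot (x - y) z = mxdot x z - mxdot y z.
Proof. by rewrite mxdotDl mxdotNl. Qed.

Lemma mxdotBr x y z : mxdot z (x - y) = mxdot z x - mxdot z y.
Proof. by rewrite mxdotDr mxdotNr. Qed.

Lemma mxdot_row x i : mxdot x (row_ones R i) = \sum_j x i j.
Proof.
rewrite /mxdot (bigD1 i) //= [X in _ + X]big1 => [|i' /negPf ii'].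
  by rewrite addr0; apply: eq_bigr => j _; rewrite mxE eqxx mulr1.
by apply: big1 => j _; rewrite mxE ii' mulr0.
Qed.

Lemma mxdot_col x j : mxdot x (col_ones R j) = \sum_i x i j.
Proof.
apply: eq_bigr => i _; rewrite (bigD1 j) //= [X in _ + X]big1.
  by rewrite addr0 mxE eqxx mulr1.
by move=> j' /negPf jj'; rewrite mxE jj' mulr0.
Qed.

Lemma mxdot_delta x i j : mxdot x (delta_mx i j) = x i j.
Proof.
rewrite /mxdot (bigD1 i) //= [X in _ + X]big1 => [|i' /negPf ii'].
  rewrite addr0 (bigD1 j) //= [X in _ + X]big1 => [|j' /negPf jj'].
    by rewrite addr0 mxE !eqxx mulr1.
  by rewrite mxE jj' andbF mulr0.
by apply: big1 => j' _; rewrite mxE ii' mulr0.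
Qed.

Lemma delta_row i j l : \sum_j' (delta_mx i j : 'M[R]_n) l j' = (l == i)%:R.
Proof. by rewrite -mxdot_row mxdotC mxdot_delta mxE eq_sym. Qed.

Lemma delta_col i j l : \sum_i' (delta_mx i j : 'M[R]_n) i' l = (l == j)%:R.
Proof. by rewrite -mxdot_col mxdotC mxdot_delta mxE eq_sym. Qed.

Lemma mxdot_ge0 x y : (forall i j, 0 <= x i j) -> (forall i j, 0 <= y i j) ->
  0 <= mxdot x y.
Proof. by move=> x0 y0; do 2![apply: sumr_ge0 => ? _]; apply: mulr_ge0. Qed.

Lemma ler_mxdot z x y : (forall i j, 0 <= z i j) ->
  (forall i j, x i j <= y i j) -> mxdot z x <= mxdot z y.
Proof.
by move=> z0 xy; do 2![apply: ler_sum => ? _]; apply: ler_wpM2l.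
Qed.

Lemma mxdot_self_ge0 x : 0 <= mxdot x x.
Proof. by do 2![apply: sumr_ge0 => ? _]; rewrite -expr2 sqr_ge0. Qed.

Lemma sqr_entry_le x i j : x i j ^+ 2 <= mxdot x x.
Proof.
rewrite /mxdot (bigD1 i) //= (bigD1 j) //= -expr2 -addrA lerDl.
by rewrite addr_ge0 //; do ?[apply: sumr_ge0 => ? _]; rewrite -expr2 sqr_ge0.
Qed.

Lemma mxnorm2_ge0 x : 0 <= mxnorm2 x.
Proof. exact: sqrtr_ge0. Qed.

Lemma sqr_mxnorm2 x : mxnorm2 x ^+ 2 = mxdot x x.
Proof. by rewrite sqr_sqrtr ?mxdot_self_ge0. Qed.

Lemma entry_le_mxnorm2 x i j : `|x i j| <= mxnorm2 x.
Proof.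
rewrite -(ler_pXn2r (isT : (0 < 2)%N)) ?nnegrE ?mxnorm2_ge0 //.
by rewrite sqr_mxnorm2 real_normK ?num_real // sqr_entry_le.
Qed.

Lemma mxdot_self_le x c : 0 <= c -> (forall i j, `|x i j| <= c) ->
  mxdot x x <= (n%:R * c) ^+ 2.
Proof.
move=> c0 xc; apply: (@le_trans _ _ (\sum_(i < n) \sum_(j < n) c ^+ 2)).
  do 2![apply: ler_sum => ? _]; rewrite -expr2 -real_normK ?num_real //.
  by rewrite ler_pXn2r // nnegrE.
by rewrite !sumr_ord; lra.
Qed.

End Mxdot.

#[local] Hint Extern 0 (is_true (0 <= mxnorm2 _)) => exact: mxnorm2_ge0 : core.

(** * Completion of a substochastic matrix to a doubly stochastic one *)

Section Fill.
Variables (R : realType) (n : nat).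
Implicit Types x q : 'M[R]_n.

(* The row and column deficits have the same total, which makes their
   normalised product the missing mass (there is none when the total is 0). *)
Definition fill x : 'M[R]_n := \matrix_(i, j)
  (x i j + (1 - \sum_l x i l) * (1 - \sum_l x l j) /
           (n%:R - \sum_i' \sum_j' x i' j')).

Lemma fill_tr x : fill x^T = (fill x)^T.
Proof.
apply/matrixP => i j; rewrite !mxE exchange_big /=; congr (_ + _ / (_ - _)).
  rewrite mulrC; congr ((1 - _) * (1 - _)).
    by apply: eq_bigr => l _; rewrite mxE.
  by apply: eq_bigr => l _; rewrite mxE.
by apply: eq_bigr => l _; apply: eq_bigr => l' _; rewrite mxE.
Qed.

Lemma fill_row x i : (forall i, \sum_j x i j <= 1) -> \sum_j fill x i j = 1.
Proof.
move=> r1; under eq_bigr do rewrite mxE.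
rewrite big_split /= -mulr_suml -mulr_sumr sumrB sumr_const card_ord.
rewrite [X in _ * (_ - X)]exchange_big /=.
set D := n%:R - _; have [D0|D0] := eqVneq D 0; last first.
  by rewrite mulfK //; lra.
rewrite D0 mulr0 mul0r addr0; apply/eqP; rewrite eq_sym -subr_eq0.
have /eqP : \sum_i (1 - \sum_j x i j) = 0.
  by rewrite sumrB sumr_const card_ord.
rewrite psumr_eq0 => [/allP/(_ i)|? _]; last by rewrite subr_ge0.
by rewrite mem_index_enum => /(_ isT) /=.
Qed.

Lemma fill_col x j : (forall j, \sum_i x i j <= 1) -> \sum_i fill x i j = 1.
Proof.
move=> c1; have <- : \sum_i fill x^T j i = 1.
  by apply: fill_row => i; under eq_bigr do rewrite mxE.
by apply: eq_bigr => i _; rewrite fill_tr [RHS]mxE.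
Qed.

Lemma fill_ge x i j : (forall i, \sum_j x i j <= 1) ->
  (forall j, \sum_i x i j <= 1) -> x i j <= fill x i j.
Proof.
move=> r1 c1; rewrite mxE lerDl divr_ge0 ?mulr_ge0 ?subr_ge0 //.
by rewrite -[n%:R]mulr1 -sumr_ord; exact: ler_sum.
Qed.

Lemma fill_doubly_stochastic x : (forall i j, 0 <= x i j) ->
  (forall i, \sum_j x i j <= 1) -> (forall j, \sum_i x i j <= 1) ->
  doubly_stochastic (fill x).
Proof.
move=> x0 r1 c1; split=> [i j|i|j]; [|exact: fill_row|exact: fill_col].
by apply: le_trans (x0 i j) _; apply: fill_ge.
Qed.

Lemma fill_neq x i j : fill x i j != x i j ->
  \sum_l x i l != 1 /\ \sum_l x l j != 1.
Proof.
rewrite mxE -subr_eq0 addrAC subrr add0r !mulf_eq0 !negb_or !subr_eq0.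
by rewrite ![1 == _]eq_sym => /andP[/andP[]].
Qed.

End Fill.

(** * MaxWeight against the capacity region *)

Section MaxWeight.
Variables (R : realType) (n : nat) (S : {set 'M[bool]_n}).
Hypothesis hS : S = schedules n \/ S = full_schedules n.
Implicit Types (q a : 'M[nat]_n) (s : 'M[bool]_n) (x : 'M[R]_n).

Definition boolmx s : 'M[R]_n := \matrix_(i, j) (s i j)%:R.

Lemma weightE q s : (weight q s)%:R = mxdot (natmx R q) (boolmx s).
Proof.
rewrite natr_sum; apply: eq_bigr => i _; rewrite natr_sum.
by apply: eq_bigr => j _; rewrite !mxE natrM.
Qed.

Definition perm_schedule (p : {perm 'I_n}) : 'M[bool]_n :=
  \matrix_(i, j) (p i == j).

Lemma perm_schedule_full p : perm_schedule p \in full_schedules n.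
Proof.
rewrite inE; apply/andP; split; apply/forallP => i.
  rewrite (bigD1 (p i)) //= mxE eqxx big1 // => j /negPf.
  by rewrite mxE eq_sym => ->.
rewrite (bigD1 (p^-1%g i)) //= mxE permKV eqxx big1 // => j /negPf.
by rewrite mxE -(inj_eq (@perm_inj _ p) j) permKV => ->.
Qed.

Lemma full_schedules_sub : full_schedules n \subset schedules n.
Proof.
apply/fintype.subsetP => s; rewrite !inE => /andP[/forallP h1 /forallP h2].
apply/andP; split; apply/forallP => i; first by rewrite (eqP (h1 i)).
by rewrite (eqP (h2 i)).
Qed.

Lemma perm_schedule_in p : perm_schedule p \in S.
Proof.
case: hS => ->; last exact: perm_schedule_full.
exact: (fintype.subsetP full_schedules_sub) (perm_schedule_full p).
Qed.

Lemma schedule_le1 s : s \in S ->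
  (forall i, \sum_j s i j <= 1)%N /\ (forall j, \sum_i s i j <= 1)%N.
Proof.
have /fintype.subsetP sub : S \subset schedules n.
  by case: hS => -> //; exact: full_schedules_sub.
by move=> /sub; rewrite inE => /andP[/forallP ? /forallP].
Qed.

Lemma boolmx_rowE s i : \sum_j boolmx s i j = (\sum_j s i j)%:R.
Proof. by rewrite natr_sum; apply: eq_bigr => j _; rewrite mxE. Qed.

Lemma boolmx_colE s j : \sum_i boolmx s i j = (\sum_i s i j)%:R.
Proof. by rewrite natr_sum; apply: eq_bigr => i _; rewrite mxE. Qed.

Lemma boolmx_row_le1 s i : s \in S -> \sum_j boolmx s i j <= 1.
Proof. by move=> sS; rewrite boolmx_rowE (ler_nat _ _ 1) (schedule_le1 sS).1. Qed.

Lemma boolmx_col_le1 s j : s \in S -> \sum_i boolmx s i j <= 1.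
Proof. by move=> sS; rewrite boolmx_colE (ler_nat _ _ 1) (schedule_le1 sS).2. Qed.

Lemma maxweight_sub q s : s \in maxweight S q -> s \in S.
Proof. by rewrite inE => /andP[]. Qed.

Lemma maxweight_nonempty q : (0 < #|maxweight S q|)%N.
Proof.
have h0 := perm_schedule_in 1%g.
case: (@arg_maxnP _ _ (mem S) (weight q) h0) => s sS smax.
apply/card_gt0P; exists s; rewrite inE; apply/andP; split=> //.
by apply/forall_inP => s' /smax.
Qed.

(** Queue lengths are nonnegative, so completing [x] can only increase its weight; some permutation
    weighs at least as much as the completion, and permutation schedules belong to both choices of
    [S]. *)
Lemma maxweight_dominates q s x : s \in maxweight S q -> capacity_region x ->
  mxdot (natmx R q) x <= mxdot (natmx R q) (boolmx s).
Proof.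
move=> sm [x0 xr xc].
have r1 i : \sum_j x i j <= 1 by rewrite -mxdot_row.
have c1 j : \sum_i x i j <= 1 by rewrite -mxdot_col.
have q0 i j : 0 <= natmx R q i j by rewrite mxE.
apply: (@le_trans _ _ (mxdot (natmx R q) (fill x))).
  by apply: ler_mxdot => // i j; apply: fill_ge.
have [p pP] := birkhoff (natmx R q) (fill_doubly_stochastic x0 r1 c1).
apply: le_trans pP _; rewrite -weightE.
have -> : \sum_i natmx R q i (p i) = (weight q (perm_schedule p))%:R.
  rewrite natr_sum; apply: eq_bigr => i _; rewrite natr_sum (bigD1 (p i)) //=.
  rewrite !mxE eqxx muln1 big1 ?addr0 // => j /negPf.
  by rewrite mxE eq_sym => ->; rewrite muln0.
rewrite ler_nat; move: sm; rewrite inE => /andP[_ /forall_inP]; apply.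
exact: perm_schedule_in.
Qed.

(** The completion changes an entry only if its row and its column are both unserved. The link could
    then be added to [s], raising the weight by [q i j], which maximality forces to be 0. Full
    schedules have no unserved row. *)
Lemma fill_maxweight q s i j : s \in maxweight S q ->
  fill (boolmx s) i j != boolmx s i j -> q i j = 0%N.
Proof.
move=> sm /fill_neq[]; rewrite boolmx_rowE boolmx_colE !pnatr_eq1 => r c.
have sS := maxweight_sub sm; have [rows cols] := schedule_le1 sS.
have r0 : (\sum_j s i j = 0)%N.
  by have := rows i; move: r; case: (\sum_j _)%N => [|[]].
have c0 : (\sum_i s i j = 0)%N.
  by have := cols j; move: c; case: (\sum_i _)%N => [|[]].
case: hS => SE; last first.
  by move: sS r; rewrite SE inE => /andP[/forallP/(_ i) ->].
pose s' : 'M[bool]_n := \matrix_(i', j') (s i' j' || ((i', j') == (i, j))).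
have sr j' : s i j' = false.
  by move/eqP: r0; rewrite sum_nat_eq0 => /forallP/(_ j'); case: (s i j').
have sc i' : s i' j = false.
  by move/eqP: c0; rewrite sum_nat_eq0 => /forallP/(_ i'); case: (s i' j).
have s'S : s' \in S.
  rewrite SE inE; apply/andP; split; apply/forallP => l.
    have [->|/negPf li] := eqVneq l i.
      rewrite (bigD1 j) //= big1 ?addn0 ?leq_b1// => j' /negPf.
      by rewrite mxE sr xpair_eqE eqxx /= => ->.
    rewrite (eq_bigr (fun j => s l j : nat)) ?rows // => j' _.
    by rewrite mxE xpair_eqE li orbF.
  have [->|/negPf li] := eqVneq l j.
    rewrite (bigD1 i) //= big1 ?addn0 ?leq_b1// => i' /negPf.
    by rewrite mxE sc xpair_eqE andbC eqxx /= => ->.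
  rewrite (eq_bigr (fun i => s i l : nat)) ?cols // => i' _.
  by rewrite mxE xpair_eqE li andbF orbF.
have : (weight q s' = weight q s + q i j)%N.
  have s'E i' j' : s' i' j' = (s i' j' + ((i' == i) && (j' == j)))%N :> nat.
    rewrite mxE xpair_eqE; have [->|] := eqVneq i' i; last first.
      by rewrite orbF addn0.
    have [->|] := eqVneq j' j; first by rewrite sr.
    by rewrite andbF orbF addn0.
  have -> : q i j = (\sum_i' \sum_j' q i' j' * ((i' == i) && (j' == j)))%N.
    rewrite (bigD1 i) //= (bigD1 j) //= !eqxx muln1.
    rewrite big1 => [|j' /negPf ->]; last by rewrite andbF muln0.
    rewrite big1 ?addn0// => i' /negPf ->.
    by rewrite big1 // => j' _; rewrite muln0.
  rewrite -big_split; apply: eq_bigr => i' _; rewrite -big_split.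
  by apply: eq_bigr => j' _; rewrite s'E mulnDr.
move: sm; rewrite inE => /andP[_ /forall_inP/(_ s' s'S)].
by move=> h h'; move: h; rewrite h'; lia.
Qed.

Lemma mxdot_fill_maxweight q s : s \in maxweight S q ->
  mxdot (natmx R q) (fill (boolmx s)) = mxdot (natmx R q) (boolmx s).
Proof.
move=> sm; apply: eq_bigr => i _; apply: eq_bigr => j _.
have [->//|] := eqVneq (fill (boolmx s) i j) (boolmx s i j).
by move=> /(fill_maxweight sm) q0; rewrite mxE q0 !mul0r.
Qed.

Lemma fill_schedule_ds s : s \in S -> doubly_stochastic (fill (boolmx s)).
Proof.
move=> sS; apply: fill_doubly_stochastic => [i j|i|j].
- by rewrite mxE.
- exact: boolmx_row_le1.
- exact: boolmx_col_le1.
Qed.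

End MaxWeight.

(** * Markov operators and stability *)

Section PositiveOperators.
Variables (R : realType) (X : Type).
Implicit Types (K : (X -> R) -> X -> R) (f g : X -> R).

(** Asked of all real functions, without domain: transition operators here average finitely many
    values. *)
Definition positive_linear K :=
  (forall a f g x, K (fun y => a * f y + g y) x = a * K f x + K g x) /\
  (forall f g, (forall x, f x <= g x) -> forall x, K f x <= K g x).

Definition markov K := positive_linear K /\ forall x, K (fun=> 1) x = 1.

Section Theory.
Variable K : (X -> R) -> X -> R.
Hypothesis plK : positive_linear K.

Lemma pl_le f g : (forall x, f x <= g x) -> forall x, K f x <= K g x.
Proof. exact: plK.2. Qed.

Lemma pl_ext f g : f =1 g -> K f =1 K g.
Proof.
by move=> fg x; apply/eqP; rewrite eq_le !pl_le// => y; rewrite fg.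
Qed.

Lemma pl0 x : K (fun=> 0) x = 0.
Proof.
have := plK.1 1 (fun=> 0) (fun=> 0) x.
rewrite [in RHS]mul1r (pl_ext (g := fun=> 0)); first by lra.
by move=> y; rewrite mul1r addr0.
Qed.

Lemma plD f g x : K (fun y => f y + g y) x = K f x + K g x.
Proof.
rewrite -[K f x]mul1r -plK.1.
by apply: pl_ext => y; rewrite mul1r.
Qed.

Lemma plZ a f x : K (fun y => a * f y) x = a * K f x.
Proof.
rewrite -[RHS]addr0 -[X in _ = _ + X](pl0 x) -plK.1.
by apply: pl_ext => y; rewrite addr0.
Qed.

Lemma plN f x : K (fun y => - f y) x = - K f x.
Proof. by rewrite -mulN1r -plZ; apply: pl_ext => y; rewrite mulN1r. Qed.

Lemma plB f g x : K (fun y => f y - g y) x = K f x - K g x.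
Proof. by rewrite plD plN. Qed.

Lemma pl_sum (I : Type) (r : seq I) (F : I -> X -> R) x :
  K (fun y => \sum_(i <- r) F i y) x = \sum_(i <- r) K (F i) x.
Proof.
elim: r => [|i r IH].
  by rewrite big_nil -[RHS](pl0 x); apply: pl_ext => y; rewrite big_nil.
by rewrite big_cons -IH -plD; apply: pl_ext => y; rewrite big_cons.
Qed.

Lemma pl_ge0 f : (forall x, 0 <= f x) -> forall x, 0 <= K f x.
Proof. by move=> f0 x; rewrite -(pl0 x); apply: pl_le. Qed.

Lemma pl_norm f x : `|K f x| <= K (fun y => `|f y|) x.
Proof.
by rewrite ler_norml -plN !pl_le // => y; rewrite ?ler_norm // lerNl -normrN ler_norm.
Qed.

Lemma pl_iter N : positive_linear (iter N K).
Proof.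
elim: N => [|N [IHl IHm]]; first by split.
split=> [a f g x|f g fg x] /=.
  by rewrite -plK.1; apply: pl_ext => y; rewrite IHl.
by apply: pl_le; exact: IHm.
Qed.

End Theory.

Lemma pl_cst K c : markov K -> forall x, K (fun=> c) x = c.
Proof.
move=> [plK K1] x; rewrite -[RHS]mulr1 -(K1 x) -plZ //.
by apply: pl_ext => // y; rewrite mulr1.
Qed.

Lemma markov_iter K N : markov K -> markov (iter N K).
Proof.
move=> mK; split; first exact: (pl_iter mK.1).
elim: N => //= N IH x; rewrite -[RHS](mK.2 x).
by apply: (pl_ext mK.1).
Qed.

(** [b / (1 - g)] is the fixed point of [c = g * c + b]. *)
Lemma iter_drift K (V : X -> R) (g b : R) : markov K -> 0 <= g < 1 -> 0 <= b ->
  (forall x, 0 <= V x) -> (forall x, K V x <= g * V x + b) ->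
  forall N x, iter N K V x <= g ^+ N * V x + b / (1 - g).
Proof.
move=> mK /andP[g0 g1] b0 V0 drift; elim=> [|N IH] x.
  by rewrite expr0 mul1r lerDl divr_ge0 // subr_ge0 ltW.
rewrite iterSr; have mN := markov_iter N mK.
apply: le_trans (pl_le mN.1 drift x) _.
rewrite mN.1.1 (pl_cst _ mN) exprS -mulrA.
have -> : b / (1 - g) = b + g * (b / (1 - g)) by field; lra.
rewrite addrCA [leLHS]addrC lerD2l -mulrDr ler_wpM2l //.
Qed.

Lemma iter_drift_le K (V : X -> R) (g b : R) : markov K -> 0 <= g < 1 -> 0 <= b ->
  (forall x, 0 <= V x) -> (forall x, K V x <= g * V x + b) ->
  forall N x, iter N K V x <= V x + b / (1 - g).
Proof.
move=> mK g01 b0 V0 drift N x; have /andP[g0 g1] := g01.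
apply: le_trans (iter_drift mK g01 b0 V0 drift N x) _.
by rewrite lerD2r ler_piMl // exprn_ile1 // ltW.
Qed.

End PositiveOperators.

(** * The chain killed at a state *)

Section KilledOperator.
Variables (R : realType) (X : eqType).
Implicit Types (K : (X -> R) -> X -> R) (f g : X -> R).

Definition indic z : X -> R := fun y => (y == z)%:R.

(** Its [N]-th iterate at the constant 1 is the probability that the chain avoids [z] at the times 1
    to [N]; the starting point itself may be [z]. *)
Definition killed K z f : X -> R := K (fun y => (y != z)%:R * f y).

Lemma killed_pl K z : positive_linear K -> positive_linear (killed K z).
Proof.
move=> plK; split=> [a f g x|f g fg x].
  by rewrite /killed -plK.1; apply: (pl_ext plK) => y; rewrite mulrDr mulrCA.
by apply: (pl_le plK) => y; rewrite ler_wpM2l.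
Qed.

Lemma iter_killed_le K z f N : positive_linear K -> (forall x, 0 <= f x) ->
  forall x, iter N (killed K z) f x <= iter N K f x.
Proof.
move=> plK f0; elim: N => //= N IH x.
apply: (@le_trans _ _ (killed K z (iter N K f) x)).
  exact: (pl_le (killed_pl z plK)).
apply: (pl_le plK) => y; rewrite ler_piMl ?lern1 ?leq_b1 //.
exact: (pl_ge0 (pl_iter plK N)).
Qed.

(** Avoiding [z] throughout is less likely than being away from [z] at the last step alone. *)
Lemma iter_killed1 K z N x : markov K ->
  iter N.+1 (killed K z) (fun=> 1) x <= 1 - iter N.+1 K (indic z) x.
Proof.
move=> mK; have plK := mK.1; rewrite !iterSr.
apply: le_trans (iter_killed_le _ _ plK _ x) _.
  by apply: (pl_ge0 (killed_pl z plK)) => y; exact: ler01.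
rewrite -[X in _ <= X - _](pl_cst 1 (markov_iter N mK) x).
have plN := pl_iter plK N; rewrite -plB //; apply: (pl_le plN) => y.
rewrite -[X in _ <= X - _](pl_cst 1 mK y) -plB //; apply: (pl_le plK) => w.
by rewrite mulr1 /indic; case: eqP => _ /=; lra.
Qed.

Section Drift.
Variables (K : (X -> R) -> X -> R) (z : X) (V : X -> R) (gam b : R).
Hypothesis mK : markov K.
Hypothesis gam01 : 0 <= gam < 1.
Hypothesis b0 : 0 <= b.
Hypothesis V0 : forall x, 0 <= V x.
Hypothesis driftV : forall x, K V x <= gam * V x + b.
Hypothesis minor : forall L, exists N, exists2 alpha : R, 0 < alpha &
  forall x, V x <= L -> alpha <= iter N.+1 K (indic z) x.

(** Harris' argument with the weight [1 + beta * V]. Where [V <= L] the mass lost at [z] pays for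
    the additive term of the drift; where [V > L] the drift of [V] does so by itself. *)
Lemma killed_iterate_contracts : exists N beta rho,
  [/\ 0 < beta <= 1, 0 <= rho < 1 &
   forall x, iter N.+1 (killed K z) (fun y => 1 + beta * V y) x <=
             rho * (1 + beta * V x)].
Proof.
have /andP[g0 g1] := gam01; pose c := b / (1 - gam).
have c0 : 0 <= c by rewrite divr_ge0 // subr_ge0 ltW.
have g1' : 0 < 1 - gam by rewrite subr_gt0.
(* [c] bounds the additive drift of any number of steps. This [L] makes [V] lose at least [c + 1]
   above [L], and [beta] below makes [beta * c] at most half of the mass lost at [z]. *)
pose L := (c + 1) / (1 - gam).
have L0 : 0 <= L by rewrite divr_ge0 ?ltW //; lra.
have LE : (1 - gam) * L = c + 1 by rewrite /L; field; lra.
have [N [alpha alpha0 alphaP]] := minor L.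
pose al := Num.min alpha 1.
have al0 : 0 < al by rewrite lt_min alpha0 ltr01.
have al1 : al <= 1 by rewrite ge_min lexx orbT.
pose beta := al / (2 * (c + 1)).
have beta0 : 0 < beta by rewrite divr_gt0 //; lra.
have betaE : beta * (2 * (c + 1)) = al by rewrite /beta; field; lra.
have beta1 : beta <= 1 by rewrite ler_pdivrMr; [lra|lra].
have bL0 : 0 < 1 + beta * L by rewrite ltr_pwDl // mulr_ge0 // ltW.
(* The three bounds serve the constant term where [V <= L], the [V] term, and the region [V > L], in
   this order. *)
pose eta := Num.min (al / 2) (Num.min (1 - gam) (beta / (1 + beta * L))).
have eta0 : 0 < eta by rewrite !lt_min g1' (divr_gt0 beta0 bL0) divr_gt0.
have eta1 : eta <= al / 2 by rewrite ge_min lexx.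
have eta2 : eta <= 1 - gam by rewrite !ge_min lexx orbT.
have eta3 : eta * (1 + beta * L) <= beta.
  by rewrite -ler_pdivlMr // !ge_min lexx !orbT.
exists N, beta, (1 - eta); split; [by rewrite beta0 beta1 | by apply/andP; split; lra |].
move=> x; have plK := mK.1; have plQ := pl_iter (killed_pl z plK) N.+1.
have V_le : iter N.+1 (killed K z) V x <= gam * V x + c.
  apply: le_trans (iter_killed_le _ _ plK V0 x) _.
  apply: le_trans (iter_drift mK gam01 b0 V0 driftV N.+1 x) _.
  rewrite lerD2r ler_wpM2r // exprS ler_piMr //.
  by rewrite exprn_ile1 // ltW.
have QE : iter N.+1 (killed K z) (fun y => 1 + beta * V y) x =
    beta * iter N.+1 (killed K z) V x + iter N.+1 (killed K z) (fun=> 1) x.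
  by rewrite -plQ.1; apply: (pl_ext plQ) => y; rewrite addrC.
rewrite QE; have Q1 := iter_killed1 z N x mK.
have : beta * iter N.+1 (killed K z) V x <= beta * (gam * V x + c).
  by rewrite ler_wpM2l // ltW.
have Vx := V0 x.
have betaV : 0 <= beta * V x by rewrite mulr_ge0 // ltW.
have h2 : eta * (beta * V x) <= (1 - gam) * (beta * V x) by rewrite ler_wpM2r.
have [VL|/ltW VL] := leP (V x) L.
  have := alphaP x VL; have : al <= alpha by rewrite ge_min lexx.
  move: Q1 h2 eta1 betaE beta0; clear=> *; lra.
have I0 : 0 <= iter N.+1 K (indic z) x.
  by apply: (pl_ge0 (pl_iter plK N.+1)) => y; rewrite ler0n.
have h3 : (1 - gam - eta) * (beta * L) <= (1 - gam - eta) * (beta * V x).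
  by rewrite ler_wpM2l ?subr_ge0 // ler_wpM2l // ltW.
have LE' : (1 - gam) * L * beta = (c + 1) * beta by rewrite LE.
move: Q1 I0 h3 LE' eta3; clear=> *; lra.
Qed.

(* Adding up [N + 1] iterates turns the contraction over [N + 1] steps into
   one over a single step. *)
Lemma killed_drift : exists rho C (g : X -> R),
  [/\ 0 <= rho < 1, forall x, 1 + V x <= g x <= C * (1 + V x) &
   forall x, killed K z g x <= rho * g x].
Proof.
have [N [beta [rho [/andP[beta0 beta1] /andP[rho0 rho1] contr]]]] :=
  killed_iterate_contracts.
have /andP[g0 g1] := gam01; pose c := b / (1 - gam).
have c0 : 0 <= c by rewrite divr_ge0 // subr_ge0 ltW.
have plK := mK.1; have plQ := killed_pl z plK.
pose U y := 1 + beta * V y.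
have U0 y : 0 <= U y by rewrite addr_ge0 // mulr_ge0 // ltW.
pose g0' y := \sum_(r < N.+1) iter r (killed K z) U y.
have g0_ge y : U y <= g0' y.
  rewrite /g0' big_ord_recl /= lerDl; apply: sumr_ge0 => r _.
  exact: (pl_ge0 (pl_iter plQ r.+1)).
pose C := N.+1%:R * (1 + c).
have C1 : 1 <= C.
  have N1 : 1 <= N.+1%:R :> R by rewrite ler1n.
  by rewrite -[1]mulr1 ler_pM //; lra.
have g0_le y : g0' y <= C * U y.
  rewrite /g0' /C -mulrA -sumr_ord.
  apply: ler_sum => r _; apply: le_trans (iter_killed_le _ _ plK U0 y) _.
  have mr := markov_iter r mK.
  have -> : iter r K U y = beta * iter r K V y + 1.
    rewrite -[X in _ + X](pl_cst 1 mr y) -mr.1.1.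
    by apply: (pl_ext mr.1) => w; rewrite addrC.
  have : beta * iter r K V y <= beta * (V y + c).
    rewrite ler_wpM2l ?(ltW beta0) //.
    exact: (iter_drift_le mK gam01 b0 V0 driftV).
  have : beta * c <= c by rewrite ler_piMl.
  have : 0 <= c * (beta * V y) by rewrite mulr_ge0 // mulr_ge0 // ltW.
  by rewrite /U; lra.
(* Applying the operator shifts the sum by one: the term [U] is lost and the last iterate, at most
   [rho * U], is gained. *)
have drop y : killed K z g0' y <= g0' y - (1 - rho) * U y.
  have -> : killed K z g0' y = g0' y - U y + iter N.+1 (killed K z) U y.
    rewrite /g0' pl_sum // [in RHS]big_ord_recl [in LHS]big_ord_recr /=.
    by rewrite [U y + _]addrC addrK.
  have := contr y; rewrite -/U -/(U y); set a := iter _ _ _ _.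
  by move: (g0' y) (U y) => *; lra.
(* As [g0' <= C * U], the loss [(1 - rho) * U] is at least the fraction [eta] of [g0']. The factor
   [beta^-1] below only serves to make the function at least [1 + V]. *)
pose eta := (1 - rho) / C.
have C0 : 0 < C by lra.
have eta0 : 0 < eta by rewrite divr_gt0 // subr_gt0.
have eta1 : eta <= 1 by rewrite ler_pdivrMr //; lra.
exists (1 - eta), (C / beta), (fun y => beta^-1 * g0' y).
have ib0 : 0 < beta^-1 by rewrite invr_gt0.
have ib1 : 1 <= beta^-1 by rewrite invf_ge1.
split; first by apply/andP; split; lra.
  move=> y; apply/andP; split.
    apply: (@le_trans _ _ (beta^-1 * U y)); last by rewrite ler_pM2l.
    by rewrite /U mulrDr mulr1 mulKf ?gt_eqF // lerD2r.
  rewrite [C / _]mulrC -mulrA ler_pM2l //; apply: le_trans (g0_le y) _.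
  by rewrite ler_pM2l // /U lerD2l ler_piMl.
move=> y; rewrite plZ // mulrCA ler_pM2l //; apply: le_trans (drop y) _.
suff : eta * g0' y <= (1 - rho) * U y by lra.
rewrite /eta mulrAC -mulrA ler_wpM2l ?subr_ge0 ?(ltW rho1) //.
by rewrite ler_pdivrMr // mulrC.
Qed.

End Drift.
End KilledOperator.

Lemma bound_ge0 (R : realDomainType) (x A w : R) : `|x| <= A * w -> 0 < w -> 0 <= A.
Proof. by move=> /(le_trans (normr_ge0 _)) + w0; rewrite pmulr_lge0. Qed.

Lemma geometric_cauchy_cvg (R : realType) (u : nat -> R) c r :
  0 <= r < 1 -> (forall s t, `|u (s + t)%N - u t| <= c * r ^+ t) ->
  cvg (u t @[t --> \oo]).
Proof.
move=> /andP[r0 r1] uP; apply/cauchy_cvgP/cauchy_exP => e e0.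
have : (c * r ^+ t) @[t --> \oo] --> (0 : R).
  by apply: (cvg_geometric c); rewrite ger0_norm.
move=> /cvgrPdist_lt/(_ e e0) [N _ NP]; exists (u N).
exists N => // t /= Nt; rewrite /ball /= distrC -(subnK Nt).
apply: le_lt_trans (uP _ _) _.
have := NP N (leqnn N); rewrite /= sub0r normrN.
exact: le_lt_trans (ler_norm _).
Qed.

(** * Two independent copies of the chain *)

Section Pairs.
Variables (R : realType) (X : eqType).
Implicit Types (K : (X -> R) -> X -> R) (f g : X -> R) (F : X * X -> R).

Definition pair_op K F : X * X -> R :=
  fun p => K (fun x => K (fun y => F (x, y)) p.2) p.1.

Lemma pair_op_markov K : markov K -> markov (pair_op K).
Proof.
move=> mK; have plK := mK.1; split; first split.
- move=> a F G p; rewrite -plK.1; apply: (pl_ext plK) => x.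
  by rewrite -plK.1; apply: (pl_ext plK).
- move=> F G FG p; apply: (pl_le plK) => x; exact: (pl_le plK).
- move=> p; rewrite -[RHS](pl_cst 1 mK p.1); apply: (pl_ext plK) => x.
  exact: pl_cst.
Qed.

Lemma pair_op_tensor K f g p : positive_linear K ->
  pair_op K (fun q => f q.1 * g q.2) p = K f p.1 * K g p.2.
Proof.
move=> plK; rewrite mulrC -plZ //; apply: (pl_ext plK) => x /=.
by rewrite plZ // mulrC.
Qed.

Lemma iter_pair_op_tensor K f g N p : markov K ->
  iter N (pair_op K) (fun q => f q.1 * g q.2) p =
  iter N K f p.1 * iter N K g p.2.
Proof.
move=> mK; elim: N p => [//|N IH] p /=; rewrite -(pair_op_tensor _ _ _ mK.1).
by apply: (pl_ext (pair_op_markov mK).1) => q; rewrite IH.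
Qed.

Lemma pair_op_sum K f g p : markov K ->
  pair_op K (fun q => f q.1 + g q.2) p = K f p.1 + K g p.2.
Proof.
move=> mK; have plK := mK.1.
rewrite -[K g p.2](pl_cst _ mK p.1) -plD //; apply: (pl_ext plK) => x /=.
by rewrite plD // pl_cst.
Qed.

End Pairs.

Section Ergodic.
Variables (R : realType) (X : eqType).
Variables (K : (X -> R) -> X -> R) (z : X) (V : X -> R) (gam b : R).
Hypothesis mK : markov K.
Hypothesis gam01 : 0 <= gam < 1.
Hypothesis b0 : 0 <= b.
Hypothesis V0 : forall x, 0 <= V x.
Hypothesis driftV : forall x, K V x <= gam * V x + b.
Hypothesis minor : forall L, exists N, exists2 alpha : R, 0 < alpha &
  forall x, V x <= L -> alpha <= iter N.+1 K (indic R z) x.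

(* Two independent copies meet at [z], after which the difference has mean 0. *)
Lemma iterate_difference : exists rho C, [/\ 0 <= rho < 1, 0 <= C &
  forall f A, (forall x, `|f x| <= A * (1 + V x)) -> forall t x y,
  `|iter t K f x - iter t K f y| <= A * C * rho ^+ t * (1 + V x + V y)].
Proof.
have plK := mK.1; have mK2 := pair_op_markov mK.
pose V2 (p : X * X) := V p.1 + V p.2.
have V20 p : 0 <= V2 p by rewrite addr_ge0.
have drift2 p : pair_op K V2 p <= gam * V2 p + (b + b).
  rewrite pair_op_sum // /V2.
  by have := driftV p.1; have := driftV p.2; rewrite mulrDr; lra.
(* A bound on [V2] bounds both coordinates, and independence squares the minorizing constant. *)
have minor2 L : exists N, exists2 alpha : R, 0 < alpha &
    forall p, V2 p <= L -> alpha <= iter N.+1 (pair_op K) (indic R (z, z)) p.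
  have [N [alpha alpha0 aP]] := minor L.
  exists N; exists (alpha ^+ 2); first by rewrite exprn_gt0.
  move=> p pL; have -> : iter N.+1 (pair_op K) (indic R (z, z)) p =
      iter N.+1 K (indic R z) p.1 * iter N.+1 K (indic R z) p.2.
    rewrite -iter_pair_op_tensor //; apply: (pl_ext (markov_iter _ mK2).1).
    by move=> [x y]; rewrite /indic xpair_eqE -natrM mulnb.
  have := V0 p.1; have := V0 p.2; move: pL; rewrite /V2 => *.
  by rewrite expr2 ler_pM ?(ltW alpha0) ?aP //; lra.
have [rho [C [g [rho01 gP contr]]]] :=
  killed_drift mK2 gam01 (addr_ge0 b0 b0) V20 drift2 minor2.
have /andP[rho0 rho1] := rho01.
have C0 : 0 <= C.
  have /andP[h1 h2] := gP (z, z); have v0 := V20 (z, z).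
  have := le_trans (addr_ge0 ler01 v0) (le_trans h1 h2).
  by rewrite pmulr_lge0 // ltr_pwDl.
exists rho, (2 * C); split=> //; first by rewrite mulr_ge0.
move=> f A fA t x y.
have A0 : 0 <= A.
  by apply: bound_ge0 (fA x) _; rewrite ltr_pwDl.
suff H : `|iter t K f x - iter t K f y| <= 2 * A * rho ^+ t * g (x, y).
  apply: le_trans H _; have /andP[_ gle] := gP (x, y).
  have -> : A * (2 * C) * rho ^+ t * (1 + V x + V y) =
    2 * A * rho ^+ t * (C * (1 + V2 (x, y))) by rewrite /V2 /=; ring.
  by rewrite ler_wpM2l // !mulr_ge0 // exprn_ge0.
elim: t x y => [|t IH] x y.
  rewrite expr0 mulr1 /=; have /andP[gge _] := gP (x, y).
  apply: le_trans (ler_normB _ _) _; apply: le_trans (lerD (fA x) (fA y)) _.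
  apply: (@le_trans _ _ (2 * A * (1 + V2 (x, y)))); last first.
    by rewrite ler_wpM2l // mulr_ge0.
  have h1 : 0 <= A * V x by rewrite mulr_ge0.
  have h2 : 0 <= A * V y by rewrite mulr_ge0.
  by rewrite /V2 /=; lra.
pose D (p : X * X) := iter t K f p.1 - iter t K f p.2.
(* [D] vanishes at [(z, z)], so killing the pair there does not change its mean, and the contraction
   of the killed pair applies. *)
have -> : iter t.+1 K f x - iter t.+1 K f y = killed (pair_op K) (z, z) D (x, y).
  have -> : killed (pair_op K) (z, z) D (x, y) = pair_op K D (x, y).
    apply: (pl_ext mK2.1) => p; have [->|] := eqVneq p (z, z).
      by rewrite /D /= subrr mulr0.
    by rewrite mul1r.
  by rewrite /D (pair_op_sum _ (fun y => - _ y)) // plN.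
have plQ := killed_pl (z, z) mK2.1.
apply: le_trans (pl_norm plQ _ _) _.
have -> : 2 * A * rho ^+ t.+1 * g (x, y) =
    2 * A * rho ^+ t * (rho * g (x, y)) by rewrite exprSr; ring.
apply: (@le_trans _ _ (2 * A * rho ^+ t * killed (pair_op K) (z, z) g (x, y))).
  by rewrite -plZ //; apply: (pl_le plQ) => -[u v]; exact: IH.
by rewrite ler_wpM2l // !mulr_ge0 // exprn_ge0.
Qed.

(** The iterate [s + t] at [z] is the mean of the iterate [t] at the position after [s] steps, whose
    mean of [V] is bounded uniformly in [s]. Forgetting the starting point at a geometric rate makes
    the sequence Cauchy, and makes the limit the same from every state. *)
Lemma iterates_cvg f A : (forall x, `|f x| <= A * (1 + V x)) ->
  exists l : R, forall x, iter t K f x @[t --> \oo] --> l.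
Proof.
move=> fA; have [rho [C [rho01 C0 diff]]] := iterate_difference.
have /andP[rho0 rho1] := rho01; pose c := b / (1 - gam).
have A0 : 0 <= A.
  by apply: bound_ge0 (fA z) _; rewrite ltr_pwDl.
have cauchy s t : `|iter (s + t)%N K f z - iter t K f z| <=
    (A * C * (1 + (V z + c) + V z)) * rho ^+ t.
  have ms := markov_iter s mK; have pls := ms.1.
  rewrite iterD -[X in _ - X](pl_cst (iter t K f z) ms z) -plB //.
  apply: le_trans (pl_norm pls _ _) _.
  apply: le_trans (pl_le pls (fun x => diff _ _ fA t x z) z) _.
  rewrite plZ // mulrAC ler_wpM2r ?exprn_ge0 // ler_wpM2l ?mulr_ge0 //.
  rewrite plD // plD // !(pl_cst _ ms) lerD2r lerD2l.
  exact: (iter_drift_le mK gam01 b0 V0 driftV).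
have /cvg_ex [l lP] := geometric_cauchy_cvg rho01 cauchy.
exists l => x; rewrite -[l]addr0.
have -> : (fun t => iter t K f x) = (fun t => iter t K f z) \+
    (fun t => iter t K f x - iter t K f z).
  by apply/funext => t /=; rewrite addrC subrK.
apply: cvgD => //; apply/norm_cvg0P.
pose B := A * C * (1 + V x + V z).
apply: (@squeeze_cvgr _ _ _ _ (fun=> 0) (fun t => B * rho ^+ t)).
- near=> t; rewrite normr_ge0 /=; apply: le_trans (diff _ _ fA t x z) _.
  by rewrite mulrAC.
- exact: cvg_cst.
- by apply: (cvg_geometric B); rewrite ger0_norm.
Unshelve. all: by end_near. Qed.

End Ergodic.

(** * Calculus of the steady-state functional *)

Section SteadyFunctional.
Variables (R : realType) (X : eqType).
Variables (K : (X -> R) -> X -> R) (W : X -> R) (pi : (X -> R) -> R).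
Hypothesis mK : markov K.
Hypothesis W1 : forall x, 1 <= W x.

Definition dominated (f : X -> R) := exists A, forall x, `|f x| <= A * W x.

(** Nothing is said of [pi] on functions that are not dominated, hence the domination premises of
    the rules below. *)
Definition steady_functional := forall f, dominated f ->
  forall x, iter t K f x @[t --> \oo] --> pi f.

Hypothesis piP : steady_functional.

Lemma dominated_le f g : dominated g -> (forall x, `|f x| <= g x) -> dominated f.
Proof.
move=> [A gA] fg; exists A => x; apply: le_trans (fg x) _.
exact: le_trans (ler_norm _) _.
Qed.

Lemma dominated_cst c : dominated (fun=> c).
Proof. by exists `|c| => x; rewrite ler_peMr. Qed.

Lemma dominatedZ a f : dominated f -> dominated (fun x => a * f x).
Proof.
move=> [A fA]; exists (`|a| * A) => x.
by rewrite normrM -mulrA ler_wpM2l.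
Qed.

Lemma dominatedD f g : dominated f -> dominated g ->
  dominated (fun x => f x + g x).
Proof.
move=> [A fA] [B gB]; exists (A + B) => x.
by apply: le_trans (ler_normD _ _) _; rewrite mulrDl lerD.
Qed.

Lemma dominated_lin a f g : dominated f -> dominated g ->
  dominated (fun x => a * f x + g x).
Proof. by move=> df dg; apply: dominatedD => //; exact: dominatedZ. Qed.

Lemma dominatedN f : dominated f -> dominated (fun x => - f x).
Proof. by move=> [A fA]; exists A => x; rewrite normrN. Qed.

Lemma dominatedB f g : dominated f -> dominated g ->
  dominated (fun x => f x - g x).
Proof. by move=> df dg; apply: dominatedD => //; exact: dominatedN. Qed.

Hypothesis x0 : X.

Lemma steady_unique f l : dominated f ->
  iter t K f x0 @[t --> \oo] --> l -> pi f = l.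
Proof.
move=> df fl; apply: (@cvg_unique _ _ (iter t K f x0 @[t --> \oo])) => //.
exact: piP.
Qed.

Lemma steady_ext f g : f =1 g -> pi f = pi g.
Proof. by move=> /funext ->. Qed.

Lemma steady_lin a f g : dominated f -> dominated g ->
  pi (fun x => a * f x + g x) = a * pi f + pi g.
Proof.
move=> df dg; apply: steady_unique; first exact: dominated_lin.
have -> : (fun t => iter t K (fun x => a * f x + g x) x0) =
    (fun t => a * iter t K f x0 + iter t K g x0).
  by apply/funext => t; rewrite (pl_iter mK.1 t).1.
by apply: cvgD; [apply: cvgMr; exact: piP | exact: piP].
Qed.

Lemma steady_cst c : pi (fun=> c) = c.
Proof.
apply: steady_unique; first exact: dominated_cst.
have -> : (fun t => iter t K (fun=> c) x0) = (fun=> c).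
  by apply/funext => t; rewrite pl_cst //; exact: markov_iter.
exact: cvg_cst.
Qed.

Lemma steadyZ a f : dominated f -> pi (fun x => a * f x) = a * pi f.
Proof.
move=> df; rewrite -[RHS]addr0 -[X in _ + X](steady_cst 0) -steady_lin //.
  by apply: steady_ext => x; rewrite addr0.
exact: dominated_cst.
Qed.

Lemma steadyD f g : dominated f -> dominated g ->
  pi (fun x => f x + g x) = pi f + pi g.
Proof.
move=> df dg; rewrite -[pi f]mul1r -steady_lin //.
by apply: steady_ext => x; rewrite mul1r.
Qed.

Lemma steadyN f : dominated f -> pi (fun x => - f x) = - pi f.
Proof.
by move=> df; rewrite -mulN1r -steadyZ //; apply: steady_ext => x; rewrite mulN1r.
Qed.

Lemma steadyB f g : dominated f -> dominated g ->
  pi (fun x => f x - g x) = pi f - pi g.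
Proof.
by move=> df dg; rewrite steadyD ?steadyN //; exact: dominatedN.
Qed.

Lemma steady_le f g : dominated f -> dominated g ->
  (forall x, f x <= g x) -> pi f <= pi g.
Proof.
move=> df dg fg; apply: (ler_cvg_to (piP df x0) (piP dg x0)).
by near=> t; apply: (pl_le (pl_iter mK.1 t)).
Unshelve. all: by end_near. Qed.

Lemma steady_ge0 f : dominated f -> (forall x, 0 <= f x) -> 0 <= pi f.
Proof.
by move=> df f0; rewrite -(steady_cst 0); apply: steady_le => //; exact: dominated_cst.
Qed.

Lemma steady_norm_le f g : dominated f -> dominated g ->
  (forall x, `|f x| <= g x) -> `|pi f| <= pi g.
Proof.
move=> df dg fg; rewrite ler_norml lerNl -steadyN //; apply/andP; split.
  apply: steady_le => // [|x]; first exact: dominatedN.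
  by apply: le_trans (fg x); rewrite -normrN ler_norm.
by apply: steady_le => // x; exact: le_trans (ler_norm _) (fg x).
Qed.

Lemma steady_invariant f : dominated f -> dominated (K f) -> pi (K f) = pi f.
Proof.
move=> df dKf; apply: steady_unique => //.
have -> : (fun t => iter t K (K f) x0) = (fun t => iter t.+1 K f x0).
  by apply/funext => t; rewrite iterSr.
by have := piP df x0; rewrite -cvg_shiftS.
Qed.

End SteadyFunctional.

(** * One slot of the switch as a finite average *)

Section SwitchOperator.
Variables (R : realType) (n amax : nat) (S : {set 'M[bool]_n}).
Hypothesis hS : S = schedules n \/ S = full_schedules n.
Variable p : 'I_n -> 'I_n -> 'I_amax.+1 -> R.
Hypothesis p_ge0 : forall i j l, 0 <= p i j l.
Hypothesis p_sum1 : forall i j, \sum_l p i j l = 1.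

Implicit Types (q a : 'M[nat]_n) (s : 'M[bool]_n) (u v x : 'M[R]_n).

(** The arrivals of one slot as a point of a finite type: the bound [amax] makes every expectation
    over a slot a finite sum. *)
Definition outcome := {ffun 'I_n * 'I_n -> 'I_amax.+1}.

Definition arrivals (m : outcome) : 'M[nat]_n := \matrix_(i, j) (m (i, j) : nat).

Definition outcome_prob (m : outcome) : R := \prod_c p c.1 c.2 (m c).

Definition rate : 'M[R]_n := \matrix_(i, j) \sum_l p i j l * l%:R.

Definition rate_var : 'M[R]_n :=
  \matrix_(i, j) \sum_l p i j l * (l%:R - rate i j) ^+ 2.

Definition mean_arrivals (g : 'M[nat]_n -> R) : R :=
  \sum_m outcome_prob m * g (arrivals m).

Definition mean_slot q (G : 'M[bool]_n -> 'M[nat]_n -> R) : R :=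
  \sum_(s in maxweight S q) #|maxweight S q|%:R^-1 * mean_arrivals (G s).

Definition queue_op (f : 'M[nat]_n -> R) : 'M[nat]_n -> R :=
  fun q => mean_slot q (fun s a => f (next_queue q a s)).

Lemma outcome_prob_ge0 m : 0 <= outcome_prob m.
Proof. by apply: prodr_ge0 => c _. Qed.

(** Independence of the entries, as distributivity of a product over sums. Total mass, marginals and
    covariances all come from it. *)
Lemma mean_arrivals_prod (g : 'I_n * 'I_n -> 'I_amax.+1 -> R) :
  \sum_m outcome_prob m * \prod_c g c (m c) =
  \prod_c \sum_l p c.1 c.2 l * g c l.
Proof.
by rewrite bigA_distr_bigA; apply: eq_bigr => m _; rewrite -big_split.
Qed.

Lemma outcome_prob_sum1 : \sum_m outcome_prob m = 1.
Proof.
transitivity (\sum_m outcome_prob m * \prod_(c : 'I_n * 'I_n) 1).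
  by apply: eq_bigr => m _; rewrite big1 ?mulr1.
rewrite (mean_arrivals_prod (fun _ _ => 1)).
by apply: big1 => c _; rewrite -[RHS](p_sum1 c.1 c.2); apply: eq_bigr => l _; rewrite mulr1.
Qed.

Lemma mean_arrivals_lin c f g :
  mean_arrivals (fun a => c * f a + g a) = c * mean_arrivals f + mean_arrivals g.
Proof.
rewrite /mean_arrivals mulr_sumr -big_split; apply: eq_bigr => m _ /=.
by rewrite mulrDr mulrCA.
Qed.

Lemma mean_arrivals_cst c : mean_arrivals (fun=> c) = c.
Proof. by rewrite /mean_arrivals -mulr_suml outcome_prob_sum1 mul1r. Qed.

Lemma mean_arrivals_ext f g : f =1 g -> mean_arrivals f = mean_arrivals g.
Proof. by move=> /funext ->. Qed.

Lemma mean_arrivals_sum (I : Type) (r : seq I) (F : I -> 'M[nat]_n -> R) :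
  mean_arrivals (fun a => \sum_(i <- r) F i a) =
  \sum_(i <- r) mean_arrivals (F i).
Proof.
rewrite /mean_arrivals exchange_big; apply: eq_bigr => m _.
by rewrite mulr_sumr.
Qed.

Lemma mean_arrivalsZ c f : mean_arrivals (fun a => c * f a) = c * mean_arrivals f.
Proof.
by rewrite /mean_arrivals mulr_sumr; apply: eq_bigr => m _; rewrite mulrCA.
Qed.

Lemma mean_arrivals_entry i j (h : nat -> R) :
  mean_arrivals (fun a => h (a i j)) = \sum_l p i j l * h l.
Proof.
pose F (c : 'I_n * 'I_n) (l : 'I_amax.+1) := if c == (i, j) then h l else 1.
transitivity (\prod_c \sum_l p c.1 c.2 l * F c l).
  rewrite -mean_arrivals_prod; apply: eq_bigr => m _.
  rewrite (bigD1 (i, j)) //= {1}/F eqxx big1 ?mulr1 ?mxE //.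
  by move=> c /negPf cE; rewrite /F cE.
rewrite (bigD1 (i, j)) //= [X in _ * X]big1 => [|c /negPf cE].
  by rewrite mulr1; apply: eq_bigr => l _; rewrite /F eqxx.
rewrite -[RHS](p_sum1 c.1 c.2).
by apply: eq_bigr => l _; rewrite /F cE mulr1.
Qed.

Lemma mean_arrivals_entry2 i j k l (h h' : nat -> R) : (i, j) != (k, l) ->
  mean_arrivals (fun a => h (a i j) * h' (a k l)) =
  (\sum_m p i j m * h m) * (\sum_m p k l m * h' m).
Proof.
move=> ne; have ne' : (k, l) != (i, j) by rewrite eq_sym.
pose F (c : 'I_n * 'I_n) (m : 'I_amax.+1) :=
  if c == (i, j) then h m else if c == (k, l) then h' m else 1.
transitivity (\prod_c \sum_m p c.1 c.2 m * F c m).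
  rewrite -mean_arrivals_prod; apply: eq_bigr => m _.
  rewrite (bigD1 (i, j)) //= (bigD1 (k, l)) //= {1 2}/F !eqxx (negPf ne').
  rewrite big1 ?mulr1 ?mxE //.
  by move=> c /andP[/negPf c1 /negPf c2]; rewrite /F c1 c2.
rewrite (bigD1 (i, j)) //= (bigD1 (k, l)) //=.
rewrite [X in _ * (_ * X)]big1 => [|c /andP[/negPf c1 /negPf c2]].
  rewrite mulr1; congr (_ * _); apply: eq_bigr => m _; rewrite /F eqxx //.
  by rewrite (negPf ne').
rewrite -[RHS](p_sum1 c.1 c.2).
by apply: eq_bigr => m _; rewrite /F c1 c2 mulr1.
Qed.

Lemma mean_arrivals_centered i j :
  \sum_l p i j l * (l%:R - rate i j) = 0.
Proof.
under eq_bigr do rewrite mulrBr; rewrite sumrB -mulr_suml p_sum1 mul1r.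
by rewrite mxE subrr.
Qed.

Lemma mean_arrivals_cov i j k l :
  mean_arrivals (fun a => (natmx R a - rate) i j * (natmx R a - rate) k l) =
  ((i, j) == (k, l))%:R * rate_var i j.
Proof.
have [e|ne] := eqVneq (i, j) (k, l).
  case: e => <- <-; rewrite mul1r [RHS]mxE.
  rewrite -(mean_arrivals_entry i j (fun m => (m%:R - rate i j) ^+ 2)).
  by apply: mean_arrivals_ext => a; rewrite expr2 !mxE.
rewrite mul0r -[RHS](mul0r (\sum_m p k l m * (m%:R - rate k l))).
rewrite -[X in X * _](mean_arrivals_centered i j).
rewrite -(mean_arrivals_entry2 (fun m => m%:R - rate i j) (fun m => m%:R - rate k l)) //.
by apply: mean_arrivals_ext => a; rewrite !mxE.
Qed.

Lemma mxdot_pair x y : mxdot x y = \sum_c x c.1 c.2 * y c.1 c.2.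
Proof. by rewrite /mxdot pair_bigA. Qed.

Lemma mean_arrivals_dot u : mean_arrivals (fun a => mxdot (natmx R a) u) = mxdot rate u.
Proof.
rewrite (mean_arrivals_ext (g := fun a => \sum_c u c.1 c.2 * natmx R a c.1 c.2)).
  rewrite mean_arrivals_sum mxdot_pair; apply: eq_bigr => c _.
  rewrite mean_arrivalsZ mulrC; congr (_ * _); rewrite mxE.
  rewrite -(mean_arrivals_entry c.1 c.2 (fun m => m%:R)).
  by apply: mean_arrivals_ext => a; rewrite mxE.
by move=> a; rewrite mxdot_pair; apply: eq_bigr => c _; rewrite mulrC.
Qed.

Lemma mean_arrivals_dot2 u v :
  mean_arrivals (fun a => mxdot (natmx R a - rate) u * mxdot (natmx R a - rate) v) =
  \sum_i \sum_j rate_var i j * (u i j * v i j).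
Proof.
pose F (c d : 'I_n * 'I_n) a := u c.1 c.2 * v d.1 d.2 *
  ((natmx R a - rate) c.1 c.2 * (natmx R a - rate) d.1 d.2).
rewrite (mean_arrivals_ext (g := fun a => \sum_c \sum_d F c d a)); last first.
  move=> a; rewrite !mxdot_pair mulr_suml; apply: eq_bigr => c _.
  by rewrite mulr_sumr; apply: eq_bigr => d _; rewrite /F; ring.
rewrite mean_arrivals_sum [RHS]pair_bigA; apply: eq_bigr => c _ /=.
rewrite mean_arrivals_sum (bigD1 c) //= big1 ?addr0.
  rewrite mean_arrivalsZ mean_arrivals_cov -surjective_pairing eqxx mul1r.
  by rewrite mulrC.
move=> d /negPf dc; rewrite mean_arrivalsZ mean_arrivals_cov.
by rewrite -!surjective_pairing eq_sym dc mul0r mulr0.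
Qed.

Lemma maxweight_mass q : \sum_(s in maxweight S q) #|maxweight S q|%:R^-1 = 1 :> R.
Proof.
rewrite sumr_const -[_ *+ _]mulr_natl divff // pnatr_eq0 -lt0n.
exact: maxweight_nonempty.
Qed.

Lemma mean_slot_lin q c G H :
  mean_slot q (fun s a => c * G s a + H s a) = c * mean_slot q G + mean_slot q H.
Proof.
rewrite /mean_slot mulr_sumr -big_split; apply: eq_bigr => s _ /=.
by rewrite mean_arrivals_lin mulrDr mulrCA.
Qed.

Lemma mean_slot_le q G H :
  (forall s a, s \in maxweight S q -> (forall i j, (a i j <= amax)%N) ->
     G s a <= H s a) -> mean_slot q G <= mean_slot q H.
Proof.
move=> GH; apply: ler_sum => s sq; rewrite ler_wpM2l ?invr_ge0 //.
apply: ler_sum => m _; rewrite ler_wpM2l ?outcome_prob_ge0 //.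
by apply: GH => // i j; rewrite mxE -ltnS ltn_ord.
Qed.

Lemma mean_slot_ext q G H :
  (forall s a, s \in maxweight S q -> (forall i j, (a i j <= amax)%N) ->
     G s a = H s a) -> mean_slot q G = mean_slot q H.
Proof.
move=> GH; apply/eqP; rewrite eq_le.
by apply/andP; split; apply: mean_slot_le => s a sq am; rewrite GH.
Qed.

Lemma mean_slot_arrivals q g : mean_slot q (fun=> g) = mean_arrivals g.
Proof. by rewrite /mean_slot -mulr_suml maxweight_mass mul1r. Qed.

Lemma mean_slot_cst q c : mean_slot q (fun _ _ => c) = c.
Proof. by rewrite mean_slot_arrivals mean_arrivals_cst. Qed.

Lemma mean_slotZ q c G : mean_slot q (fun s a => c * G s a) = c * mean_slot q G.
Proof.
rewrite -[RHS]addr0 -[X in _ = _ + X](mean_slot_cst q 0) -mean_slot_lin.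
by apply: mean_slot_ext => s a _ _; rewrite addr0.
Qed.

Lemma mean_slotD q G H :
  mean_slot q (fun s a => G s a + H s a) = mean_slot q G + mean_slot q H.
Proof.
rewrite -[mean_slot q G]mul1r -mean_slot_lin.
by apply: mean_slot_ext => s a _ _; rewrite mul1r.
Qed.

Lemma mean_slot_sum q (I : Type) (r : seq I) F :
  mean_slot q (fun s a => \sum_(i <- r) F i s a) =
  \sum_(i <- r) mean_slot q (F i).
Proof.
elim: r => [|i r IH].
  rewrite big_nil -[RHS](mean_slot_cst q 0).
  by apply: mean_slot_ext => s a _ _; rewrite big_nil.
rewrite big_cons -IH -mean_slotD.
by apply: mean_slot_ext => s a _ _; rewrite big_cons.
Qed.

Lemma mean_slot_dot q u : mean_slot q (fun _ a => mxdot (natmx R a) u) = mxdot rate u.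
Proof. by rewrite mean_slot_arrivals mean_arrivals_dot. Qed.

Lemma mean_slot_dot2 q u v :
  mean_slot q (fun _ a => mxdot (natmx R a - rate) u * mxdot (natmx R a - rate) v) =
  \sum_i \sum_j rate_var i j * (u i j * v i j).
Proof. by rewrite mean_slot_arrivals mean_arrivals_dot2. Qed.

Lemma queue_op_markov : markov queue_op.
Proof.
split; first split=> [a f g q|f g fg q]; first exact: mean_slot_lin.
  by apply: mean_slot_le => s a _ _.
by move=> q; exact: mean_slot_cst.
Qed.

Section Slot.
Variables (q : 'M[nat]_n) (s : 'M[bool]_n) (a : 'M[nat]_n).
Hypothesis sq : s \in maxweight S q.
Hypothesis a_le : forall i j, (a i j <= amax)%N.

Local Notation q' := (natmx R (next_queue q a s)).

(* Relative to the completed schedule. *)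
Definition unused : 'M[R]_n :=
  q' - natmx R q - natmx R a + fill (boolmx R s).

Lemma next_queueE :
  q' = natmx R q + natmx R a - fill (boolmx R s) + unused.
Proof.
by apply/matrixP => i j; rewrite ![in RHS]mxE ![in LHS]mxE; ring.
Qed.

Lemma fill_neq_schedule i j : fill (boolmx R s) i j != boolmx R s i j ->
  q i j = 0%N /\ s i j = false.
Proof.
move=> ne; split; first exact: (fill_maxweight hS sq ne).
have [r _] := fill_neq ne; move: r; rewrite boolmx_rowE pnatr_eq1.
have := (schedule_le1 hS (maxweight_sub sq)).1 i.
rewrite (bigD1 j) //=; case: (s i j) => //=.
by case: (\sum_(_ < _ | _) _)%N.
Qed.

Lemma unusedP i j : [/\ 0 <= unused i j <= 1, natmx R q i j * unused i j = 0 &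
  q' i j * unused i j <= amax%:R * unused i j].
Proof.
have dsf := fill_schedule_ds R hS (maxweight_sub sq).
have f1 := doubly_stochastic_le1 i j dsf; have [f0 _ _] := dsf.
have {}f0 := f0 i j.
have uE : unused i j = (q i j + a i j - s i j)%N%:R - (q i j)%:R - (a i j)%:R
    + fill (boolmx R s) i j by rewrite /unused; set f := fill _; rewrite !mxE.
have qE : natmx R q i j = (q i j)%:R by rewrite mxE.
have nE : q' i j = (q i j + a i j - s i j)%N%:R.
  by rewrite 2!mxE.
have aA : (a i j)%:R <= amax%:R :> R by rewrite ler_nat.
have [fE|/fill_neq_schedule [q0 s0]] :=
    eqVneq (fill (boolmx R s) i j) (boolmx R s i j); last first.
  have -> : unused i j = fill (boolmx R s) i j.
    by rewrite uE q0 s0 add0n subn0 subr0 subrr add0r.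
  rewrite qE nE q0 s0 add0n subn0 mul0r f0 f1.
  by split=> //; rewrite ler_wpM2r.
have {}uE : unused i j = (q i j + a i j < s i j)%N%:R.
  rewrite uE fE mxE; case: ltnP => [lt|le]; last by rewrite natrB // natrD mulr0n; ring.
  have [-> -> ->] : [/\ q i j = 0, a i j = 0 & s i j = true :> nat]%N.
    by move: lt; case: (s i j) => /=; split; lia.
  by rewrite !subr0 add0r.
rewrite uE qE nE; case: ltnP => [lt|_]; last by rewrite !mulr0 lexx ler01.
have [-> ->] : q i j = 0%N /\ a i j = 0%N by move: lt; case: (s i j) => /=; lia.
by rewrite !mul0r lexx ler01 mulr1.
Qed.

Lemma increment_le i j :
  `|(q' - natmx R q) i j| <= amax.+1%:R.
Proof.
rewrite !mxE; have := a_le i j; rewrite -(ler_nat R); case: (s i j) => /=.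
  rewrite subn1; case: (q i j) => [|k].
    move=> _; rewrite add0n subr0 ger0_norm // ler_nat.
    by move: (a_le i j); clear; lia.
  rewrite addSn /= natrD -(natr1 k) -(natr1 amax) => h.
  have a0 : 0 <= (a i j)%:R :> R by [].
  by rewrite ler_norml; apply/andP; split; lra.
rewrite subn0 natrD -(natr1 amax) addrAC subrr add0r => h.
by rewrite ger0_norm //; lra.
Qed.

(** Truncation at 0 only decreases the square of an entry, and the untruncated increment [a - s] is
    bounded by [amax.+1] entrywise. *)
Lemma sqr_next_queue_le : mxdot q' q' <=
  mxdot (natmx R q) (natmx R q) + 2 * mxdot (natmx R q) (natmx R a - boolmx R s) +
  (n%:R * amax.+1%:R) ^+ 2.
Proof.
have dle : mxdot (natmx R a - boolmx R s) (natmx R a - boolmx R s) <=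
    (n%:R * amax.+1%:R) ^+ 2.
  apply: mxdot_self_le => // i j; rewrite !mxE.
  have := a_le i j; rewrite -(ler_nat R) -(natr1 amax).
  have a0 : 0 <= (a i j)%:R :> R by [].
  by case: (s i j) => /= h; rewrite ler_norml; apply/andP; split; lra.
pose w := natmx R q + (natmx R a - boolmx R s).
have : mxdot q' q' <= mxdot w w.
  do 2![apply: ler_sum => ? _]; rewrite -!expr2 !mxE.
  set i := (X in q X _); set j := (X in q _ X).
  have [le|lt] := leqP (s i j) (q i j + a i j).
    by rewrite natrB // natrD addrA.
  by rewrite (eqP (ltnW lt : _ - _ == 0)%N) expr0n sqr_ge0.
rewrite /w; move: (natmx R a - boolmx R s) dle => d dle.
by rewrite mxdotDl !mxdotDr (mxdotC d (natmx R q)); lra.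
Qed.

End Slot.
End SwitchOperator.

(** * Cauchy-Schwarz and the Euclidean norm of matrices *)

Section MatrixNorm.
Variables (R : realType) (n : nat).
Implicit Types x y : 'M[R]_n.

Lemma mxdot_le_norm x y : mxdot x y <= mxnorm2 x * mxnorm2 y.
Proof.
have norm0 u v : mxnorm2 u = 0 -> mxdot u v = 0.
  move=> u0; apply: big1 => i _; apply: big1 => j _.
  have := entry_le_mxnorm2 u i j; rewrite u0 normr_le0 => /eqP ->.
  by rewrite mul0r.
have [x0|x0] := eqVneq (mxnorm2 x) 0; first by rewrite norm0 // x0 mul0r.
have [y0|y0] := eqVneq (mxnorm2 y) 0.
  by rewrite mxdotC norm0 // y0 mulr0.
have xp : 0 < mxnorm2 x by rewrite lt_def x0 mxnorm2_ge0.
have yp : 0 < mxnorm2 y by rewrite lt_def y0 mxnorm2_ge0.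
have := mxdot_self_ge0 (mxnorm2 y *: x - mxnorm2 x *: y).
rewrite mxdotBl !mxdotBr !mxdotZl !mxdotZr -!sqr_mxnorm2 (mxdotC y x).
have -> : mxnorm2 y * (mxnorm2 y * mxnorm2 x ^+ 2) -
  mxnorm2 y * (mxnorm2 x * mxdot x y) -
  (mxnorm2 x * (mxnorm2 y * mxdot x y) -
   mxnorm2 x * (mxnorm2 x * mxnorm2 y ^+ 2)) =
  2 * (mxnorm2 x * mxnorm2 y) * (mxnorm2 x * mxnorm2 y - mxdot x y) by ring.
by rewrite pmulr_rge0 ?subr_ge0 // !mulr_gt0.
Qed.

Lemma mxdot_norm_le x y : `|mxdot x y| <= mxnorm2 x * mxnorm2 y.
Proof.
rewrite ler_norml mxdot_le_norm andbT lerNl -mxdotNl.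
by apply: le_trans (mxdot_le_norm _ _) _; rewrite {1}/mxnorm2 mxdotNl mxdotNr opprK.
Qed.

Lemma mxnorm2_le x c : 0 <= c -> mxdot x x <= c ^+ 2 -> mxnorm2 x <= c.
Proof.
by move=> c0; rewrite -sqr_mxnorm2 ler_pXn2r // nnegrE.
Qed.

Lemma mxnorm2D x y : mxnorm2 (x + y) <= mxnorm2 x + mxnorm2 y.
Proof.
apply: mxnorm2_le; first by rewrite addr_ge0.
rewrite mxdotDl !mxdotDr (mxdotC y x) -!sqr_mxnorm2.
by have := mxdot_le_norm x y; lra.
Qed.

Lemma mxnorm2_entries x c : 0 <= c -> (forall i j, `|x i j| <= c) ->
  mxnorm2 x <= n%:R * c.
Proof.
move=> c0 xc; apply: mxnorm2_le; first by rewrite mulr_ge0.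
exact: mxdot_self_le.
Qed.

Lemma mxnorm2_le_sum x : (forall i j, 0 <= x i j) ->
  mxnorm2 x <= mxdot x (const_mx 1).
Proof.
move=> x0; have [z|nz] := eqVneq (mxnorm2 x) 0.
  by rewrite z; apply: mxdot_ge0 => // i j; rewrite mxE.
have xp : 0 < mxnorm2 x by rewrite lt_def nz mxnorm2_ge0.
rewrite -(ler_pM2l xp) -expr2 sqr_mxnorm2 -mxdotZr.
apply: ler_mxdot => // i j; rewrite !mxE mulr1.
exact: le_trans (ler_norm _) (entry_le_mxnorm2 _ _ _).
Qed.

End MatrixNorm.

Lemma finite_lower_bound (R : realType) (I : finType) (f : I -> R) :
  (forall i, 0 < f i) -> exists2 r, 0 < r & forall i, r <= f i.
Proof.
move=> f0; exists (\big[Num.min/1]_i f i).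
  by elim/big_ind: _ => // x y x0 y0; rewrite lt_min x0.
by move=> i; rewrite (bigD1 i) //= ge_min lexx.
Qed.

(** From [1 - u <= expR (- u)], [expR u] is at most the inverse of [1 - u], and [(1 + u + 2 u^2) (1
    - u) = 1 + u^2 (1 - 2 u)] is at least 1. *)
Lemma expR_le_quad (R : realType) (u : R) : `|u| <= 1 / 2 ->
  expR u <= 1 + u + 2 * u ^+ 2.
Proof.
rewrite ler_norml => /andP[u1 u2].
have := expR_ge1Dx (- u); rewrite expRN => h.
have e0 := expR_gt0 u.
have : expR u * (1 - u) <= 1.
  by rewrite -[leRHS](mulfV (lt0r_neq0 e0)) ler_wpM2l // ltW.
have p : 0 < 1 - u by lra.
rewrite -ler_pdivlMr // => h'; apply: le_trans h' _.
rewrite ler_pdivrMr //.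
have : 0 <= u ^+ 2 * (1 - 2 * u) by rewrite mulr_ge0 ?sqr_ge0 //; lra.
by rewrite expr2; lra.
Qed.

(** * Norms and weights of queue lengths *)

Section QueueNorm.
Variables (R : realType) (n : nat).

Definition qnorm (q : 'M[nat]_n) : R := mxnorm2 (natmx R q).

(** Degree 4 is what admits the fourth power of the distance to the cone as a test function. *)
Definition qweight (q : 'M[nat]_n) : R := (1 + qnorm q) ^+ 4.

Definition exp_norm (th : R) (q : 'M[nat]_n) : R := expR (th * qnorm q).

Lemma qnorm_ge0 q : 0 <= qnorm q. Proof. exact: mxnorm2_ge0. Qed.

Lemma natmx_ge0 (q : 'M[nat]_n) i j : 0 <= natmx R q i j.
Proof. by rewrite mxE. Qed.

Lemma qweight_ge1 q : 1 <= qweight q.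
Proof. by rewrite exprn_ege1 // lerDl qnorm_ge0. Qed.

(** The fourth power of [1 + x <= (4 / th) * expR (th * x / 4)], which follows from
    [1 + y <= expR y] and [th <= 1]. *)
Lemma qweight_le_exp th : 0 < th <= 1 ->
  forall q, qweight q <= (4 / th) ^+ 4 * (1 + exp_norm th q).
Proof.
move=> /andP[th0 th1] q; have q0 := qnorm_ge0 q.
apply: (@le_trans _ _ ((4 / th) ^+ 4 * exp_norm th q)); last first.
  by rewrite ler_wpM2l ?lerDr // exprn_ge0 // divr_ge0 // ltW.
have -> : exp_norm th q = expR (th * qnorm q / 4) ^+ 4.
  by rewrite -expRM_natl /exp_norm; congr expR; field.
rewrite -exprMn ler_pXn2r ?nnegrE ?addr_ge0 //; last first.
  by rewrite mulr_ge0 ?expR_ge0 // divr_ge0 // ltW.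
apply: (@le_trans _ _ (4 / th * (1 + th * qnorm q / 4))).
  have -> : 4 / th * (1 + th * qnorm q / 4) = 4 / th + qnorm q.
    by field; rewrite gt_eqF.
  by rewrite lerD2r ler_pdivlMr //; lra.
by rewrite ler_wpM2l ?expR_ge1Dx // divr_ge0 // ltW.
Qed.

End QueueNorm.

#[local] Hint Extern 0 (is_true (0 <= qnorm _ _)) => exact: qnorm_ge0 : core.

Section QueueWeight.
Variables (R : realType) (n : nat).
Local Notation W := (@qweight R n).

(** The additional factor [1 + qnorm] is a margin of growth: it controls the tails when the steady
    functional is later written as a sum over states. *)
Lemma bounded_dominated1 (f : 'M[nat]_n -> R) M : (forall x, `|f x| <= M) ->
  dominated W (fun x => `|f x| * (1 + qnorm R x)).
Proof.
move=> fM; exists M => x.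
have x1 : 1 <= 1 + qnorm R x by rewrite lerDl.
rewrite normrM normr_id ler_pM // ger0_norm ?addr_ge0 //.
by rewrite /qweight ler_eXnr.
Qed.

Lemma dominated1 (f : 'M[nat]_n -> R) :
  dominated W (fun x => `|f x| * (1 + qnorm R x)) -> dominated W f.
Proof. by move=> df; apply: (dominated_le df) => x; rewrite ler_peMr // lerDl. Qed.

Lemma linear_dominated1 (u : 'M[R]_n) :
  dominated W (fun q => `|mxdot (natmx R q) u| * (1 + qnorm R q)).
Proof.
exists (mxnorm2 u) => q.
rewrite normrM normr_id [`|1 + _|]ger0_norm ?addr_ge0 //.
apply: (@le_trans _ _ ((mxnorm2 u * (1 + qnorm R q)) * (1 + qnorm R q))).
  rewrite ler_wpM2r ?addr_ge0 //; apply: le_trans (mxdot_norm_le _ _) _.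
  by rewrite mulrC ler_wpM2l // lerDr.
rewrite -mulrA ler_wpM2l // -expr2.
by rewrite /qweight ler_weXn2l // lerDl.
Qed.

Lemma linear_dominated (u : 'M[R]_n) : dominated W (fun q => mxdot (natmx R q) u).
Proof. exact/dominated1/linear_dominated1. Qed.

End QueueWeight.

(** * Stability when all row and column loads are below 1 *)

Section Stability.
Variables (R : realType) (n amax : nat) (S : {set 'M[bool]_n}).
Hypothesis n_gt0 : (0 < n)%N.
Hypothesis hS : S = schedules n \/ S = full_schedules n.
Variable p : 'I_n -> 'I_n -> 'I_amax.+1 -> R.
Hypothesis p_ge0 : forall i j l, 0 <= p i j l.
Hypothesis p_sum1 : forall i j, \sum_l p i j l = 1.
Hypothesis rate_row : forall i, \sum_j rate p i j < 1.
Hypothesis rate_col : forall j, \sum_i rate p i j < 1.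

Implicit Types (q a : 'M[nat]_n) (s : 'M[bool]_n).

Local Notation K := (queue_op S p).
Local Notation E := (mean_slot S p).
Local Notation nrm := (@qnorm R n).
Local Notation W := (@qweight R n).
Let D : R := n%:R * amax.+1%:R.

Let mK : markov K := queue_op_markov hS p_ge0 p_sum1.

Lemma step_norm_ge1 : 1 <= D.
Proof. by rewrite -[1]mulr1 ler_pM // ler1n. Qed.

Lemma rate_ge0 i j : 0 <= rate p i j.
Proof. by rewrite mxE; apply: sumr_ge0 => l _; rewrite mulr_ge0. Qed.

Lemma rate_slack : exists2 delta, 0 < delta <= 1 &
  capacity_region (rate p + delta *: const_mx 1).
Proof.
pose f (c : 'I_n + 'I_n) := match c with
  inl i => (1 - \sum_j rate p i j) / n%:R | inr j => (1 - \sum_i rate p i j) / n%:R end.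
have n0 : 0 < n%:R :> R by rewrite ltr0n.
have [|r r0 rf] := @finite_lower_bound R ('I_n + 'I_n)%type f.
  by case=> i; rewrite /f divr_gt0 // subr_gt0.
pose d := Num.min r 1; have dr : d <= r by rewrite ge_min lexx.
have d0 : 0 < d by rewrite lt_min r0 ltr01.
exists d; first by rewrite d0 ge_min lexx orbT.
have entry i j : (rate p + d *: const_mx 1) i j = rate p i j + d.
  by rewrite mxE; congr (_ + _); rewrite !mxE mulr1.
split=> [i j|i|j].
- by rewrite entry addr_ge0 ?(ltW d0) ?rate_ge0.
- rewrite mxdot_row (eq_bigr (fun j => rate p i j + d)) => [|j _]; last exact: entry.
  rewrite big_split /= sumr_ord; have := rf (inl i); rewrite /f ler_pdivlMr // => h.
  by have : d * n%:R <= r * n%:R; [rewrite ler_wpM2r // ltW | lra].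
- rewrite mxdot_col (eq_bigr (fun i => rate p i j + d)) => [|i _]; last exact: entry.
  rewrite big_split /= sumr_ord; have := rf (inr j); rewrite /f ler_pdivlMr // => h.
  by have : d * n%:R <= r * n%:R; [rewrite ler_wpM2r // ltW | lra].
Qed.

(** MaxWeight does at least as well as the rates raised by [delta] everywhere, so the mean of the
    cross term is at most [- delta] times the total queue length, itself at least the norm. [D]
    bounds the change of the norm in one slot. *)
Lemma norm_drift : exists2 delta, 0 < delta <= 1 & forall q,
  E q (fun s a => mxdot (natmx R (next_queue q a s)) (natmx R (next_queue q a s))) <=
  nrm q ^+ 2 - 2 * delta * nrm q + D ^+ 2.
Proof.
have [d /andP[d0 d1] dC] := rate_slack; exists d; first by rewrite d0.
move=> q; have E_rate := mean_slot_dot hS p_sum1 q (natmx R q).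
apply: (@le_trans _ _ (E q (fun _ a => 2 * mxdot (natmx R a) (natmx R q) +
   (nrm q ^+ 2 - 2 * mxdot (rate p) (natmx R q) - 2 * d * nrm q + D ^+ 2)))).
  apply: mean_slot_le => // s a sq aA; apply: le_trans (sqr_next_queue_le R q s aA) _.
  have := maxweight_dominates hS sq dC.
  rewrite mxdotDr mxdotZr mxdotBr !(mxdotC (natmx R q)) sqr_mxnorm2.
  have : d * nrm q <= d * mxdot (natmx R q) (const_mx 1).
    by rewrite ler_wpM2l ?(ltW d0) // mxnorm2_le_sum // => i j; exact: natmx_ge0.
  rewrite /D mxdotC.
  by lra.
by rewrite mean_slot_lin (mean_slot_cst hS p_sum1) E_rate; lra.
Qed.

Lemma norm_step q s a : (forall i j, (a i j <= amax)%N) ->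
  `|nrm (next_queue q a s) - nrm q| <= D.
Proof.
move=> aA; pose d := natmx R (next_queue q a s) - natmx R q.
have dD : mxnorm2 d <= D.
  by apply: mxnorm2_entries => // i j; exact: increment_le.
have dND : mxnorm2 (- d) <= D.
  apply: mxnorm2_entries => // i j; rewrite mxE normrN; exact: increment_le.
have h1 := mxnorm2D (natmx R q) d; have h2 := mxnorm2D (natmx R (next_queue q a s)) (- d).
rewrite /d addrC subrK -!/(qnorm _ _) in h1.
rewrite /d opprB addrC subrK -!/(qnorm _ _) in h2.
by rewrite ler_norml; move: dD dND; rewrite /d opprB => ? ?; apply/andP; split; lra.
Qed.

(** Above [L] the drift of the squared norm becomes one of the norm, since the change [u] of the
    norm satisfies [2 |q| u <= |q'|^2 - |q|^2], and the exponential is expanded to second order.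
    Below [L] one slot raises the norm by at most [D]. *)
Lemma exp_norm_drift : exists th gam b,
  [/\ 0 < th <= 1, 0 <= gam < 1, 0 <= b &
      forall q, K (exp_norm th) q <= gam * exp_norm th q + b].
Proof.
have [d /andP[d0 d1] drift] := norm_drift.
have D1 := step_norm_ge1; have D0 : 0 < D by lra.
(* Chosen so that the second order term [2 * (th * D) ^+ 2] equals [th * d / 4]. With
   [L = D ^+ 2 / d] the term [c * D ^+ 2] is at most [th * d / 2], so a quarter of the gain [th * d]
   remains. *)
pose th := d / (8 * D ^+ 2).
have D2 : 1 <= D ^+ 2 by rewrite exprn_ege1.
have th0 : 0 < th by rewrite divr_gt0 // mulr_gt0 // exprn_gt0.
have thE : th * (8 * D ^+ 2) = d.
  by rewrite /th mulfVK // mulf_neq0 // ?expf_neq0 // lt0r_neq0.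
have thD : th * D <= 1 / 8.
  have : th * D * 1 <= th * D * D by rewrite ler_wpM2l // mulr_ge0 // ltW.
  by move: thE; rewrite expr2; lra.
have th1 : th <= 1.
  by have : th * 1 <= th * D; [rewrite ler_wpM2l // ltW | lra].
pose L := D ^+ 2 / d; have LE : d * L = D ^+ 2 by rewrite /L; field; rewrite gt_eqF.
have thd : 0 < th * d <= 1.
  by rewrite mulr_gt0 //= mulr_ile1 ?(ltW th0) ?(ltW d0).
have L0 : 0 < L by rewrite divr_gt0 // exprn_gt0.
exists th, (1 - th * d / 4), (expR (th * (L + D))).
split; [by rewrite th0 | by apply/andP; split; lra | exact: expR_ge0 |].
move=> q; have V0 : 0 < exp_norm th q by exact: expR_gt0.
have [qL|Lq] := leP (nrm q) L.
  apply: (@le_trans _ _ (expR (th * (L + D)))).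
    rewrite -[leRHS](mean_slot_cst hS p_sum1 q); apply: mean_slot_le => // s a sq aA.
    rewrite ler_expR ler_pM2l //; have := norm_step q s aA.
    by rewrite ler_norml => /andP[_]; lra.
  by rewrite lerDr mulr_ge0 ?(ltW V0) //; lra.
have q0 : 0 < nrm q by lra.
apply: (@le_trans _ _ ((1 - th * d / 4) * exp_norm th q)); last first.
  by rewrite lerDl expR_ge0.
pose c := th / (2 * nrm q).
have c0 : 0 < c by rewrite divr_gt0 // mulr_gt0.
pose X s a := mxdot (natmx R (next_queue q a s)) (natmx R (next_queue q a s)).
apply: (@le_trans _ _ (E q (fun s a => exp_norm th q * c * X s a +
    exp_norm th q * (1 - c * nrm q ^+ 2 + 2 * (th * D) ^+ 2)))).
  apply: mean_slot_le => // s a sq aA.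
  pose u := nrm (next_queue q a s) - nrm q.
  have uD : `|u| <= D := norm_step q s aA.
  have -> : exp_norm th (next_queue q a s) = exp_norm th q * expR (th * u).
    by rewrite /exp_norm -expRD -mulrDr addrC subrK.
  rewrite -mulrA -mulrDr ler_pM2l //.
  have thu : `|th * u| <= th * D by rewrite normrM gtr0_norm // ler_pM2l.
  apply: le_trans (expR_le_quad _) _; first by apply: le_trans thu _; lra.
  have -> : 2 * (th * u) ^+ 2 = 2 * `|th * u| ^+ 2 by rewrite real_normK ?num_real.
  have : `|th * u| ^+ 2 <= (th * D) ^+ 2.
    by rewrite ler_pXn2r // nnegrE // mulr_ge0 // ltW.
  suff : th * u <= c * (X s a - nrm q ^+ 2) by lra.
  have -> : X s a = nrm (next_queue q a s) ^+ 2 by rewrite sqr_mxnorm2.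
  have -> : c * (nrm (next_queue q a s) ^+ 2 - nrm q ^+ 2) = th * u + c * u ^+ 2.
    by rewrite /c /u; field; rewrite gt_eqF.
  by rewrite lerDl mulr_ge0 ?sqr_ge0 // ltW.
rewrite mean_slot_lin (mean_slot_cst hS p_sum1).
have : exp_norm th q * c * E q X <= exp_norm th q * c * (nrm q ^+ 2 - 2 * d * nrm q + D ^+ 2).
  by rewrite ler_wpM2l // mulr_ge0 // ltW.
suff : c * (nrm q ^+ 2 - 2 * d * nrm q + D ^+ 2) + (1 - c * nrm q ^+ 2 + 2 * (th * D) ^+ 2)
    <= 1 - th * d / 4.
  by rewrite -(ler_pM2l V0) => h h'; lra.
have -> : c * (nrm q ^+ 2 - 2 * d * nrm q + D ^+ 2) + (1 - c * nrm q ^+ 2 + 2 * (th * D) ^+ 2) =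
   1 - th * d + c * D ^+ 2 + 2 * (th * D) ^+ 2.
  by rewrite /c; field; rewrite gt_eqF.
have : c * D ^+ 2 <= th * d / 2.
  rewrite /c -LE mulrAC ler_pdivrMr ?mulr_gt0 //.
  have : th * d * L <= th * d * nrm q by rewrite ler_wpM2l ?(ltW Lq) // ltW; case/andP: thd.
  lra.
have : 2 * (th * D) ^+ 2 = th * d / 4 by rewrite -thE; field.
lra.
Qed.

Lemma qweight_step q s a : (forall i j, (a i j <= amax)%N) ->
  W (next_queue q a s) <= (1 + D) ^+ 4 * W q.
Proof.
move=> aA; have D1 := step_norm_ge1.
have q0 : 0 <= nrm q := mxnorm2_ge0 _.
have q'0 : 0 <= nrm (next_queue q a s) := mxnorm2_ge0 _.
rewrite -exprMn ler_pXn2r ?nnegrE ?mulr_ge0 ?addr_ge0 //; [|lra].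
have := norm_step q s aA; rewrite ler_norml => /andP[_ h].
have : 0 <= D * nrm q by rewrite mulr_ge0 //; lra.
lra.
Qed.

Lemma mean_slot_norm q G : `|E q G| <= E q (fun s a => `|G s a|).
Proof.
rewrite ler_norml -mulN1r -(mean_slotZ hS p_ge0 p_sum1).
by apply/andP; split; apply: mean_slot_le => // s a _ _;
  rewrite ?ler_norm // mulN1r lerNl -normrN ler_norm.
Qed.

Lemma mean_slot_dominated (G : 'M[nat]_n -> 'M[bool]_n -> 'M[nat]_n -> R) A :
  (forall q s a, s \in maxweight S q -> (forall i j, (a i j <= amax)%N) ->
     `|G q s a| <= A * W q) -> dominated W (fun q => E q (G q)).
Proof.
move=> GA; exists A => q; apply: le_trans (mean_slot_norm _ _) _.
rewrite -(mean_slot_cst hS p_sum1 q (A * W q)).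
by apply: mean_slot_le => // s a sq aA; exact: GA.
Qed.

Lemma queue_op_dominated f : dominated W f -> dominated W (K f).
Proof.
move=> [A fA]; have A0 : 0 <= A := bound_ge0 (fA 0) (lt_le_trans ltr01 (qweight_ge1 R 0)).
apply: (@mean_slot_dominated (fun q s a => f (next_queue q a s)) (A * (1 + D) ^+ 4)).
move=> q s a _ aA; apply: le_trans (fA _) _.
by rewrite -mulrA ler_wpM2l // qweight_step.
Qed.

Section Draining.
Hypothesis p_idle : forall i j, 0 < p i j ord0.

Let tot q : nat := (\sum_i \sum_j q i j)%N.

(** A nonempty queue alone is a point of the capacity region with positive weight, so a MaxWeight
    schedule has positive weight and serves at least one packet. *)
Lemma drain_step q s N : s \in maxweight S q -> (tot q <= N.+1)%N ->
  (tot (next_queue q 0 s) <= N)%N.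
Proof.
move=> sq qN.
have totE : (tot q = tot (next_queue q 0 s) +
    \sum_i \sum_j (s i j && (0 < q i j)%N))%N.
  rewrite /tot -big_split; apply: eq_bigr => i _; rewrite -big_split.
  by apply: eq_bigr => j _; rewrite !mxE; case: (s i j); case: (q i j) => // m /=; lia.
have [q0|[i [j qij]]] : tot q = 0%N \/ exists i j, (0 < q i j)%N.
  have [/existsP[i /existsP[j]]|] := boolP [exists i, exists j, (0 < q i j)%N].
    by right; exists i, j.
  rewrite negb_exists => /forallP no; left; apply: big1 => i _; apply: big1 => j _.
  have := no i; rewrite negb_exists => /forallP/(_ j).
  by rewrite lt0n negbK => /eqP.
  by rewrite q0 in totE; lia.
suff : (0 < \sum_i \sum_j (s i j && (0 < q i j)%N))%N by lia.
rewrite lt0n; apply/negP => /eqP z0.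
have cap : capacity_region (delta_mx i j : 'M[R]_n).
  split=> [i' j'|i'|j']; first by rewrite mxE.
    by rewrite mxdot_row delta_row lern1 leq_b1.
  by rewrite mxdot_col delta_col lern1 leq_b1.
have := maxweight_dominates hS sq cap; rewrite mxdot_delta -weightE mxE ler_nat.
suff -> : weight q s = 0%N by lia.
apply: big1 => i' _; apply: big1 => j' _.
move/eqP: z0; rewrite sum_nat_eq0 => /forallP/(_ i') /=.
rewrite sum_nat_eq0 => /forallP/(_ j') /=.
by case: (s i' j') => /=; [case: (q i' j')|rewrite muln0].
Qed.

Let idle : outcome n amax := [ffun=> ord0].

Lemma idle_gt0 : 0 < outcome_prob p idle.
Proof. by apply: prodr_gt0 => c _; rewrite ffunE. Qed.

Lemma arrivals_idle : arrivals idle = 0.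
Proof. by apply/matrixP => i j; rewrite !mxE ffunE. Qed.

Lemma mean_slot_idle q G t : (forall s a, 0 <= G s a) ->
  (forall s, s \in maxweight S q -> t <= G s 0) ->
  outcome_prob p idle * t <= E q G.
Proof.
move=> G0 Gt; have i0 := idle_gt0.
rewrite -(mulr1 (_ * t)) -(@maxweight_mass R _ _ hS q) mulr_sumr.
apply: ler_sum => s sq; rewrite mulrC ler_wpM2l ?invr_ge0 //.
rewrite /mean_arrivals (bigD1 idle) //= arrivals_idle.
rewrite -[leLHS]addr0 lerD ?ler_pM2l ?Gt //.
by apply: sumr_ge0 => m _; rewrite mulr_ge0 // outcome_prob_ge0.
Qed.

Lemma iter_drain N q : (tot q <= N)%N ->
  outcome_prob p idle ^+ N <= iter N K (indic R 0) q.
Proof.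
elim: N q => [|N IH] q qN.
  rewrite expr0 /= /indic (_ : q = 0) ?eqxx //.
  apply/matrixP => i j; move: qN; rewrite leqn0 /tot sum_nat_eq0 mxE.
  by move=> /forallP/(_ i) /=; rewrite sum_nat_eq0 => /forallP/(_ j) /= /eqP.
rewrite exprS /=; apply: mean_slot_idle => [s a|s sq].
  by apply: (pl_ge0 (pl_iter mK.1 N)) => y; rewrite ler0n.
exact/IH/drain_step.
Qed.

(** A state of the sublevel set has norm at most [|L| / th], hence at most [N.+1] packets. That many
    slots without arrivals lead to 0, where an emptied switch stays, and [M] further slots lead from
    0 to [z]; the number of slots is the same for all these states. *)
Lemma minorization (th : R) z : 0 < th ->
  (exists M, 0 < iter M K (indic R z) 0) ->
  forall L, exists N, exists2 alpha : R, 0 < alpha &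
  forall q : 'M[nat]_n, exp_norm th q <= L -> alpha <= iter N.+1 K (indic R z) q.
Proof.
move=> th0 [M Mz] L.
pose N := Num.bound (n%:R * (n%:R * (`|L| / th))).
exists (N + M)%N; exists (outcome_prob p idle ^+ N.+1 * iter M K (indic R z) 0).
  by rewrite mulr_gt0 // exprn_gt0 // idle_gt0.
move=> q qL; rewrite -addSn iterD.
have qn : qnorm R q <= `|L| / th.
  rewrite ler_pdivlMr // mulrC; apply: le_trans (le_trans qL (ler_norm _)).
  by apply: le_trans (expR_ge1Dx _); rewrite lerDr.
have totN : (tot q <= N.+1)%N.
  apply: ltnW; rewrite ltnS -(ler_nat R); apply: ltW.
  apply: le_lt_trans (archi_boundP _); last first.
    by rewrite !mulr_ge0 // invr_ge0 ltW.
  rewrite natr_sum -sumr_ord; apply: ler_sum => i _; rewrite natr_sum -sumr_ord.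
  apply: ler_sum => j _; apply: le_trans qn.
  by have := entry_le_mxnorm2 (natmx R q) i j; rewrite mxE normr_nat.
have plN := pl_iter mK.1 N.+1.
apply: (@le_trans _ _ (iter N.+1 K (fun y => iter M K (indic R z) 0 * indic R 0 y) q)).
  by rewrite plZ // mulrC ler_pM2l // iter_drain.
apply: (pl_le plN) => y; rewrite /(indic R 0).
case: eqP => [->|_]; first by rewrite mulr1.
by rewrite mulr0; apply: (pl_ge0 (pl_iter mK.1 M)) => w; rewrite ler0n.
Qed.

Lemma exp_norm_ge0 (th : R) q : 0 <= exp_norm th q.
Proof. exact: expR_ge0. Qed.

Lemma steady_exists : exists pi, steady_functional K W pi.
Proof.
have [th [gam [b [th01 gam01 b0 drift]]]] := exp_norm_drift.
have th0 : 0 < th by case/andP: th01.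
have reach0 : exists M, 0 < iter M K (indic R 0) 0 by exists 0%N; rewrite /= /indic eqxx.
(* On functions that are not dominated the functional takes the arbitrary value 0. *)
have H f : exists l : R, dominated W f -> forall q, iter t K f q @[t --> \oo] --> l.
  have [[A fA]|nd] := pselect (dominated W f); last by exists 0.
  have A0 : 0 <= A := bound_ge0 (fA 0) (lt_le_trans ltr01 (qweight_ge1 R 0)).
  have [|l lP] := @iterates_cvg _ _ _ 0 _ _ _ mK gam01 b0 (exp_norm_ge0 th) drift
    (minorization th0 reach0) f (A * (4 / th) ^+ 4).
    move=> q; apply: le_trans (fA q) _; rewrite -mulrA ler_wpM2l //.
    exact: qweight_le_exp.
  by exists l.
by exists (fun f => projT1 (cid (H f))) => f; exact: (projT2 (cid (H f))).
Qed.

Lemma recurrence z : (exists M, 0 < iter M K (indic R z) 0) ->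
  exists rho (g : 'M[nat]_n -> R), [/\ 0 <= rho < 1, forall q, 1 <= g q &
    forall q, killed K z g q <= rho * g q].
Proof.
move=> zM; have [th [gam [b [th01 gam01 b0 drift]]]] := exp_norm_drift.
have th0 : 0 < th by case/andP: th01.
have [rho [C [g [rho01 gP gK]]]] := @killed_drift _ _ _ z _ _ _ mK gam01 b0
  (exp_norm_ge0 th) drift (minorization th0 zM).
exists rho, g; split=> // q; have /andP[h _] := gP q.
by apply: le_trans h; rewrite lerDl exp_norm_ge0.
Qed.

End Draining.
End Stability.

(** * State space collapse and heavy traffic *)

Lemma continuous_sumr (R : realType) (T : topologicalType) (I : Type)
    (r : seq I) (F : I -> T -> R) :
  (forall i, continuous (F i)) -> continuous (fun x => \sum_(i <- r) F i x).
Proof.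
move=> cF; elim: r => [|i r IH].
  have -> : (fun x => \sum_(i <- [::]) F i x) = (fun=> 0).
    by apply/funext => x; rewrite big_nil.
  by move=> x; exact: cvg_cst.
have -> : (fun x => \sum_(l <- i :: r) F l x) =
    F i \+ (fun x => \sum_(l <- r) F l x).
  by apply/funext => x; rewrite big_cons.
by move=> x; apply: cvgD; [exact: cF | exact: IH].
Qed.

Lemma mxdot_sqrD (R : realType) (n : nat) (x y : 'M[R]_n) :
  mxdot (x + y) (x + y) = mxdot x x + 2 * mxdot x y + mxdot y y.
Proof. by rewrite mxdotDl !mxdotDr (mxdotC y x); ring. Qed.

(** * Projection on the cone of saturated rows and columns *)

Section Cone.
Variables (R : realType) (n n1 n2 : nat).
Hypotheses (hn1 : (n1 < n)%N) (hn2 : (n2 < n)%N).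
Implicit Types (x y z : 'M[R]_n) (w v : 'I_n -> R).

(** The weights are indexed by all lines, those of unsaturated lines being multiplied by 0. *)
Definition cone_mx w v : 'M[R]_n :=
  \matrix_(i, j) ((i < n1)%:R * w i + (j < n2)%:R * v j).

Lemma cone_mx0 : cone_mx (fun=> 0) (fun=> 0) = 0.
Proof. by apply/matrixP => i j; rewrite !mxE !mulr0 addr0. Qed.

Lemma mxdot_cone z w v : mxdot z (cone_mx w v) =
  \sum_(i < n | (i < n1)%N) w i * (\sum_j z i j) +
  \sum_(j < n | (j < n2)%N) v j * (\sum_i z i j).
Proof.
transitivity (\sum_i \sum_j (z i j * ((i < n1)%:R * w i) +
                             z i j * ((j < n2)%:R * v j))).
  by do 2![apply: eq_bigr => ? _]; rewrite mxE mulrDr.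
under eq_bigr do rewrite big_split /=; rewrite big_split /=; congr (_ + _).
  rewrite [RHS]big_mkcond; apply: eq_bigr => i _; rewrite -mulr_suml.
  by case: ifP => _; rewrite ?mul1r ?mul0r ?mulr0 // mulrC.
rewrite exchange_big [RHS]big_mkcond; apply: eq_bigr => j _; rewrite -mulr_suml.
by case: ifP => _; rewrite ?mul1r ?mul0r ?mulr0 // mulrC.
Qed.

Lemma mxdot_cone0 x w v :
  (forall i : 'I_n, (i < n1)%N -> \sum_j x i j = 0) ->
  (forall j : 'I_n, (j < n2)%N -> \sum_i x i j = 0) -> mxdot x (cone_mx w v) = 0.
Proof.
move=> r0 c0; rewrite mxdot_cone !big1 ?addr0 // => l lsat.
  by rewrite c0 // mulr0.
by rewrite r0 // mulr0.
Qed.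

(** Compactness of the box of weights at most [2 |q|]: a larger saturated weight gives a point
    farther from [q] than the origin. *)
Lemma cone_mx_min q : exists w v, [/\ forall i, 0 <= w i, forall j, 0 <= v j &
  forall w' v', (forall i, 0 <= w' i) -> (forall j, 0 <= v' j) ->
    mxdot (q - cone_mx w v) (q - cone_mx w v) <=
    mxdot (q - cone_mx w' v') (q - cone_mx w' v')].
Proof.
pose W (t : 'rV[R]_(n + n)) i := t 0 (lshift n i).
pose V (t : 'rV[R]_(n + n)) j := t 0 (rshift n j).
pose obj t := mxdot (q - cone_mx (W t) (V t)) (q - cone_mx (W t) (V t)).
pose B := 2 * mxnorm2 q.
have B0 : 0 <= B by rewrite mulr_ge0.
pose box := [set t : 'rV[R]_(n + n) | forall i, `[0, B]%classic (t ord0 i)].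
have cbox : compact box.
  by apply: (@rV_compact _ _ (fun=> `[0, B]%classic)) => i; exact: segment_compact.
have box0 : box 0 by move=> i /=; rewrite mxE in_itv /= lexx B0.
have cobj : continuous obj.
  apply: continuous_sumr => i; apply: continuous_sumr => j.
  have c : continuous (fun t => (q - cone_mx (W t) (V t)) i j).
    pose g1 (t : 'rV[R]_(n + n)) := (i < n1)%:R * t 0 (lshift n i).
    pose g2 (t : 'rV[R]_(n + n)) := (j < n2)%:R * t 0 (rshift n j).
    have -> : (fun t => (q - cone_mx (W t) (V t)) i j) = (fun=> q i j) \- (g1 \+ g2).
      by apply/funext => t; rewrite !mxE.
    move=> t; apply: continuousB; first exact: cst_continuous.
    by apply: continuousD; (apply: continuousM; [exact: cst_continuous | exact: coord_continuous]).
  by move=> t; apply: continuousM; exact: c.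
have [t tbox tmin] := @EVT_min_rV _ _ obj box (ex_intro _ 0 box0) cbox
  (continuous_subspaceT cobj).
exists (W t), (V t); split=> [i|j|w' v' w0 v0].
- by move: tbox; rewrite inE => /(_ (lshift n i)) /=; rewrite in_itv /= => /andP[].
- by move: tbox; rewrite inE => /(_ (rshift n j)) /=; rewrite in_itv /= => /andP[].
have obj_le0 : obj t <= mxdot q q.
  have := tmin 0; rewrite inE => /(_ box0).
  rewrite {2}/obj (_ : cone_mx (W 0) (V 0) = 0) ?subr0 //.
  by apply/matrixP => i j; rewrite !mxE /W /V !mxE !mulr0 addr0.
have big (c r : R) : B < c -> `|r| <= mxnorm2 q -> mxdot q q <= (r - c) ^+ 2.
  move=> Bc; rewrite ler_norml => /andP[_ rq]; rewrite -sqr_mxnorm2.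
  have q0 := mxnorm2_ge0 q.
  rewrite -[leRHS]sqrrN ler_pXn2r ?nnegrE //; move: Bc; rewrite /B => *; lra.
(* Column [n2] exists and is unsaturated, so there the entry in row [i] of the cone matrix is [w' i]
   alone; rows are treated alike with row [n1] below. *)
have [/existsP[i /andP[i1 iB]]|nw] := boolP [exists i : 'I_n, (i < n1)%N && (B < w' i)].
  apply: le_trans obj_le0 _; pose j := Ordinal hn2.
  apply: le_trans (sqr_entry_le _ i j); rewrite !mxE i1 ltnn mul1r mul0r addr0.
  exact/big/entry_le_mxnorm2.
have [/existsP[j /andP[j1 jB]]|nv] := boolP [exists j : 'I_n, (j < n2)%N && (B < v' j)].
  apply: le_trans obj_le0 _; pose i := Ordinal hn1.
  apply: le_trans (sqr_entry_le _ i j); rewrite !mxE j1 ltnn mul1r mul0r add0r.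
  exact/big/entry_le_mxnorm2.
(* Setting the unsaturated weights to 0 does not change the matrix and brings the point into the
   box. *)
pose t' : 'rV[R]_(n + n) := row_mx (\row_i ((i < n1)%:R * w' i))
                                  (\row_j ((j < n2)%:R * v' j)).
have -> : cone_mx w' v' = cone_mx (W t') (V t').
  apply/matrixP => i j; rewrite !mxE /W /V /t' row_mxEl row_mxEr !mxE.
  by rewrite !mulrA -!natrM !mulnb !andbb.
apply: (tmin t'); rewrite inE => k /=; rewrite in_itv /= /t' mxE.
case: (fintype.split k) => i; rewrite mxE.
  have := w0 i; move: nw; rewrite negb_exists => /forallP/(_ i); rewrite negb_and -leNgt.
  by case: (i < n1)%N => /=; rewrite ?mul1r ?mul0r ?lexx ?B0 // => -> ->.
have := v0 i; move: nv; rewrite negb_exists => /forallP/(_ i); rewrite negb_and -leNgt.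
by case: (i < n2)%N => /=; rewrite ?mul1r ?mul0r ?lexx ?B0 // => -> ->.
Qed.

(** If [c = <y, z>] were positive, the step [t = c / (N + c)] with [N = <z, z>] would change the
    squared norm by [t * (t * N - 2 * c)], which is negative. *)
Lemma mxdot_first_order y z :
  (forall t, 0 < t <= 1 -> mxdot y y <= mxdot (y - t *: z) (y - t *: z)) ->
  mxdot y z <= 0.
Proof.
move=> H; rewrite leNgt; apply/negP => c0.
have N0 := mxdot_self_ge0 z; set N := mxdot z z in N0; set c := mxdot y z in c0.
have p : 0 < N + c by lra.
have t01 : 0 < c / (N + c) <= 1.
  by rewrite divr_gt0 //= ler_pdivrMr // mul1r lerDr.
have := H _ t01; rewrite mxdotBl !mxdotBr !mxdotZl !mxdotZr (mxdotC z y) -/N -/c.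
set t := c / (N + c); have tE : t * (N + c) = c by rewrite /t mulfVK // gt_eqF.
have /andP[t0 t1] := t01; rewrite -/t in t0 t1.
move=> h; have : t * (2 * c - t * N) <= 0 by lra.
rewrite pmulr_rle0 //; have : 0 < t * c by rewrite mulr_gt0.
by move: tE; rewrite mulrDr; lra.
Qed.

(** First order conditions at the minimiser: raising one saturated weight stays in the cone and
    gives the signs of the sums; scaling the cone point by [1 + t] and by [1 - t] stays in the cone
    and gives orthogonality. *)
Lemma cone_projection q : exists w v, let y := q - cone_mx w v in
  [/\ forall i, 0 <= w i /\ 0 <= v i,
   forall w' v', (forall i, 0 <= w' i) -> (forall j, 0 <= v' j) ->
     mxdot y y <= mxdot (q - cone_mx w' v') (q - cone_mx w' v'),
   forall i : 'I_n, (i < n1)%N -> \sum_j y i j <= 0,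
   forall j : 'I_n, (j < n2)%N -> \sum_i y i j <= 0
   & mxdot y (cone_mx w v) = 0].
Proof.
have [w [v [w0 v0 wvmin]]] := cone_mx_min q; exists w, v => y.
split=> // [i i1|j j2|].
- rewrite -mxdot_row; apply: mxdot_first_order => t /andP[t0 _].
  have -> : y - t *: row_ones R i =
      q - cone_mx (fun i' => w i' + t * (i' == i)%:R) v.
    apply/matrixP => i' j'; rewrite /y !mxE.
    by have [->|_] := eqVneq i' i; rewrite ?i1 ?mulr1n ?mulr0n; ring.
  by apply: wvmin => // i'; rewrite addr_ge0 // mulr_ge0 // ltW.
- rewrite -mxdot_col; apply: mxdot_first_order => t /andP[t0 _].
  have -> : y - t *: col_ones R j =
      q - cone_mx w (fun j' => v j' + t * (j' == j)%:R).
    apply/matrixP => i' j'; rewrite /y !mxE.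
    by have [->|_] := eqVneq j' j; rewrite ?j2 ?mulr1n ?mulr0n; ring.
  by apply: wvmin => // j'; rewrite addr_ge0 // mulr_ge0 // ltW.
apply/eqP; rewrite eq_le; apply/andP; split.
  apply: mxdot_first_order => t /andP[t0 _].
  have -> : y - t *: cone_mx w v =
      q - cone_mx (fun i => (1 + t) * w i) (fun j => (1 + t) * v j).
    by apply/matrixP => i' j'; rewrite /y !mxE; ring.
  by apply: wvmin => l; rewrite mulr_ge0 // addr_ge0 // ltW.
rewrite -oppr_le0 -mxdotNr; apply: mxdot_first_order => t /andP[t0 t1].
have -> : y - t *: (- cone_mx w v) =
    q - cone_mx (fun i => (1 - t) * w i) (fun j => (1 - t) * v j).
  by apply/matrixP => i' j'; rewrite /y !mxE; ring.
by apply: wvmin => l; rewrite mulr_ge0 // subr_ge0.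
Qed.

(** What the projection on the cone leaves of [q]; choice fixes one pair of optimal weights for each
    [q]. *)
Definition cone_rest q : 'M[R]_n :=
  let: exist w wP := cid (cone_projection q) in q - cone_mx w (projT1 (cid wP)).

Lemma cone_restP q : exists w v, [/\ cone_rest q = q - cone_mx w v,
  forall i, 0 <= w i /\ 0 <= v i,
  (forall i : 'I_n, (i < n1)%N -> \sum_j cone_rest q i j <= 0) /\
  (forall j : 'I_n, (j < n2)%N -> \sum_i cone_rest q i j <= 0)
  & mxdot (cone_rest q) (cone_mx w v) = 0].
Proof.
rewrite /cone_rest; case: cid => w wP; case: cid => v [wv0 _ r c d] /=.
by exists w, v.
Qed.

Lemma cone_rest_min q w v : (forall i, 0 <= w i) -> (forall j, 0 <= v j) ->
  mxdot (cone_rest q) (cone_rest q) <= mxdot (q - cone_mx w v) (q - cone_mx w v).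
Proof.
by rewrite /cone_rest; case: cid => w' wP; case: cid => v' [_ h _ _ _] /=; apply: h.
Qed.

Lemma cone_rest_le q : mxdot (cone_rest q) (cone_rest q) <= mxdot q q.
Proof.
by have := @cone_rest_min q (fun=> 0) (fun=> 0); rewrite cone_mx0 subr0; apply.
Qed.

End Cone.

(** * The quadratic form of the saturated sums *)

Section SaturatedForm.
Variables (R : realType) (n n1 n2 : nat).
Hypotheses (hn1 : (n1 < n)%N) (hn2 : (n2 < n)%N).
Implicit Types (x y z : 'M[R]_n).

Definition rsum x i : R := \sum_j x i j.
Definition csum x j : R := \sum_i x i j.
Definition sat_rsum x : R := \sum_(i < n | (i < n1)%N) rsum x i.
Definition sat_csum x : R := \sum_(j < n | (j < n2)%N) csum x j.

Let Den : R := n%:R ^+ 2 - n1%:R * n2%:R.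

Lemma den_gt0 : 0 < Den.
Proof.
rewrite subr_gt0 expr2 -!natrM ltr_nat.
by rewrite (leq_ltn_trans (leq_mul (ltnW hn1) (leqnn n2))) // ltn_pmul2l // (leq_ltn_trans _ hn1).
Qed.

(* [n] times the orthogonal projection on the span of the saturated rows and
   columns. *)
Definition sat_proj y : 'M[R]_n := cone_mx n1 n2
  (fun i => rsum y i - (n%:R * sat_csum y - n2%:R * sat_rsum y) / Den)
  (fun j => csum y j - (n%:R * sat_rsum y - n1%:R * sat_csum y) / Den).

Definition sat_form x y : R := mxdot x (sat_proj y).

(** Written with the saturated sums of both arguments, the form is visibly symmetric. *)
Lemma sat_formE x y : sat_form x y =
  \sum_(i < n | (i < n1)%N) rsum x i * rsum y i +
  \sum_(j < n | (j < n2)%N) csum x j * csum y j -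
  (n%:R * (sat_rsum x * sat_csum y + sat_csum x * sat_rsum y)
   - n2%:R * (sat_rsum x * sat_rsum y) - n1%:R * (sat_csum x * sat_csum y)) / Den.
Proof.
rewrite /sat_form mxdot_cone.
under eq_bigr do rewrite mulrBl; under [X in _ + X]eq_bigr do rewrite mulrBl.
rewrite !sumrB -!mulr_sumr -/(sat_rsum x) -/(sat_csum x).
under eq_bigr do rewrite mulrC; under [X in _ + (X - _)]eq_bigr do rewrite mulrC.
by rewrite -/(rsum x) -/(csum x); ring.
Qed.

Lemma sat_formC x y : sat_form x y = sat_form y x.
Proof.
rewrite !sat_formE; congr (_ + _ - _ / _); last by ring.
  by apply: eq_bigr => i _; rewrite mulrC.
by apply: eq_bigr => i _; rewrite mulrC.
Qed.

Lemma sat_formDl x y z : sat_form (x + y) z = sat_form x z + sat_form y z.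
Proof. exact: mxdotDl. Qed.

Lemma sat_formZl c x z : sat_form (c *: x) z = c * sat_form x z.
Proof. exact: mxdotZl. Qed.

Lemma sat_formDr x y z : sat_form z (x + y) = sat_form z x + sat_form z y.
Proof. by rewrite sat_formC sat_formDl !(sat_formC z). Qed.

Lemma sat_formZr c x z : sat_form z (c *: x) = c * sat_form z x.
Proof. by rewrite sat_formC sat_formZl (sat_formC z). Qed.

Lemma sum_sat (m : nat) : (m < n)%N -> \sum_(i < n | (i < m)%N) 1 = m%:R :> R.
Proof.
move=> mn; rewrite -(big_ord_widen_cond n xpredT (fun=> 1)) ?(ltnW mn) //.
by rewrite sumr_ord mulr1.
Qed.

(** This is where the quotients in [sat_proj] come from. A saturated row of a cone matrix sums to
    [n w_i + V] and a saturated column to [n v_j + W], with [W] and [V] the totals of the saturated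
    weights; the quotients solve [sat_rsum = n W + n1 V], [sat_csum = n V + n2 W] for [V] and [W], a
    system of determinant [n^2 - n1 n2]. *)
Lemma sat_proj_cone w v : sat_proj (cone_mx n1 n2 w v) = n%:R *: cone_mx n1 n2 w v.
Proof.
set x := cone_mx n1 n2 w v.
pose Wt := \sum_(i < n | (i < n1)%N) w i; pose Vt := \sum_(j < n | (j < n2)%N) v j.
have rE (i : 'I_n) : (i < n1)%N -> rsum x i = n%:R * w i + Vt.
  move=> i1; rewrite /rsum; under eq_bigr do rewrite mxE i1 mul1r.
  rewrite big_split /= sumr_ord; congr (_ + _); rewrite /Vt [RHS]big_mkcond.
  by apply: eq_bigr => j _; case: ifP => _; rewrite ?mul1r ?mul0r.
have cE (j : 'I_n) : (j < n2)%N -> csum x j = n%:R * v j + Wt.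
  move=> j1; rewrite /csum; under eq_bigr do rewrite mxE j1 mul1r.
  rewrite big_split /= sumr_ord addrC; congr (_ + _); rewrite /Wt [RHS]big_mkcond.
  by apply: eq_bigr => i _; case: ifP => _; rewrite ?mul1r ?mul0r.
have RE : sat_rsum x = n%:R * Wt + n1%:R * Vt.
  rewrite /sat_rsum (eq_bigr _ rE) big_split /= -mulr_sumr -(sum_sat hn1) mulr_suml.
  by under [in RHS]eq_bigr do rewrite mul1r.
have CE : sat_csum x = n%:R * Vt + n2%:R * Wt.
  rewrite /sat_csum (eq_bigr _ cE) big_split /= -mulr_sumr -(sum_sat hn2) mulr_suml.
  by under [in RHS]eq_bigr do rewrite mul1r.
have D0 : Den != 0 by rewrite gt_eqF // den_gt0.
have VE : (n%:R * sat_csum x - n2%:R * sat_rsum x) / Den = Vt.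
  by rewrite RE CE; apply: (canLR (mulfK D0)); rewrite /Den; ring.
have WE : (n%:R * sat_rsum x - n1%:R * sat_csum x) / Den = Wt.
  by rewrite RE CE; apply: (canLR (mulfK D0)); rewrite /Den; ring.
apply/matrixP => i j; rewrite /sat_proj VE WE !mxE.
case i1: (i < n1)%N; case j1: (j < n2)%N; rewrite ?mulr1n ?mulr0n ?mul1r ?mul0r.
- by rewrite rE // cE //; ring.
- by rewrite rE //; ring.
- by rewrite cE //; ring.
- by ring.
Qed.

Lemma sat_form_delta i j :
  sat_form (delta_mx i j) (delta_mx i j) = zeta R n n1 n2 i j.
Proof.
have D0 : Den != 0 by rewrite gt_eqF // den_gt0.
have delta_sum (m : nat) (l : 'I_n) : \sum_(h < n | (h < m)%N) (h == l)%:R = (l < m)%N%:R :> R.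
  rewrite big_mkcond (bigD1 l) //= eqxx big1 ?addr0.
    by case: (l < m)%N.
  by move=> h /negPf ->; case: ifP.
have RE : sat_rsum (delta_mx i j) = (i < n1)%N%:R.
  by rewrite /sat_rsum; under eq_bigr do rewrite /rsum delta_row; exact: delta_sum.
have CE : sat_csum (delta_mx i j) = (j < n2)%N%:R.
  by rewrite /sat_csum; under eq_bigr do rewrite /csum delta_col; exact: delta_sum.
rewrite /sat_form mxdotC mxdot_delta mxE RE CE /rsum /csum delta_row delta_col !eqxx [RHS]mxE -/Den.
by case: (i < n1)%N; case: (j < n2)%N; rewrite ?mulr1n ?mulr0n; field; exact: D0.
Qed.

Lemma sat_form_expand x q z k u eps :
  (forall y, sat_form x y = sat_form (q + z + (- eps) *: k + u) y) ->
  sat_form x x = sat_form q q +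
    mxdot z (2 *: sat_proj q - (2 * eps) *: sat_proj k) -
    2 * eps * sat_form q k + sat_form z z + eps ^+ 2 * sat_form k k +
    (2 * sat_form u x - sat_form u u).
Proof.
move=> E; rewrite mxdotBr !mxdotZr -/(sat_form z q) -/(sat_form z k).
rewrite E [in LHS]sat_formC E (sat_formC u x) E.
rewrite !(sat_formDl, sat_formDr, sat_formZl, sat_formZr).
rewrite (sat_formC z q) (sat_formC k q) (sat_formC k z) (sat_formC u q).
rewrite (sat_formC u z) (sat_formC u k).
ring.
Qed.

Definition sat_bound : R := \sum_i \sum_j mxnorm2 (sat_proj (delta_mx i j)).

Lemma sat_proj_entry y i j : sat_proj y i j = mxdot y (sat_proj (delta_mx i j)).
Proof. by rewrite -/(sat_form _ _) sat_formC /sat_form mxdotC mxdot_delta. Qed.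

Lemma sat_bound_ge0 : 0 <= sat_bound.
Proof. by do 2![apply: sumr_ge0 => ? _]; exact: mxnorm2_ge0. Qed.

Lemma sat_proj_le y i j : `|sat_proj y i j| <= sat_bound * mxnorm2 y.
Proof.
rewrite sat_proj_entry; apply: le_trans (mxdot_norm_le _ _) _.
rewrite mulrC ler_wpM2r //.
rewrite /sat_bound (bigD1 i) //= (bigD1 j) //= -addrA lerDl.
by rewrite addr_ge0 //; do ?[apply: sumr_ge0 => ? _]; exact: mxnorm2_ge0.
Qed.

Definition sat_ones : 'M[R]_n := cone_mx n1 n2 (fun=> 1) (fun=> 1).

Lemma sat_ones_ge0 i j : 0 <= sat_ones i j.
Proof. by rewrite mxE addr_ge0 // mulr_ge0. Qed.

Lemma sat_ones_le2 i j : sat_ones i j <= 2.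
Proof.
rewrite mxE !mulr1 -natrD (ler_nat _ _ 2).
by case: (i < n1)%N; case: (j < n2)%N.
Qed.

(* The projection vanishes at the doubly unsaturated entries. *)
Lemma sat_form_le (u : 'M[R]_n) y b : (forall i j, 0 <= u i j) -> 0 <= b ->
  (forall i j, `|u i j * sat_proj y i j| <= u i j * b) ->
  `|sat_form u y| <= b * mxdot u sat_ones.
Proof.
move=> u0 b0 ub; rewrite /sat_form -mxdotZr.
apply: le_trans (ler_norm_sum _ _ _) _; apply: ler_sum => i _.
apply: le_trans (ler_norm_sum _ _ _) _; apply: ler_sum => j _.
rewrite [X in _ <= _ * X]mxE; have ub0 : 0 <= u i j * b by rewrite mulr_ge0.
have onesE : sat_ones i j = (i < n1)%N%:R + (j < n2)%N%:R.
  by rewrite mxE !mulr1.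
have [s0|s1] := boolP ((i < n1)%N || (j < n2)%N).
  apply: le_trans (ub i j) _; rewrite mulrA ler_peMr // onesE -natrD (ler_nat _ 1).
  by move: s0; case: (i < n1)%N; case: (j < n2)%N.
rewrite (_ : sat_proj y i j = 0) ?mulr0 ?normr0 ?mulr_ge0 ?sat_ones_ge0 //.
by move: s1; rewrite negb_or mxE => /andP[/negPf -> /negPf ->]; rewrite !mul0r addr0.
Qed.

End SaturatedForm.

(** The polynomial is nonpositive beyond [A / c], and its quadratic term bounds it before. *)
Lemma cubic_bound (R : realType) (c A : R) : 0 < c -> 0 <= A ->
  exists M, forall Y, 0 <= Y -> A * Y ^+ 2 - c * Y ^+ 3 <= M.
Proof.
move=> c0 A0; exists (A * (A / c) ^+ 2) => Y Y0.
have cY : A * Y ^+ 2 - c * Y ^+ 3 = (A - c * Y) * Y ^+ 2 by ring.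
have Ac0 : 0 <= A / c by rewrite divr_ge0 // ltW.
have [AY|YA] := leP (A / c) Y.
  rewrite ler_pdivrMr // mulrC in AY.
  apply: (@le_trans _ _ 0); last by rewrite mulr_ge0 // sqr_ge0.
  by rewrite cY mulr_le0_ge0 ?sqr_ge0 // subr_le0.
apply: (@le_trans _ _ (A * Y ^+ 2)).
  by rewrite lerBlDr lerDl mulr_ge0 ?(ltW c0) // exprn_ge0.
by rewrite ler_wpM2l // ler_pXn2r ?nnegrE // ltW.
Qed.

Definition steady_limit (R : realType) (n amax : nat) (S : {set 'M[bool]_n})
    (p : 'I_n -> 'I_n -> 'I_amax.+1 -> R) (pi : ('M[nat]_n -> R) -> R) : Prop :=
  [/\ forall i j l, 0 <= p i j l, forall i j, \sum_l p i j l = 1 &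
  steady_functional (queue_op S p) (@qweight R n) pi].

(** * Collapse and balance, uniformly in the distance to saturation *)

Section HeavyTraffic.
Variables (R : realType) (n n1 n2 amax : nat).
Hypotheses (hn1 : (n1 < n)%N) (hn2 : (n2 < n)%N).
Variables (nu k : 'M[R]_n) (delta : R) (S : {set 'M[bool]_n}).
Hypothesis hS : S = schedules n \/ S = full_schedules n.
Hypothesis delta0 : 0 < delta.
Hypothesis nu_ge : forall i j, delta <= nu i j.
Hypothesis nu_row1 : forall i : 'I_n, (i < n1)%N -> \sum_j nu i j = 1.
Hypothesis nu_col1 : forall j : 'I_n, (j < n2)%N -> \sum_i nu i j = 1.
Hypothesis nu_row : forall i : 'I_n, (n1 <= i)%N -> \sum_j nu i j + n%:R * delta <= 1.
Hypothesis nu_col : forall j : 'I_n, (n2 <= j)%N -> \sum_i nu i j + n%:R * delta <= 1.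
Hypothesis k_ge0 : forall i j, 0 <= k i j.
Hypothesis k_sum : mxdot k (const_mx 1) = n%:R.

Local Notation W := (@qweight R n).
Local Notation rest := (@cone_rest R n n1 n2 hn1 hn2).
Let D : R := n%:R * amax.+1%:R.
Let dist q := mxnorm2 (rest (natmx R q)).

Lemma nu_fill_cone s w v : s \in S ->
  mxdot (nu - fill (boolmx R s)) (cone_mx n1 n2 w v) = 0.
Proof.
move=> sS; have [_ fr fc] := fill_schedule_ds R hS sS.
by apply: mxdot_cone0 => l lsat; under eq_bigr do rewrite mxE [X in _ + X]mxE;
  rewrite big_split /= sumrN ?fr ?fc ?nu_row1 ?nu_col1 ?subrr.
Qed.

(* MaxWeight does at least as well as [nu + delta * y / |y|], a point of the
   capacity region when [y] is the component of the queues off the cone. *)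
Lemma maxweight_rest (q : 'M[nat]_n) s : s \in maxweight S q ->
  mxdot (rest (natmx R q)) (nu - fill (boolmx R s)) <= - delta * dist q.
Proof.
move=> sq; have [w [v [yE wv0 [yr yc] yx]]] := cone_restP hn1 hn2 (natmx R q).
have sS := maxweight_sub sq.
set y := rest _ in yE yr yc yx *.
have -> : mxdot y (nu - fill (boolmx R s)) =
    mxdot (natmx R q) nu - mxdot (natmx R q) (boolmx R s).
  rewrite -(mxdot_fill_maxweight R hS sq) -mxdotBr yE mxdotBl.
  by rewrite [X in _ - X]mxdotC (nu_fill_cone _ _ sS) subr0.
have [Y0|Y0] := eqVneq (dist q) 0.
  rewrite Y0 mulr0 subr_le0; apply: (maxweight_dominates hS sq).
  split=> [i j|i|j]; first exact: le_trans (ltW delta0) (nu_ge i j).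
    rewrite mxdot_row; have [/nu_row1->//|/nu_row] := ltnP i n1.
    by have := mulr_ge0 (ler0n R n) (ltW delta0); lra.
  rewrite mxdot_col; have [/nu_col1->//|/nu_col] := ltnP j n2.
  by have := mulr_ge0 (ler0n R n) (ltW delta0); lra.
have Yp : 0 < dist q by rewrite lt_def Y0 mxnorm2_ge0.
have d' : 0 < delta / dist q by rewrite divr_gt0.
pose r := nu + (delta / dist q) *: y.
have yle i j : `|delta / dist q * y i j| <= delta.
  rewrite normrM gtr0_norm // mulrAC ler_pdivrMr // ler_pM2l //.
  exact: entry_le_mxnorm2.
(* The saturated sums of [y] are nonpositive, so the move does not increase them; on an unsaturated
   line each entry moves by at most [delta], which the slack [n * delta] absorbs. *)
have rcap : capacity_region r.
  split=> [i j|i|j].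
  - rewrite !mxE; have := yle i j; have := nu_ge i j.
    by rewrite ler_norml => ? /andP[? _]; lra.
  - rewrite mxdot_row; under eq_bigr do rewrite mxE [X in _ + X]mxE.
    rewrite big_split /=; have [i1|i1] := ltnP i n1.
      rewrite nu_row1 // gerDl -mulr_sumr mulr_ge0_le0 ?(ltW d') //.
      exact: yr.
    apply: le_trans (nu_row i1); rewrite lerD2l -sumr_ord; apply: ler_sum => j _.
    exact: le_trans (ler_norm _) (yle i j).
  - rewrite mxdot_col; under eq_bigr do rewrite mxE [X in _ + X]mxE.
    rewrite big_split /=; have [i1|i1] := ltnP j n2.
      rewrite nu_col1 // gerDl -mulr_sumr mulr_ge0_le0 ?(ltW d') //.
      exact: yc.
    apply: le_trans (nu_col i1); rewrite lerD2l -sumr_ord; apply: ler_sum => i _.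
    exact: le_trans (ler_norm _) (yle i j).
have := maxweight_dominates hS sq rcap; rewrite mxdotDr mxdotZr.
have -> : mxdot (natmx R q) y = dist q ^+ 2.
  have -> : natmx R q = y + cone_mx n1 n2 w v by rewrite yE subrK.
  by rewrite mxdotDl (mxdotC (cone_mx _ _ _ _)) yx addr0 sqr_mxnorm2.
have -> : delta / dist q * dist q ^+ 2 = delta * dist q by field.
lra.
Qed.

Local Notation Phi := (@sat_form R n n1 n2).
Local Notation proj := (@sat_proj R n n1 n2).
Local Notation ones := (sat_ones R n n1 n2).
Let CT := sat_bound R n n1 n2.
Let c1 := 2 * n%:R * amax%:R + CT * n%:R.
Let c2 := 2 * (n%:R + CT).

Lemma sat_ones_sum (x : 'M[R]_n) : (forall i j, 0 <= x i j) ->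
  0 <= mxdot x ones <= 2 * mxdot x (const_mx 1).
Proof.
move=> x0; apply/andP; split.
  by apply: mxdot_ge0 => // i j; exact: sat_ones_ge0.
rewrite -mxdotZr; apply: ler_mxdot => // i j; rewrite [leRHS]mxE [X in _ * X]mxE mulr1.
exact: sat_ones_le2.
Qed.

Section Slot.
Variables (q a : 'M[nat]_n) (s : 'M[bool]_n).
Hypothesis sq : s \in maxweight S q.
Hypothesis aA : forall i j, (a i j <= amax)%N.
Let u := unused R q s a.
Let q' := natmx R (next_queue q a s).

(** [proj] multiplies the cone part of [q'] by [n], so [proj q'] is [n q'] plus a linear image of
    the rest. Where [u] is positive the former is at most [n * amax], and the latter is at most
    [(n + CT)] times the distance; [c1] collects the first bound and that of [Phi u u], [c2] the
    second. *)
Lemma unused_error r : 0 < r ->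
  `|2 * Phi u q' - Phi u u| <=
  (c1 + c2 * n%:R ^+ 2 / r) * mxdot u ones + c2 * r / 2 * dist (next_queue q a s) ^+ 2.
Proof.
move=> r0; have uP i j := unusedP R hS sq aA i j.
have u0 i j : 0 <= u i j by have [/andP[]] := uP i j.
have u1 i j : `|u i j| <= 1 by rewrite ger0_norm //; have [/andP[]] := uP i j.
have CT0 : 0 <= CT := sat_bound_ge0 R n n1 n2.
set Y := dist _; have Y0 : 0 <= Y := mxnorm2_ge0 _.
have [w [v [yE _ _ _]]] := cone_restP hn1 hn2 q'.
have e1 : `|Phi u q'| <= (n%:R * amax%:R + (n%:R + CT) * Y) * mxdot u ones.
  apply: sat_form_le => // [|i j].
    by rewrite addr_ge0 // ?mulr_ge0 // addr_ge0.
  have -> : proj q' i j = n%:R * q' i j + (- (n%:R * rest q' i j) + proj (rest q') i j).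
    have q'E : q' = cone_mx n1 n2 w v + rest q' by rewrite yE addrC subrK.
    rewrite {1}q'E sat_proj_entry mxdotDl -!sat_proj_entry sat_proj_cone //.
    by rewrite {2}q'E !mxE; ring.
  rewrite mulrDr; apply: le_trans (ler_normD _ _) _; rewrite [leRHS]mulrDr lerD //.
    have [_ _ h] := uP i j; rewrite mulrCA [leRHS]mulrCA ger0_norm.
      by rewrite ler_wpM2l // mulrC [leRHS]mulrC.
    by rewrite !mulr_ge0 // natmx_ge0.
  rewrite normrM (ger0_norm (u0 i j)) ler_wpM2l //.
  apply: le_trans (ler_normD _ _) _; rewrite mulrDl lerD //.
    by rewrite normrN normrM ger0_norm // ler_wpM2l // entry_le_mxnorm2.
  exact: sat_proj_le.
have e2 : `|Phi u u| <= CT * n%:R * mxdot u ones.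
  apply: sat_form_le => // [|i j]; first by rewrite mulr_ge0.
  rewrite normrM (ger0_norm (u0 i j)) ler_wpM2l //.
  apply: le_trans (sat_proj_le _ _ _ _ _) _; rewrite -/CT ler_wpM2l //.
  by have := mxnorm2_entries ler01 u1; rewrite mulr1.
have /andP[U0 U1] := sat_ones_sum u0; set U := mxdot u ones in U0 U1 e1 e2 *.
(* Replaces [U ^+ 2] by a multiple of [U] after the AM-GM step, so that only the mean of [U], of
   order [eps], is needed. *)
have Un : U <= 2 * n%:R ^+ 2.
  apply: le_trans U1 _; rewrite ler_wpM2l //.
  apply: (@le_trans _ _ (\sum_(i < n) \sum_(j < n) 1)).
    do 2![apply: ler_sum => ? _]; rewrite [X in _ * X]mxE mulr1.
    exact: le_trans (ler_norm _) (u1 _ _).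
  by rewrite !sumr_ord mulr1.
apply: le_trans (ler_normB _ _) _; rewrite normrM ger0_norm //.
apply: (@le_trans _ _ (c1 * U + c2 * (Y * U))).
  by apply: le_trans (lerD (ler_wpM2l _ e1) e2) _ => //; rewrite /c1 /c2; lra.
have c20 : 0 <= c2 by rewrite mulr_ge0 // addr_ge0.
have YU : Y * U <= n%:R ^+ 2 / r * U + r / 2 * Y ^+ 2.
  (* AM-GM; [r = sqrt eps] in the end *)
  apply: (@le_trans _ _ (U ^+ 2 / (2 * r) + r / 2 * Y ^+ 2)).
    have : 0 <= (U - r * Y) ^+ 2 / (2 * r) by rewrite divr_ge0 ?sqr_ge0 // mulr_ge0 // ltW.
    have -> : (U - r * Y) ^+ 2 / (2 * r) = U ^+ 2 / (2 * r) - Y * U + r / 2 * Y ^+ 2.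
      by field; rewrite gt_eqF.
    lra.
  rewrite lerD2r ler_pdivrMr ?mulr_gt0 //.
  have -> : n%:R ^+ 2 / r * U * (2 * r) = 2 * n%:R ^+ 2 * U by field; rewrite gt_eqF.
  by rewrite expr2 ler_wpM2r.
have -> : (c1 + c2 * n%:R ^+ 2 / r) * U + c2 * r / 2 * Y ^+ 2 =
    c1 * U + c2 * (n%:R ^+ 2 / r * U + r / 2 * Y ^+ 2) by ring.
by rewrite lerD2l ler_wpM2l.
Qed.

Variables (eps : R) (rt : 'M[R]_n).
Hypothesis rtE : rt = nu - eps *: k.

Lemma sat_form_step : let z := natmx R a - rt in
  Phi q' q' = Phi (natmx R q) (natmx R q) +
    mxdot z (2 *: proj (natmx R q) - (2 * eps) *: proj k) -
    2 * eps * Phi (natmx R q) k + Phi z z + eps ^+ 2 * Phi k k +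
    (2 * Phi u q' - Phi u u).
Proof.
move=> z; have sS := maxweight_sub sq.
apply: sat_form_expand => y.
have -> : q' = natmx R q + z + (- eps) *: k + u + (nu - fill (boolmx R s)).
  rewrite /q' (next_queueE R) -/u /z rtE scaleNr.
  move: u (fill _) (natmx R q) (natmx R a) (eps *: k) => v f b c e.
  rewrite opprB !addrA [b + c + e - nu - e]addrAC addrK.
  by rewrite [b + c - nu + v]addrAC subrK addrAC.
by rewrite sat_formDl [X in _ + X](nu_fill_cone _ _ sS) addr0.
Qed.

(** Conservation of packets on the saturated lines, the completed schedule being replaced by [nu],
    which has the same sums. In steady state the queue terms cancel and the mean is
    [eps * mxdot k ones]. *)
Lemma unused_ones : mxdot u ones = mxdot q' ones - mxdot (natmx R q) ones -
  mxdot (natmx R a) ones + mxdot nu ones.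
Proof.
have : mxdot (nu - fill (boolmx R s)) ones = 0 := nu_fill_cone _ _ (maxweight_sub sq).
rewrite mxdotBl => /eqP.
rewrite subr_eq0 => /eqP ->; rewrite /q' (next_queueE R) -/u.
by move: u (fill _) => v f; rewrite !mxdotDl mxdotNl; ring.
Qed.

End Slot.

Section Regime.
Variables (eps : R) (p : 'I_n -> 'I_n -> 'I_amax.+1 -> R).
Hypothesis p_ge0 : forall i j l, 0 <= p i j l.
Hypothesis p_sum1 : forall i j, \sum_l p i j l = 1.
Hypothesis rateE : rate p = nu - eps *: k.
Hypothesis eps0 : 0 < eps.
Hypothesis eps_le : eps * n%:R <= delta / 2.

Local Notation K := (queue_op S p).
Local Notation E := (mean_slot S p).

Lemma rest_increment (q a : 'M[nat]_n) s :
  s \in maxweight S q -> (forall i j, (a i j <= amax)%N) ->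
  mxdot (rest (natmx R q)) (natmx R (next_queue q a s) - natmx R q) <=
  mxdot (rest (natmx R q)) (natmx R a - rate p) - delta / 2 * dist q.
Proof.
move=> sq aA; have mw := maxweight_rest sq.
have [w [v [yE wv0 _ _]]] := cone_restP hn1 hn2 (natmx R q).
set y := rest _ in mw yE *; set f := fill _ in mw.
have uP := unusedP R hS sq aA; set u := unused R q s a in uP.
have -> : natmx R (next_queue q a s) - natmx R q =
    (natmx R a - rate p) + (nu - f) - eps *: k + u.
  rewrite (next_queueE R) rateE -/f -/u.
  by apply/matrixP => i j; rewrite !mxE; ring.
rewrite [leLHS]mxdotDr [X in X + _]mxdotBr [X in X - _]mxdotDr mxdotZr.
have yu : mxdot y u <= 0.
  rewrite yE mxdotBl (_ : mxdot (natmx R q) u = 0) ?sub0r ?oppr_le0.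
    apply: mxdot_ge0 => i j; last by have [/andP[]] := uP i j.
    have [wi vi] := (wv0 i, wv0 j).
    by rewrite mxE addr_ge0 // mulr_ge0 //; [case: wi | case: vi].
  by apply: big1 => i _; apply: big1 => j _; have [] := uP i j.
have yk : - (eps * mxdot y k) <= delta / 2 * dist q.
  apply: (@le_trans _ _ (eps * n%:R * dist q)); last first.
    by rewrite ler_wpM2r // mxnorm2_ge0.
  rewrite -mulrN -mulrA ler_pM2l // -mxdotNl mxdotC -k_sum mulrC -mxdotZr.
  apply: ler_mxdot => // i j; rewrite !mxE mulr1.
  by have := entry_le_mxnorm2 y i j; rewrite -normrN; apply: le_trans; exact: ler_norm.
lra.
Qed.

(* The negative cubic term bounds the second moment of [dist] in steady state. *)
Lemma rest_step (q a : 'M[nat]_n) s :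
  s \in maxweight S q -> (forall i j, (a i j <= amax)%N) ->
  dist (next_queue q a s) ^+ 4 <=
  4 * dist q ^+ 2 * mxdot (rest (natmx R q)) (natmx R a - rate p) +
  (dist q ^+ 4 - 2 * delta * dist q ^+ 3 + 10 * D ^+ 2 * dist q ^+ 2 + 2 * D ^+ 4).
Proof.
move=> sq aA; have inc := rest_increment sq aA.
pose xi := natmx R (next_queue q a s) - natmx R q; rewrite -/xi in inc.
have [w [v [yE wv0 _ _]]] := cone_restP hn1 hn2 (natmx R q).
(* The cone point of the old queues bounds the distance of the new ones to the cone. *)
have := @cone_rest_min _ _ _ _ hn1 hn2 (natmx R (next_queue q a s)) w v
  (fun i => (wv0 i).1) (fun i => (wv0 i).2).
have -> : natmx R (next_queue q a s) - cone_mx n1 n2 w v = rest (natmx R q) + xi.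
  by apply/matrixP => i j; rewrite yE /xi !mxE; ring.
rewrite mxdot_sqrD -!(sqr_mxnorm2 (rest _)) -!/(dist _).
have xiD : mxdot xi xi <= D ^+ 2.
  by apply: mxdot_self_le => // i j; exact: increment_le.
have D0 : 0 <= D by rewrite mulr_ge0.
have xi0 := mxdot_self_ge0 xi.
have Y0 : 0 <= dist q := mxnorm2_ge0 _.
have xin : mxnorm2 xi <= D by apply: mxnorm2_le.
have yxi : `|mxdot (rest (natmx R q)) xi| <= dist q * D.
  by apply: le_trans (mxdot_norm_le _ _) _; rewrite ler_wpM2l // mxnorm2_ge0.
rewrite -/(dist q) in yxi *.
move: inc yxi; set c := mxdot _ xi; set e := mxdot _ (_ - rate p).
set Y := dist q in Y0 *; set Y' := dist _; set x2 := mxdot xi xi in xiD xi0 *.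
rewrite ler_norml => inc /andP[l1 l2] Y'le.
(* Bounds the increase of the squared distance: from above it carries the drift, and its absolute
   value only enters through [Del ^+ 2]. *)
pose Del := 2 * c + x2.
have h : Y' ^+ 2 <= Y ^+ 2 + Del by rewrite /Del; lra.
have h4 : Y' ^+ 4 <= (Y ^+ 2 + Del) ^+ 2.
  rewrite (exprM Y' 2 2) ler_pXn2r // nnegrE ?sqr_ge0 //.
  exact: le_trans (sqr_ge0 _) h.
apply: le_trans h4 _.
have De : Del <= 2 * e - delta * Y + D ^+ 2 by rewrite /Del; lra.
have Dabs : `|Del| <= 2 * (Y * D) + D ^+ 2.
  by have D20 := sqr_ge0 D; rewrite /Del ler_norml; apply/andP; split; lra.
have Dsq : Del ^+ 2 <= 8 * (Y * D) ^+ 2 + 2 * D ^+ 4.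
  apply: (@le_trans _ _ ((2 * (Y * D) + D ^+ 2) ^+ 2)).
    rewrite -real_normK ?num_real // ler_pXn2r // nnegrE //.
    exact: le_trans Dabs.
  have := sqr_ge0 (2 * (Y * D) - D ^+ 2).
  have -> : D ^+ 4 = (D ^+ 2) ^+ 2 by rewrite -exprM.
  by move: (Y * D) (D ^+ 2) => y1 d1; lra.
have YDel : 2 * Y ^+ 2 * Del <= 2 * Y ^+ 2 * (2 * e - delta * Y + D ^+ 2).
  by rewrite ler_wpM2l // mulr_ge0 // sqr_ge0.
have -> : (Y ^+ 2 + Del) ^+ 2 = Y ^+ 4 + 2 * Y ^+ 2 * Del + Del ^+ 2 by ring.
apply: le_trans (lerD (lerD (lexx _) YDel) Dsq) _.
lra.
Qed.

Lemma dist_le_qnorm q : dist q <= qnorm R q.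
Proof.
rewrite /dist /qnorm -(ler_pXn2r (isT : (0 < 2)%N)) ?nnegrE //.
by rewrite !sqr_mxnorm2 cone_rest_le.
Qed.

Lemma dist_dominated m : (m <= 4)%N -> dominated W (fun q => dist q ^+ m).
Proof.
move=> m4; exists 1 => q; rewrite mul1r.
have Y0 : 0 <= dist q := mxnorm2_ge0 _.
have Yq := dist_le_qnorm q.
rewrite ger0_norm ?exprn_ge0 //.
apply: (@le_trans _ _ ((1 + qnorm R q) ^+ m)).
  by rewrite lerXn2r ?nnegrE ?addr_ge0 //; lra.
by rewrite /qweight ler_weXn2l // lerDl.
Qed.

Variable pi : ('M[nat]_n -> R) -> R.
Hypothesis piP : steady_functional K W pi.

(** Stationarity of the fourth power of the distance. The cubic term absorbs the quadratic ones and,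
    through the [+ 1], one more square, whose steady mean is then bounded by the constants. *)
Lemma steady_dist_le M :
  (forall Y, 0 <= Y -> (10 * D ^+ 2 + 1) * Y ^+ 2 - 2 * delta * Y ^+ 3 <= M) ->
  pi (fun q => dist q ^+ 2) <= M + 2 * D ^+ 4.
Proof.
move=> HM; have n0 := leq_ltn_trans (leq0n _) hn1.
have mK := queue_op_markov hS p_ge0 p_sum1.
have d4 := dist_dominated (isT : (4 <= 4)%N).
have d2 := dist_dominated (isT : (2 <= 4)%N).
have W1 := @qweight_ge1 R n.
have dK := queue_op_dominated n0 hS p_ge0 p_sum1 d4.
have dc := dominated_cst W1 (M + 2 * D ^+ 4).
have := @steady_le _ _ _ _ _ mK piP 0 _ _ dK
  (dominatedD (dominatedB d4 d2) dc).
rewrite (steady_invariant piP 0 d4 dK).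
rewrite (steadyD mK piP 0 (dominatedB d4 d2) dc) (steadyB mK W1 piP 0 d4 d2).
rewrite (steady_cst mK W1 piP 0).
suff H q : K (fun q => dist q ^+ 4) q <= dist q ^+ 4 - dist q ^+ 2 + (M + 2 * D ^+ 4).
  by move=> /(_ H); lra.
have Y0 : 0 <= dist q := mxnorm2_ge0 _.
apply: (@le_trans _ _ (E q (fun _ a =>
  4 * dist q ^+ 2 * (mxdot (natmx R a) (rest (natmx R q))) +
  (- (4 * dist q ^+ 2 * mxdot (rate p) (rest (natmx R q))) + (dist q ^+ 4 - 2 * delta * dist q ^+ 3 + 10 * D ^+ 2 * dist q ^+ 2 + 2 * D ^+ 4))))).
  apply: mean_slot_le => // s a sq aA; apply: le_trans (rest_step sq aA) _.
  by rewrite mxdotBr !(mxdotC (rest _)); lra.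
rewrite mean_slot_lin (mean_slot_cst hS p_sum1) (mean_slot_dot hS p_sum1).
by have := HM _ Y0; lra.
Qed.

Let F q := Phi (natmx R q) (natmx R q).
Let g q := mxdot (natmx R q) ones.

(** The centered arrivals are uncorrelated, so only the diagonal values of the form survive,
    weighted by the variances. *)
Lemma mean_sat_form q : E q (fun _ a => Phi (natmx R a - rate p) (natmx R a - rate p)) =
  mxdot (rate_var p) (zeta R n n1 n2).
Proof.
transitivity (E q (fun _ a => \sum_c mxdot (natmx R a - rate p) (delta_mx c.1 c.2) *
    mxdot (natmx R a - rate p) (proj (delta_mx c.1 c.2)))).
  apply: (mean_slot_ext p_ge0) => s a _ _; rewrite /sat_form mxdot_pair.
  by apply: eq_bigr => c _; rewrite mxdot_delta -sat_proj_entry.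
rewrite (mean_slot_sum hS p_ge0 p_sum1) mxdot_pair; apply: eq_bigr => c _.
rewrite (mean_slot_dot2 hS p_sum1) -sat_form_delta // /sat_form [in RHS]mxdotC.
have dE i j : delta_mx c.1 c.2 i j = ((i == c.1) && (j == c.2))%:R :> R.
  by rewrite mxE.
rewrite [in RHS]mxdot_delta (bigD1 c.1) //= (bigD1 c.2) //= dE !eqxx mul1r.
rewrite !big1 ?addr0 // => [i /negPf ic|j /negPf jc].
  by apply: big1 => j _; rewrite dE ic mul0r mulr0.
by rewrite dE jc andbF mul0r mulr0.
Qed.

Lemma mean_unused_ones q : E q (fun s a => mxdot (unused R q s a) ones) =
  K g q - g q + eps * mxdot k ones.
Proof.
rewrite (mean_slot_ext p_ge0 (H := fun s a => g (next_queue q a s) +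
  (-1 * mxdot (natmx R a) ones + (mxdot nu ones - g q)))); last first.
  by move=> s a sq aA; rewrite unused_ones // /g; ring.
rewrite (mean_slotD S p_ge0) mean_slot_lin (mean_slot_dot hS p_sum1).
rewrite (mean_slot_cst hS p_sum1) rateE mxdotBl mxdotZl /queue_op.
by set x := mean_slot _ _ _ _; ring.
Qed.

(** The balance given the current queues, before stationarity: the differences [K F q - F q] and
    [K g q - g q] disappear under the steady functional. *)
Lemma slot_balance q r : 0 < r ->
  `|K F q - F q + 2 * eps * Phi (natmx R q) k -
    (mxdot (rate_var p) (zeta R n n1 n2) + eps ^+ 2 * Phi k k)| <=
  (c1 + c2 * n%:R ^+ 2 / r) * (K g q - g q + eps * mxdot k ones) +
  c2 * r / 2 * K (fun q => dist q ^+ 2) q.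
Proof.
move=> r0.
pose err s a := 2 * Phi (unused R q s a) (natmx R (next_queue q a s)) -
  Phi (unused R q s a) (unused R q s a).
pose U := 2 *: proj (natmx R q) - (2 * eps) *: proj k.
pose z a := natmx R a - rate p.
have KF : K F q = mxdot (rate p) U + (F q - mxdot (rate p) U -
    2 * eps * Phi (natmx R q) k + eps ^+ 2 * Phi k k) +
    mxdot (rate_var p) (zeta R n n1 n2) + E q err.
  rewrite /queue_op (mean_slot_ext p_ge0 (H := fun s a => mxdot (natmx R a) U +
    (F q - mxdot (rate p) U - 2 * eps * Phi (natmx R q) k + eps ^+ 2 * Phi k k) +
    Phi (z a) (z a) + err s a)).
    rewrite 3!(mean_slotD S p_ge0) (mean_slot_dot hS p_sum1).
    by rewrite (mean_slot_cst hS p_sum1) mean_sat_form.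
  move=> s a sq aA; rewrite /F (sat_form_step a sq rateE) -/U mxdotBl -/(err s a) -/(z a).
  by rewrite -/(F q); set x := Phi (z a) _; ring.
have -> : K F q - F q + 2 * eps * Phi (natmx R q) k -
    (mxdot (rate_var p) (zeta R n n1 n2) + eps ^+ 2 * Phi k k) = E q err.
  by rewrite KF; ring.
apply: le_trans (mean_slot_norm hS p_ge0 p_sum1 _ _) _.
rewrite -mean_unused_ones -(mean_slotZ hS p_ge0 p_sum1) -(mean_slotZ hS p_ge0 p_sum1).
rewrite -(mean_slotD S p_ge0); apply: (mean_slot_le p_ge0) => s a sq aA.
exact: unused_error.
Qed.

Lemma form_dominated : dominated W F.
Proof.
exists (n%:R * sat_bound R n n1 n2) => q.
have CT0 := sat_bound_ge0 R n n1 n2.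
apply: le_trans (mxdot_norm_le _ _) _.
apply: (@le_trans _ _ (qnorm R q * (n%:R * (sat_bound R n n1 n2 * qnorm R q)))).
  rewrite ler_pM //; apply: mxnorm2_entries => [|i j].
    by rewrite mulr_ge0.
  exact: sat_proj_le.
rewrite mulrC -!mulrA !ler_wpM2l //; rewrite /qweight -expr2.
apply: (@le_trans _ _ ((1 + qnorm R q) ^+ 2)).
  by rewrite lerXn2r ?nnegrE ?addr_ge0 // lerDr.
by rewrite ler_weXn2l // lerDl.
Qed.

Lemma steady_balance r : 0 < r ->
  `|2 * eps * pi (fun q => Phi (natmx R q) k) -
    (mxdot (rate_var p) (zeta R n n1 n2) + eps ^+ 2 * Phi k k)| <=
  (c1 + c2 * n%:R ^+ 2 / r) * (eps * mxdot k ones) +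
  c2 * r / 2 * pi (fun q => dist q ^+ 2).
Proof.
move=> r0; have n0 := leq_ltn_trans (leq0n _) hn1.
have mK := queue_op_markov hS p_ge0 p_sum1.
have W1 := @qweight_ge1 R n.
have Kd f := @queue_op_dominated R n amax S n0 hS p p_ge0 p_sum1 f.
have dF := form_dominated; have dKF := Kd _ dF.
have dg : dominated W g := linear_dominated _; have dKg := Kd _ dg.
have dd : dominated W (fun q => dist q ^+ 2).
  exact: (dist_dominated (isT : (2 <= 4)%N)).
have dKd := Kd _ dd.
have dk : dominated W (fun q => Phi (natmx R q) k) := linear_dominated _.
have dc c : dominated W (fun=> c) := dominated_cst W1 c.
pose s0 := mxdot (rate_var p) (zeta R n n1 n2) + eps ^+ 2 * Phi k k.
pose A := c1 + c2 * n%:R ^+ 2 / r; pose B := c2 * r / 2.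
pose L q := K F q - F q + 2 * eps * Phi (natmx R q) k - s0.
pose H q := A * (K g q - g q + eps * mxdot k ones) + B * K (fun q => dist q ^+ 2) q.
have dL1 := dominatedB dKF dF; have dL2 := dominatedZ (2 * eps) dk.
have dL3 := dominatedD dL1 dL2.
have dL : dominated W L := dominatedB dL3 (dc s0).
have dH1 := dominatedB dKg dg; have dH2 := dominatedD dH1 (dc (eps * mxdot k ones)).
have dH3 := dominatedZ A dH2; have dH4 := dominatedZ B dKd.
have dH : dominated W H := dominatedD dH3 dH4.
have piL : pi L = 2 * eps * pi (fun q => Phi (natmx R q) k) - s0.
  rewrite (steadyB mK W1 piP 0 dL3 (dc s0)) (steadyD mK piP 0 dL1 dL2).
  rewrite (steadyB mK W1 piP 0 dKF dF) (steady_invariant piP 0 dF dKF).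
  by rewrite (steadyZ mK W1 piP 0 _ dk) (steady_cst mK W1 piP 0) subrr add0r.
have piH : pi H = A * (eps * mxdot k ones) + B * pi (fun q => dist q ^+ 2).
  rewrite (steadyD mK piP 0 dH3 dH4) !(steadyZ mK W1 piP 0) //.
  rewrite (steadyD mK piP 0 dH1 (dc _)) (steadyB mK W1 piP 0 dKg dg).
  rewrite (steady_invariant piP 0 dg dKg) (steady_invariant piP 0 dd dKd).
  by rewrite (steady_cst mK W1 piP 0) subrr add0r.
have LH q : `|L q| <= H q by exact: slot_balance.
by rewrite -/s0 -/A -/B -piL -piH; exact: (steady_norm_le mK W1 piP 0 dL dH).
Qed.

Lemma steady_dist1_le M : pi (fun q => dist q ^+ 2) <= M ->
  pi dist <= 1 + M.
Proof.
move=> HM; have mK := queue_op_markov hS p_ge0 p_sum1.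
have W1 := @qweight_ge1 R n.
have dd : dominated W (fun q => dist q ^+ 2).
  exact: (dist_dominated (isT : (2 <= 4)%N)).
have d1 : dominated W dist.
  exact: (dist_dominated (isT : (1 <= 4)%N)).
have dc := dominated_cst W1 1.
apply: (@le_trans _ _ (pi (fun q => 1 + dist q ^+ 2))).
  apply: (steady_le mK piP 0 d1 (dominatedD dc dd)) => q.
  by have := sqr_ge0 (dist q - 1 / 2); lra.
by rewrite (steadyD mK piP 0 dc dd) (steady_cst mK W1 piP 0) lerD2l.
Qed.

(** Cone matrices vanish at a doubly unsaturated entry, so the queue there is an entry of the
    rest. *)
Lemma steady_unsaturated_le M (i j : 'I_n) : pi dist <= M ->
  (n1 <= i)%N -> (n2 <= j)%N -> pi (fun q => (q i j)%:R) <= M.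
Proof.
move=> HM i1 j2; have mK := queue_op_markov hS p_ge0 p_sum1.
have d1 : dominated W dist.
  exact: (dist_dominated (isT : (1 <= 4)%N)).
have dq := linear_dominated (delta_mx i j : 'M[R]_n).
apply: le_trans HM.
have -> : (fun q : 'M[nat]_n => (q i j)%:R) =
    (fun q => mxdot (natmx R q) (delta_mx i j)).
  by apply/funext => q; rewrite mxdot_delta mxE.
apply: (steady_le mK piP 0 dq d1) => q; rewrite mxdot_delta.
have [w [v [yE _ _ _]]] := cone_restP hn1 hn2 (natmx R q).
have -> : natmx R q i j = rest (natmx R q) i j.
  have := congr1 (fun M : 'M[R]_n => M i j) yE; rewrite /= => ->.
  have -> : (natmx R q - cone_mx n1 n2 w v) i j = natmx R q i j - cone_mx n1 n2 w v i j.
    by rewrite mxE [X in _ + X]mxE.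
  by rewrite [cone_mx _ _ _ _ _ _]mxE (ltnNge i) i1 (ltnNge j) j2 !mul0r addr0 subr0.
exact: le_trans (ler_norm _) (entry_le_mxnorm2 _ _ _).
Qed.

(** [alpha - proj k] is orthogonal to the cone, as [proj] is symmetric and multiplies cone matrices
    by [n]: only the rest pairs with it. *)
Lemma steady_alpha M (alpha : 'M[R]_n) :
  (forall i : 'I_n, (i < n1)%N -> rsum alpha i = n%:R * rsum k i) ->
  (forall j : 'I_n, (j < n2)%N -> csum alpha j = n%:R * csum k j) ->
  pi dist <= M ->
  `|pi (fun q => mxdot (natmx R q) alpha) - pi (fun q => Phi (natmx R q) k)| <=
  mxnorm2 (alpha - proj k) * M.
Proof.
move=> ar ac HM; have mK := queue_op_markov hS p_ge0 p_sum1.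
have W1 := @qweight_ge1 R n.
have d1 : dominated W dist.
  exact: (dist_dominated (isT : (1 <= 4)%N)).
have da := linear_dominated alpha.
have dk : dominated W (fun q => Phi (natmx R q) k) := linear_dominated _.
have dB := dominatedB da dk; set c := mxnorm2 _.
have c0 : 0 <= c := mxnorm2_ge0 _.
have dZ := dominatedZ c d1.
have rest_dot q : mxdot (natmx R q) alpha - Phi (natmx R q) k =
    mxdot (rest (natmx R q)) (alpha - proj k).
  have [w [v [yE _ _ _]]] := cone_restP hn1 hn2 (natmx R q).
  have e : mxdot (cone_mx n1 n2 w v) alpha = Phi (cone_mx n1 n2 w v) k.
    rewrite sat_formC /sat_form sat_proj_cone // mxdotC mxdotZr !mxdot_cone.
    rewrite mulrDr !mulr_sumr; congr (_ + _); apply: eq_bigr => l lsat.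
      by have := ar l lsat; rewrite /rsum => ->; rewrite mulrCA.
    by have := ac l lsat; rewrite /csum => ->; rewrite mulrCA.
  rewrite yE mxdotBr !mxdotBl -/(Phi (natmx R q) k) -/(Phi (cone_mx _ _ _ _) k) e.
  by ring.
apply: (@le_trans _ _ (c * pi dist)); last by rewrite ler_wpM2l.
rewrite -(steadyZ mK W1 piP 0 c d1) -(steadyB mK W1 piP 0 da dk).
apply: (steady_norm_le mK W1 piP 0 dB dZ) => q.
by rewrite rest_dot mulrC; exact: mxdot_norm_le.
Qed.

End Regime.

(** The order of the quantifiers is the content: the bound on the cubic depends on [delta], [n] and
    [amax] alone, hence is chosen before [eps] and the arrival law. *)
Lemma steady_dist_uniform : exists2 M, 0 <= M & forall eps (p : 'I_n -> 'I_n -> 'I_amax.+1 -> R) pi, steady_limit S p pi ->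
  rate p = nu - eps *: k -> 0 < eps -> eps * n%:R <= delta / 2 ->
  pi (fun q => dist q ^+ 2) <= M.
Proof.
have d0 : 0 < 2 * delta by rewrite mulr_gt0.
have D0 : 0 <= 10 * D ^+ 2 + 1 by rewrite addr_ge0 // mulr_ge0 // sqr_ge0.
have [M HM] := cubic_bound d0 D0.
have M0 : 0 <= M by have := HM 0 (lexx 0); rewrite !expr0n /= !mulr0 subr0.
exists (M + 2 * D ^+ 4).
  by rewrite addr_ge0 // mulr_ge0 // (exprM D 2 2) sqr_ge0.
move=> eps p pi [p0 p1 piP] rE e0 e1.
exact: (steady_dist_le p0 p1 rE e0 e1 piP HM).
Qed.

Lemma heavy_traffic_bound (alpha : 'M[R]_n) :
  (forall i : 'I_n, (i < n1)%N -> rsum alpha i = n%:R * rsum k i) ->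
  (forall j : 'I_n, (j < n2)%N -> csum alpha j = n%:R * csum k j) ->
  exists C, forall eps (p : 'I_n -> 'I_n -> 'I_amax.+1 -> R) pi, steady_limit S p pi ->
  rate p = nu - eps *: k -> 0 < eps <= 1 -> eps * n%:R <= delta / 2 ->
  `|eps * pi (fun q => mxdot (natmx R q) alpha) -
    1 / 2 * mxdot (rate_var p) (zeta R n n1 n2)| <= C * Num.sqrt eps.
Proof.
move=> ar ac; have [M M0 HM] := steady_dist_uniform.
pose CL := mxnorm2 (alpha - proj k).
have CT0 : 0 <= CT := sat_bound_ge0 R n n1 n2.
have c10 : 0 <= c1 by rewrite addr_ge0 ?mulr_ge0.
have c20 : 0 <= c2 by rewrite mulr_ge0 // addr_ge0.
exists ((`|Phi k k| + 2 * n%:R * (c1 + c2 * n%:R ^+ 2) + c2 * M / 2) / 2 + CL * (1 + M)).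
move=> eps p pi sl rE /andP[e0 e1] en; have dM := HM _ _ _ sl rE e0 en.
have [p0 p1 piP] := sl.
have d1 := steady_dist1_le p0 p1 piP dM.
have := steady_alpha p0 p1 piP ar ac d1.
(* The choice that balances [eps / r] against [r]. *)
pose r := Num.sqrt eps; have r0 : 0 < r by rewrite sqrtr_gt0.
have rr : r ^+ 2 = eps by rewrite sqr_sqrtr // ltW.
have r1 : r <= 1 by rewrite -(ler_pXn2r (isT : (0 < 2)%N)) ?nnegrE ?(ltW r0) // expr1n rr.
have := steady_balance p0 p1 rE piP r0.
rewrite -/CL -/r; set X := pi (fun q => Phi _ _); set Z := pi (fun q => mxdot _ _).
set V := mxdot (rate_var p) _ => h1 h2.
have := sat_ones_sum k_ge0; rewrite k_sum => /andP[k0 kn]; set kap := mxdot k ones in k0 kn h1.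
have CL0 : 0 <= CL := mxnorm2_ge0 _.
have -> : eps * Z - 1 / 2 * V = ((2 * eps * X - (V + eps ^+ 2 * Phi k k)) +
    eps ^+ 2 * Phi k k) / 2 + eps * (Z - X) by field.
apply: le_trans (ler_normD _ _) _; rewrite [leRHS]mulrDl lerD //; last first.
  have er : eps <= r by rewrite -rr -[leRHS]expr1 ler_wiXn2l // ltW.
  rewrite normrM (gtr0_norm e0); apply: le_trans (ler_wpM2r (normr_ge0 _) er) _.
  by rewrite mulrC ler_wpM2r // ltW.
rewrite normrM [`|2^-1|]ger0_norm // [leRHS]mulrAC ler_wpM2r //.
apply: le_trans (ler_normD _ _) _.
have h3 : `|eps ^+ 2 * Phi k k| <= `|Phi k k| * r.
  rewrite normrM mulrC ler_wpM2l // ger0_norm ?sqr_ge0 // -rr -exprM.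
  by rewrite -[leRHS]expr1 ler_wiXn2l // ltW.
have h4 : (c1 + c2 * n%:R ^+ 2 / r) * (eps * kap) <=
    2 * n%:R * (c1 + c2 * n%:R ^+ 2) * r.
  have -> : (c1 + c2 * n%:R ^+ 2 / r) * (eps * kap) =
    kap * r * (c1 * r + c2 * n%:R ^+ 2).
    by rewrite -rr; field; rewrite gt_eqF.
  have n20 : 0 <= n%:R ^+ 2 :> R by rewrite exprn_ge0.
  rewrite [leRHS]mulrAC; apply: ler_pM.
  - by rewrite mulr_ge0 // ltW.
  - by rewrite addr_ge0 // mulr_ge0 // ltW.
  - by rewrite ler_wpM2r // ltW.
  - by rewrite lerD2r ler_piMr.
have h5 : c2 * r / 2 * pi (fun q => dist q ^+ 2) <= c2 * M / 2 * r.
  have -> : c2 * M / 2 * r = c2 * r / 2 * M by ring.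
  by rewrite ler_wpM2l // divr_ge0 // mulr_ge0 // ltW.
apply: le_trans (lerD (le_trans h1 (lerD h4 h5)) h3) _.
lra.
Qed.

Lemma unsaturated_bound : exists C, forall eps (p : 'I_n -> 'I_n -> 'I_amax.+1 -> R) pi, steady_limit S p pi ->
  rate p = nu - eps *: k -> 0 < eps -> eps * n%:R <= delta / 2 ->
  forall i j : 'I_n, (n1 <= i)%N -> (n2 <= j)%N -> pi (fun q => (q i j)%:R) <= C.
Proof.
have [M M0 HM] := steady_dist_uniform; exists (1 + M).
move=> eps p pi sl rE e0 en i j; have [p0 p1 piP] := sl.
apply: (steady_unsaturated_le p0 p1 piP).
exact: (steady_dist1_le p0 p1 piP (HM _ _ _ sl rE e0 en)).
Qed.

End HeavyTraffic.

(** * From the switch to its transition operator *)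

Section ExtendedSums.
Variable R : realType.
Local Open Scope ereal_scope.

(** Sums over a countable type are read along its codes, as series; numbers that code nothing
    contribute 0. *)
Lemma esum_pickle (C : countType) (u : C -> \bar R) : (forall x, 0 <= u x) ->
  \esum_(x in [set: C]) u x =
  \sum_(0 <= k <oo) (if @pickle_inv C k is Some x then u x else 0).
Proof.
move=> u0; pose v k := if @pickle_inv C k is Some x then u x else 0.
have v0 k : 0 <= v k by rewrite /v; case: pickle_inv.
rewrite (@nneseries_esumT _ v) //.
transitivity (\esum_(k in [set pickle x | x in [set: C]]) v k).
  rewrite (esum_image _ pickle) => [|x y _ _]; last exact: (pcan_inj pickleK).
  by apply: eq_esum => x _; rewrite /v pickleK_inv.
rewrite esum_mkcond; apply: eq_esum => k _.
case: ifPn => // /negP kC; rewrite /v; case E : (pickle_inv k) => [x|//].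
exfalso; apply: kC; rewrite inE; exists x => //.
by have := @pickle_invK C k; rewrite E.
Qed.

Lemma esum_delta (C : choiceType) (A : set C) (i : C) (c : \bar R) : 0 <= c ->
  \esum_(x in A) (if x == i then c else 0) = if i \in A then c else 0.
Proof.
move=> c0; pose c' := if i \in A then c else 0.
have c'0 : 0 <= c' by rewrite /c'; case: ifP.
rewrite -/c' -[RHS](@esum_set1 _ _ i (fun=> c')) // [LHS]esum_mkcond [RHS]esum_mkcond.
apply: eq_esum => x _; have [->|xi] := eqVneq x i.
  have -> : i \in [set i] by rewrite inE.
  by [].
have -> : (x \in [set i]) = false by apply/negP; rewrite inE; exact/eqP.
by rewrite if_same.
Qed.

Lemma esum_finType (I : finType) (u : I -> \bar R) : (forall i, 0 <= u i) ->
  \esum_(i in [set: I]) u i = \sum_i u i.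
Proof.
move=> u0; rewrite (eq_esum (b := fun x => \sum_i (if x == i then u i else 0))).
  rewrite esum_sum => [|x i _ _]; last by case: ifP.
  by apply: eq_bigr => i _; rewrite esum_delta // mem_set.
move=> x _; rewrite (bigD1 x) //= eqxx big1 ?adde0 // => i /negPf.
by rewrite eq_sym => ->.
Qed.

End ExtendedSums.

(** * Random variables with countably many values *)

Section Discrete.
Context {d : measure_display} {T : measurableType d} {R : realType}.
Variable P : probability T R.
Local Open Scope ereal_scope.

(** Stated on fibres, which suffices for countably many values and asks for no sigma-algebra on
    [C]. *)
Definition discrete_rv (C : countType) (X : T -> C) :=
  forall x, measurable [set w | X w = x].

Section OneVariable.
Variables (C : countType) (X : T -> C).
Hypothesis mX : discrete_rv X.

Lemma discrete_preimage (B : set C) : measurable (X @^-1` B).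
Proof.
have -> : X @^-1` B = \bigcup_k [set w | pickle (X w) = k /\ B (X w)].
  by apply/seteqP; split=> [w Bw|w [k _ []//]]; exists (pickle (X w)).
apply: bigcupT_measurable => k.
have [[x [xk Bx]]|no] := pselect (exists x, pickle x = k /\ B x).
  rewrite (_ : [set w | _ /\ _] = [set w | X w = x]); first exact: mX.
  apply/seteqP; split=> w /= => [[]|-> //].
  by rewrite -xk => /(pcan_inj pickleK) ->.
rewrite (_ : [set w | _ /\ _] = set0) //.
by apply/seteqP; split=> w //= h; apply: no; exists (X w).
Qed.

Lemma discrete_measurable d' (U : measurableType d') (g : C -> U) :
  measurable_fun [set: T] (fun w => g (X w)).
Proof.
move=> _ Y mY; rewrite setTI.
exact: (discrete_preimage (g @^-1` Y)).
Qed.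

Lemma discrete_comp (C' : countType) (g : C -> C') : discrete_rv (fun w => g (X w)).
Proof. by move=> x; exact: (discrete_preimage [set y | g y = x]). Qed.

Lemma integral_discrete (B : set T) (f : C -> R) : measurable B ->
  (forall x, (0 <= f x)%R) ->
  \int[P]_(w in B) (f (X w))%:E =
  \esum_(x in [set: C]) ((f x)%:E * P (B `&` [set w | X w = x])).
Proof.
move=> mB f0; rewrite esum_pickle => [|x]; last by rewrite mule_ge0 // lee_fin.
pose F k := B `&` [set w | pickle (X w) = k].
have BF : B = \bigcup_k F k.
  apply/seteqP; split=> [w Bw|w [k _ []//]].
  by exists (pickle (X w)).
have mF k : measurable (F k).
  apply: measurableI => //; exact: (discrete_preimage [set x | pickle x = k]).
rewrite {1}BF ge0_integral_bigcup //.
- apply: eq_eseriesr => k _; rewrite /F.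
  case E : (pickle_inv k) => [x|].
    have xk : pickle x = k by have := @pickle_invK C k; rewrite E.
    have -> : [set w | pickle (X w) = k] = [set w | X w = x].
      apply/seteqP; split=> w /= => [|->//]; rewrite -xk.
      exact: (pcan_inj pickleK).
    rewrite -integral_cst; last by apply: measurableI.
    apply: eq_integral => w; rewrite inE => -[_ /= -> //].
  have -> : [set w | pickle (X w) = k] = set0.
    apply/seteqP; split=> w //= kw.
    by have := @pickleK_inv C (X w); rewrite kw E.
  by rewrite setI0 integral_set0.
- apply: (@measurable_funS _ _ _ _ setT) => //.
  by apply/measurable_realfun.measurable_EFinP; exact: discrete_measurable.
- by move=> w _; rewrite lee_fin.
- apply/trivIsetP => i j _ _ ij; rewrite -subset0 => w [[_ /= wi] [_ /= wj]].
  by move/eqP: ij; apply; rewrite -wi -wj.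
Qed.

(** Total probability over the values of [X]: a conditional probability that is the same constant on
    every atom within [A] is the one given [A]. *)
Lemma product_rule (A B : set T) (c : R) : measurable A -> measurable B ->
  (0 <= c)%R ->
  (forall w0, A w0 -> P (A `&` [set w | X w = X w0] `&` B) =
     P (A `&` [set w | X w = X w0]) * c%:E) ->
  P (A `&` B) = P A * c%:E.
Proof.
move=> mA mB c0 H.
have -> : P A * c%:E = \int[P]_(w in A) (cst c (X w))%:E.
  by rewrite muleC -(integral_cst P mA).
have -> : P (A `&` B) = \int[P]_(w in A `&` B) (cst 1%R (X w))%:E.
  by rewrite -[LHS]mul1e -(integral_cst P (measurableI _ _ mA mB)).
rewrite !integral_discrete //; last exact: measurableI.
apply: eq_esum => x _; rewrite mul1e.
have [[w0 [Aw0 Xw0]]|no] := pselect (exists w0, A w0 /\ X w0 = x).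
  by have := H w0 Aw0; rewrite Xw0 setIAC muleC => ->; rewrite muleC.
rewrite setIAC (_ : A `&` [set w | X w = x] = set0) ?set0I ?measure0 ?mule0 //.
by apply/seteqP; split=> w //= [Aw Xw]; apply: no; exists w.
Qed.

End OneVariable.

Lemma discrete_pair (C C' : countType) (X : T -> C) (Y : T -> C') :
  discrete_rv X -> discrete_rv Y -> discrete_rv (fun w => (X w, Y w)).
Proof.
move=> mX mY [x y].
rewrite (_ : [set w | _] = [set w | X w = x] `&` [set w | Y w = y]).
  exact: measurableI.
by apply/seteqP; split=> w /= [-> ->].
Qed.

Lemma integral_finite (I : finType) (f : T -> I) (h : I -> R) :
  discrete_rv f -> (forall i, (0 <= h i)%R) ->
  \int[P]_w (h (f w))%:E = \sum_i (h i)%:E * P [set w | f w = i].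
Proof.
move=> mf h0; rewrite (integral_discrete mf) //.
rewrite esum_finType => [|i]; last by rewrite mule_ge0 // lee_fin.
by apply: eq_bigr => i _; rewrite setTI.
Qed.

End Discrete.

(** * The law of the switch and its transition operator *)

Section SwitchLaw.
Context {d : measure_display} {T : measurableType d} {R : realType}.
Variables (P : probability T R) (n : nat).
Local Open Scope ereal_scope.

Lemma measurable_fiber d' (U : measurableType d') (f : T -> U) (x : U) :
  measurable_fun [set: T] f -> measurable [set x] -> measurable [set w | f w = x].
Proof. by move=> mf mx; have := mf measurableT _ mx; rewrite setTI. Qed.

Lemma discrete_matrix (C : countType) (X : T -> 'M[C]_n) :
  (forall i j c, measurable [set w | X w i j = c]) -> discrete_rv X.
Proof.
move=> mX x; have -> : [set w | X w = x] =
    \bigcap_(c in [set: 'I_n * 'I_n]) [set w | X w c.1 c.2 = x c.1 c.2].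
  apply/seteqP; split=> w /= => [E c _ /=|h]; first by rewrite E.
  by apply/matrixP => i j; exact: (h (i, j)).
by apply: fin_bigcap_measurable => [|c _]; [exact: finite_finset | exact: mX].
Qed.

Lemma nat_matrix_discrete (X : T -> 'M[nat]_n) : nat_random_matrix X -> discrete_rv X.
Proof. by move=> mX; apply: discrete_matrix => i j c; apply: measurable_fiber. Qed.

Lemma discrete_mkseq (C : countType) (Y : nat -> T -> C) t :
  (forall u, discrete_rv (Y u)) -> discrete_rv (fun w => mkseq (Y ^~ w) t).
Proof.
move=> mY; elim: t => [|t IH] x.
  have [->|x0] := eqVneq x [::].
    rewrite (_ : [set w | _] = setT); first exact: measurableT.
    by apply/seteqP; split.
  rewrite (_ : [set w | _] = set0); first exact: measurable0.
  by apply/seteqP; split=> w //= h; rewrite -h in x0.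
have := @discrete_comp _ _ _ _ (discrete_pair IH (mY t)) _ (fun p => rcons p.1 p.2) x.
rewrite (_ : [set w | _] = [set w | mkseq (Y ^~ w) t.+1 = x]) //.
by apply/seteqP; split=> w /=; rewrite mkseqS.
Qed.

Variables (S : {set 'M[bool]_n}) (amax : nat) (lambda sigma2 : 'M[R]_n).
Variables (q a : nat -> T -> 'M[nat]_n) (s : nat -> T -> 'M[bool]_n).
Hypothesis hS : S = schedules n \/ S = full_schedules n.
Hypothesis sw : maxweight_switch P S amax lambda sigma2 q a s.

Lemma q_discrete t : discrete_rv (q t).
Proof. exact/nat_matrix_discrete/(queues_random sw). Qed.

Lemma a_discrete t : discrete_rv (a t).
Proof. exact/nat_matrix_discrete/(arrivals_random sw). Qed.

Lemma s_discrete t : discrete_rv (s t).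
Proof.
by apply: discrete_matrix => i j c; apply: measurable_fiber => //; exact: (schedules_random sw).
Qed.

(** The past before slot [t] as one value of a countable type, whose atoms are the prescribed pasts
    of the model. *)
Definition history t w :=
  (mkseq (q ^~ w) t.+1, (mkseq (s ^~ w) t, mkseq (a ^~ w) t)).

Lemma history_discrete t : discrete_rv (history t).
Proof.
apply: discrete_pair; first exact/discrete_mkseq/q_discrete.
by apply: discrete_pair; apply: discrete_mkseq; [exact: s_discrete | exact: a_discrete].
Qed.

Lemma mkseq_eqP (C : eqType) (f g : nat -> C) t :
  mkseq f t = mkseq g t <-> forall u, (u < t)%N -> f u = g u.
Proof.
split=> [E u ut|E]; first by rewrite -(nth_mkseq (f 0%N) f ut) E nth_mkseq.
by apply/eq_in_map => u; rewrite mem_iota => /= ut; exact: E.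
Qed.

Lemma history_past t w0 : [set w | history t w = history t w0] =
  past_before_schedule q a s (q ^~ w0) (a ^~ w0) (s ^~ w0) t.
Proof.
apply/seteqP; split=> w => [E|[h1 h2]].
  have /mkseq_eqP h1 := congr1 (fun h => h.1) E.
  have /mkseq_eqP h2 := congr1 (fun h => h.2.1) E.
  have /mkseq_eqP h3 := congr1 (fun h => h.2.2) E.
  by split=> u ut; [exact: h1 | split; [exact: h2 | exact: h3]].
congr (_, (_, _)); apply/mkseq_eqP => u ut; first exact: h1.
  by have [] := h2 u ut.
by have [] := h2 u ut.
Qed.

Definition arrival_law i j (l : 'I_amax.+1) : R :=
  fine (P [set w | a 0%N w i j = l]).

Local Notation p := arrival_law.

Lemma arrival_entry_measurable t i j m : measurable [set w | a t w i j = m].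
Proof. by apply: measurable_fiber => //; exact: (arrivals_random sw). Qed.

Lemma arrival_lawE t i j (l : 'I_amax.+1) :
  P [set w | a t w i j = l] = (p i j l)%:E.
Proof.
rewrite (arrivals_stationary sw) fineK //.
by apply: fin_num_measure; exact: arrival_entry_measurable.
Qed.

Lemma arrival_law_ge0 i j l : (0 <= p i j l)%R.
Proof. by rewrite fine_ge0. Qed.

Lemma arrival_outcome_prob_ge0 m : (0 <= outcome_prob p m)%R.
Proof. exact: outcome_prob_ge0 arrival_law_ge0 m. Qed.

Definition arrival_outcome t w : outcome n amax :=
  [ffun c => inord (a t w c.1 c.2)].

Lemma arrivals_outcome t w : arrivals (arrival_outcome t w) = a t w.
Proof.
apply/matrixP => i j; rewrite mxE ffunE inordK //= ltnS.
exact: (arrivals_bounded sw).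
Qed.

Lemma arrival_outcome_eq t (m : outcome n amax) :
  [set w | arrival_outcome t w = m] = [set w | a t w = arrivals m].
Proof.
apply/seteqP; split=> w /= => [<-|h]; first by rewrite arrivals_outcome.
apply/ffunP => c; apply/val_inj; rewrite ffunE /= h mxE -surjective_pairing.
by rewrite inordK // ltn_ord.
Qed.

Lemma arrival_outcome_discrete t : discrete_rv (arrival_outcome t).
Proof. by move=> m; rewrite arrival_outcome_eq; exact: a_discrete. Qed.

Lemma arrival_entry_discrete t i j :
  discrete_rv (fun w => inord (a t w i j) : 'I_amax.+1).
Proof.
by have := @discrete_comp _ _ _ _ (@a_discrete t) _ (fun m => inord (m i j) : 'I_amax.+1).
Qed.

Lemma integral_arrival t i j (h : nat -> R) : (forall l, (0 <= h l)%R) ->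
  \int[P]_w (h (a t w i j))%:E = (\sum_l p i j l * h l)%:E.
Proof.
move=> h0; transitivity (\int[P]_w (h (inord (a t w i j) : 'I_amax.+1))%:E).
  apply: eq_integral => w _; rewrite inordK // ltnS.
  exact: (arrivals_bounded sw).
rewrite (integral_finite _ (arrival_entry_discrete t i j) (h := fun l : 'I_amax.+1 => h l)) //.
rewrite -sumEFin; apply: eq_bigr => l _; rewrite mulrC EFinM; congr (_ * _).
rewrite -(arrival_lawE t); congr (P _); apply/seteqP; split=> w /= => [<-|->].
  by rewrite inordK // ltnS; exact: (arrivals_bounded sw).
by rewrite inord_val.
Qed.

Lemma arrival_law_sum1 i j : (\sum_l p i j l = 1)%R.
Proof.
have h1 := @integral_arrival 0%N i j (fun=> 1%R) (fun=> ler01).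
apply: EFin_inj; rewrite -(probability_setT P) -[RHS]mul1e.
rewrite -(integral_cst P measurableT) [RHS]h1; congr _%:E.
by apply: eq_bigr => l _; rewrite mulr1.
Qed.

Lemma arrival_law_rate : rate p = lambda.
Proof.
apply/matrixP => i j; rewrite mxE; apply: EFin_inj.
rewrite -(arrivals_mean sw 0%N) -(@integral_arrival 0%N i j (fun l => l%:R)) //.
by rewrite unlock.
Qed.

Lemma arrival_law_var : rate_var p = sigma2.
Proof.
apply/matrixP => i j; rewrite mxE; apply: EFin_inj.
rewrite -(arrivals_variance sw 0%N) /variance covariance.unlock (arrivals_mean sw) /=.
rewrite -(@integral_arrival 0%N i j (fun l => (l%:R - rate p i j) ^+ 2)%R).
  by rewrite unlock; apply: eq_integral => w _ /=; rewrite expr2 arrival_law_rate.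
by move=> l; exact: sqr_ge0.
Qed.

Definition schedule_prob (x : 'M[nat]_n) (s0 : 'M[bool]_n) : R :=
  if s0 \in maxweight S x then #|maxweight S x|%:R^-1%R else 0%R.

Lemma schedule_prob_ge0 x s0 : (0 <= schedule_prob x s0)%R.
Proof. by rewrite /schedule_prob; case: ifP => _ //; rewrite invr_ge0. Qed.

Lemma schedule_law t x s0 :
  P ([set w | q t w = x] `&` [set w | s t w = s0]) =
  P [set w | q t w = x] * (schedule_prob x s0)%:E.
Proof.
apply: (product_rule (@history_discrete t)); [exact: q_discrete|exact: s_discrete|exact: schedule_prob_ge0|].
move=> w0 qx; rewrite history_past.
have E : [set w | q t w = x] `&` past_before_schedule q a s (q^~ w0) (a^~ w0) (s^~ w0) t =
    past_before_schedule q a s (q^~ w0) (a^~ w0) (s^~ w0) t.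
  apply/seteqP; split=> w [] // h1 h2; split=> //=.
  by rewrite (h1 t (leqnn t)).
rewrite E (schedules_maxweight sw) /= qx; congr (_ * _).
by rewrite /schedule_prob; case: ifP.
Qed.

(** The Markov property: the conditional laws given a whole past depend on it only through the
    current queues and schedule, so summing over pasts keeps them. *)
Lemma outcome_law t x s0 (m : outcome n amax) :
  P [set w | (q t w, (s t w, arrival_outcome t w)) = (x, (s0, m))] =
  P [set w | q t w = x] * (schedule_prob x s0 * outcome_prob p m)%:E.
Proof.
have -> : [set w | (q t w, (s t w, arrival_outcome t w)) = (x, (s0, m))] =
    [set w | q t w = x] `&` [set w | s t w = s0] `&` [set w | arrival_outcome t w = m].
  by apply/seteqP; split=> w /= [[] // -> ->] -> //; case.
rewrite EFinM muleA -schedule_law; apply: (product_rule (@history_discrete t)).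
- by apply: measurableI; [exact: q_discrete | exact: s_discrete].
- exact: arrival_outcome_discrete.
- exact: arrival_outcome_prob_ge0.
move=> w0 [/= qx ss]; rewrite history_past arrival_outcome_eq.
have -> : [set w | q t w = x] `&` [set w | s t w = s0] `&`
    past_before_schedule q a s (q^~ w0) (a^~ w0) (s^~ w0) t =
    past_before_arrivals q a s (q^~ w0) (a^~ w0) (s^~ w0) t.
  apply/seteqP; split=> w /= [].
    by move=> [_ sw0] pw; split => //=; rewrite sw0 ss.
  move=> [h1 h2] sw0; split; last by split.
  by split; [rewrite /= (h1 t (leqnn t)) | rewrite /= sw0].
rewrite (arrivals_independent sw); congr (_ * _).
have -> : outcome_prob p m = (\prod_i \prod_j p i j (m (i, j)))%R.
  by rewrite pair_bigA; apply: eq_bigr => -[].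
rewrite -prodEFin.
apply: eq_bigr => i _; rewrite -prodEFin; apply: eq_bigr => j _.
by rewrite -(arrival_lawE t) mxE.
Qed.

Lemma queue_op_sum (f : 'M[nat]_n -> R) x : queue_op S p f x =
  (\sum_(y : 'M[bool]_n * outcome n amax) schedule_prob x y.1 * outcome_prob p y.2 *
     f (next_queue x (arrivals y.2) y.1))%R.
Proof.
rewrite -(pair_bigA _ (fun s0 m => schedule_prob x s0 * outcome_prob p m *
  f (next_queue x (arrivals m) s0))%R) /=.
rewrite /queue_op /mean_slot big_mkcond; apply: eq_bigr => s0 _.
rewrite /schedule_prob; case: ifP => _.
  by rewrite /mean_arrivals mulr_sumr; apply: eq_bigr => m _; rewrite mulrA.
by rewrite big1 // => m _; rewrite !mul0r.
Qed.

Lemma outcome_weight_ge0 x (y : 'M[bool]_n * outcome n amax) :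
  (0 <= schedule_prob x y.1 * outcome_prob p y.2)%R.
Proof.
by rewrite mulr_ge0 ?schedule_prob_ge0 ?arrival_outcome_prob_ge0.
Qed.

Lemma integral_next (f : 'M[nat]_n -> R) t : (forall x, (0 <= f x)%R) ->
  \int[P]_w (f (q t.+1 w))%:E = \int[P]_w (queue_op S p f (q t w))%:E.
Proof.
move=> f0; pose X w := (q t w, (s t w, arrival_outcome t w)).
have mX : discrete_rv X.
  apply: discrete_pair; first exact: q_discrete.
  by apply: discrete_pair; [exact: s_discrete | exact: arrival_outcome_discrete].
pose g (c : 'M[nat]_n * ('M[bool]_n * outcome n amax)) :=
  f (next_queue c.1 (arrivals c.2.2) c.2.1).
transitivity (\int[P]_w (g (X w))%:E).
  by apply: eq_integral => w _; rewrite (queues_step sw) /g /= arrivals_outcome.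
have Kf0 x : (0 <= queue_op S p f x)%R.
  by rewrite queue_op_sum; apply: sumr_ge0 => y _; rewrite mulr_ge0 ?outcome_weight_ge0.
rewrite (integral_discrete P mX (f := g) measurableT) => [|c]; last exact: f0.
rewrite (integral_discrete P (@q_discrete t) (f := queue_op S p f)) //.
pose G x y := (g (x, y))%:E * P (setT `&` [set w | X w = (x, y)]).
transitivity (\esum_(x in [set: 'M[nat]_n])
    \esum_(y in [set: 'M[bool]_n * outcome n amax]) G x y).
  rewrite esum_esum => [|x y _ _]; last by rewrite mule_ge0 // lee_fin f0.
  rewrite (_ : _ `*`` _ = setT); last by apply/seteqP; split.
  by apply: eq_esum => -[x y] _.
rewrite /G; clear G.
apply: eq_esum => x _; rewrite esum_finType => [|y]; last by rewrite mule_ge0 // lee_fin f0.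
rewrite setTI queue_op_sum -sumEFin ge0_sume_distrl => [|y _]; last first.
  by rewrite lee_fin mulr_ge0 ?outcome_weight_ge0.
apply: eq_bigr => -[s0 m] _; rewrite setTI outcome_law /g /=.
set c := (schedule_prob x s0 * _)%R; set b := f _.
by rewrite [(c * b)%R]mulrC (EFinM b c) -muleA; congr (_ * _); rewrite muleC.
Qed.

Lemma integral_queue (f : 'M[nat]_n -> R) t : (forall x, (0 <= f x)%R) ->
  \int[P]_w (f (q t w))%:E = \int[P]_w (iter t (queue_op S p) f (q 0%N w))%:E.
Proof.
move=> f0; elim: t f f0 => [//|t IH] f f0.
rewrite integral_next // IH => [|x]; first by rewrite iterSr.
by rewrite queue_op_sum; apply: sumr_ge0 => y _; rewrite mulr_ge0 ?outcome_weight_ge0.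
Qed.

(** The model gives the law of the arrivals conditionally on the past; summing over the initial
    queues and schedule yields the law of slot 0 that defines [queue_kernel]. *)
Lemma outcome_marginal m : P [set w | arrival_outcome 0%N w = m] = (outcome_prob p m)%:E.
Proof.
rewrite -[RHS]mul1e -(probability_setT P) -[X in P X = _]setTI.
apply: (product_rule (discrete_pair (@q_discrete 0%N) (@s_discrete 0%N))) => //.
- exact: arrival_outcome_discrete.
- exact: arrival_outcome_prob_ge0.
move=> w0 _; rewrite !setTI.
have -> : [set w | (q 0%N w, s 0%N w) = (q 0%N w0, s 0%N w0)] =
    [set w | q 0%N w = q 0%N w0] `&` [set w | s 0%N w = s 0%N w0].
  by apply/seteqP; split=> w /= [-> ->].
rewrite schedule_law -muleA -EFinM -outcome_law; congr (P _).
by apply/seteqP; split=> w /= [[-> ->] ->].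
Qed.

Lemma queue_kernelE x y : queue_kernel P S a x y = (queue_op S p (indic R y) x)%:E.
Proof.
rewrite queue_op_sum -(pair_bigA _ (fun s0 m => schedule_prob x s0 * outcome_prob p m *
  indic R y (next_queue x (arrivals m) s0))%R) /= -sumEFin.
rewrite /queue_kernel big_mkcond; apply: eq_bigr => s0 _.
rewrite /schedule_prob; case: ifP => _; last by rewrite big1 // => m _; rewrite !mul0r.
pose h (m : outcome n amax) := indic R y (next_queue x (arrivals m) s0).
pose B := [set w | next_queue x (a 0%N w) s0 = y].
have mB : measurable B.
  exact: (discrete_preimage (@a_discrete 0%N) [set m | next_queue x m s0 = y]).
have -> : P B = \sum_m (h m)%:E * P [set w | arrival_outcome 0%N w = m].
  rewrite -(integral_finite P (@arrival_outcome_discrete 0%N)) => [|m]; last exact: ler0n.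
  rewrite -[in LHS](setIT B) -(integral_indic P measurableT mB).
  apply: eq_integral => w _; rewrite indicE /h arrivals_outcome /indic; congr (_%:R)%:E.
  by congr nat_of_bool; apply/idP/eqP => [|E]; rewrite inE.
rewrite ge0_sume_distrr => [|m _]; last by rewrite mule_ge0 // lee_fin ler0n.
rewrite -sumEFin; apply: eq_bigr => m _.
rewrite outcome_marginal -!EFinM; congr _%:E.
by rewrite /h; ring.
Qed.

End SwitchLaw.

(** * The steady functional as a sum over states *)

Lemma qnorm_sublevel_finite (R : realType) n (L : R) :
  exists m0, forall x : 'M[nat]_n, qnorm R x <= L -> (pickle x < m0)%N.
Proof.
pose B := Num.bound `|L|.
exists (\max_(m : 'M['I_B.+1]_n) pickle (map_mx (fun l : 'I_B.+1 => l : nat) m)).+1 => x xL.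
rewrite ltnS; pose m : 'M['I_B.+1]_n := map_mx inord x.
have -> : x = map_mx (fun l : 'I_B.+1 => l : nat) m.
  apply/matrixP => i j; rewrite !mxE inordK // ltnS -(ler_nat R).
  apply: le_trans (ltW (archi_boundP (normr_ge0 L))).
  apply: le_trans (ler_norm L); apply: le_trans xL.
  by have := entry_le_mxnorm2 (natmx R x) i j; rewrite mxE normr_nat.
exact: (leq_bigmax m).
Qed.

Section SteadyMass.
Variables (R : realType) (n : nat).
Variables (K : ('M[nat]_n -> R) -> 'M[nat]_n -> R) (pi : ('M[nat]_n -> R) -> R).
Hypothesis mK : markov K.
Local Notation W := (@qweight R n).
Hypothesis piP : steady_functional K W pi.

Let W1 := @qweight_ge1 R n.

Lemma indic_dominated x : dominated W (indic R x).
Proof.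
exists 1 => y; rewrite mul1r; apply: le_trans (qweight_ge1 R y).
by rewrite /indic; case: eqP => _; rewrite ?normr1 ?normr0.
Qed.

Lemma steady_indic_ge0 x : 0 <= pi (indic R x).
Proof. by apply: (steady_ge0 mK W1 piP 0 (indic_dominated x)) => y; rewrite ler0n. Qed.

(** A partial sum over codes is [pi] of a truncation of [f]. No mass escapes to infinity: all but
    finitely many states have large norm, and the factor [1 + qnorm] in the domination makes their
    contribution small. *)
Lemma esum_steady (f : 'M[nat]_n -> R) : (forall x, 0 <= f x) ->
  dominated W (fun x => f x * (1 + qnorm R x)) ->
  (\esum_(x in [set: 'M[nat]_n]) ((f x)%:E * (pi (indic R x))%:E) = (pi f)%:E)%E.
Proof.
move=> f0 dfn.
have df : dominated W f.
  apply: (dominated_le dfn) => x; rewrite ger0_norm // ler_peMr //.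
  by rewrite lerDl.
rewrite esum_pickle => [|x]; last by rewrite mule_ge0 // lee_fin // steady_indic_ge0.
pose tr m (x : 'M[nat]_n) := f x * (pickle x < m)%N%:R.
have dtr m : dominated W (tr m).
  apply: (dominated_le df) => x; rewrite /tr ger0_norm ?mulr_ge0 //.
  by rewrite ler_piMr // lern1 leq_b1.
have trE m : (\sum_(0 <= k < m) (if @pickle_inv 'M[nat]_n k is Some x
    then (f x)%:E * (pi (indic R x))%:E else 0) = (pi (tr m))%:E)%E.
  elim: m => [|m IH].
    rewrite big_nil; congr _%:E; rewrite -[LHS](steady_cst mK W1 piP 0 0).
    by apply: steady_ext => x; rewrite /tr mulr0.
  rewrite big_nat_recr //= IH; case E : (pickle_inv m) => [y|].
    have ym : pickle y = m by have := @pickle_invK 'M[nat]_n m; rewrite E.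
    have dy := dominatedZ (f y) (indic_dominated y).
    rewrite -EFinM -EFinD; congr _%:E.
    rewrite -(steadyZ mK W1 piP 0 (f y) (indic_dominated y)) -(steadyD mK piP 0 (dtr m) dy).
    apply: steady_ext => x; rewrite /tr /indic -ym.
    have [->|xy] := eqVneq x y; first by rewrite ltnn ltnSn mulr0 add0r.
    have -> : (pickle x < (pickle y).+1)%N = (pickle x < pickle y)%N.
      rewrite ltnS leq_eqVlt; case: eqP => // e.
      by move/eqP: xy; case; exact: (pcan_inj pickleK e).
    by rewrite mulr0 addr0.
  rewrite adde0; congr _%:E; apply: steady_ext => x; rewrite /tr.
  have -> // : (pickle x < m.+1)%N = (pickle x < m)%N.
  rewrite [LHS]ltnS [LHS]leq_eqVlt; have [xm|//] := eqVneq (pickle x) m.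
  have e := @pickleK_inv 'M[nat]_n x.
  by rewrite xm in e; have := etrans (esym E) e.
apply: cvg_lim => //; under eq_cvg do rewrite trE.
apply: cvg_EFin; first exact: nearW.
apply/cvgrPdist_le => e e0 /=.
pose C := pi (fun x => f x * (1 + qnorm R x)).
have C0 : 0 <= C.
  by apply: (steady_ge0 mK W1 piP 0 dfn) => x; rewrite mulr_ge0 // addr_ge0.
have [m0 m0P] := @qnorm_sublevel_finite R n (C / e).
exists m0 => // m /= mm; rewrite -(steadyB mK W1 piP 0 df (dtr m)).
have dB := dominatedB df (dtr m).
have B0 x : 0 <= f x - tr m x.
  by rewrite subr_ge0 /tr ler_piMr // lern1 leq_b1.
rewrite ger0_norm; last exact: (steady_ge0 mK W1 piP 0 dB).
(* A state cut off by the truncation has [1 + qnorm >= L], so the tail is at most [C / L], which is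
   at most [e]. *)
pose L := 1 + C / e; have L0 : 0 < L by rewrite ltr_pwDl // divr_ge0 // ltW.
have dZ := dominatedZ L^-1 dfn.
apply: (@le_trans _ _ (pi (fun x => L^-1 * (f x * (1 + qnorm R x))))).
  apply: (steady_le mK piP 0 dB dZ) => x; rewrite /tr.
  case: ltnP => mx; first by rewrite mulr1 subrr mulr_ge0 ?invr_ge0 ?(ltW L0) // mulr_ge0 // addr_ge0.
  rewrite mulr0 subr0 mulrC -mulrA ler_peMr // ler_pdivlMr // mul1r lerD2l ltW // ltNge.
  by apply/negP => /m0P h; move: mx; rewrite leqNgt (leq_trans h).
rewrite (steadyZ mK W1 piP 0 _ dfn) mulrC ler_pdivrMr // -/C /L mulrDr mulr1.
by rewrite mulrCA divff ?gt_eqF // mulr1 lerDr ltW.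
Qed.

Lemma esum_steady_indic : (\esum_(x in [set: 'M[nat]_n]) (pi (indic R x))%:E = 1)%E.
Proof.
rewrite -[RHS](congr1 EFin (steady_cst mK W1 piP 0 1)).
rewrite -(@esum_steady (fun=> 1)) //.
  by apply: eq_esum => x _; rewrite mul1e.
exists 1 => x.
by rewrite !mul1r ger0_norm ?addr_ge0 // /qweight ler_eXnr // lerDl.
Qed.

Section Law.
Context {d : measure_display} {T : measurableType d}.
Variables (P : probability T R) (qbar : T -> 'M[nat]_n).
Hypothesis mq : discrete_rv qbar.
Hypothesis law : forall x, P [set w | qbar w = x] = (pi (indic R x))%:E.

Lemma integral_steady (f : 'M[nat]_n -> R) : (forall x, 0 <= f x) ->
  dominated W (fun x => f x * (1 + qnorm R x)) ->
  (\int[P]_w (f (qbar w))%:E = (pi f)%:E)%E.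
Proof.
move=> f0 df; rewrite (integral_discrete P mq) // -esum_steady //.
by apply: eq_esum => x _; rewrite setTI law.
Qed.

(** [f] is the difference of the nonnegative functions [f + |f|] and [|f|], both with finite
    integral. *)
Lemma expectation_steady (f : 'M[nat]_n -> R) :
  dominated W (fun x => `|f x| * (1 + qnorm R x)) ->
  ('E_P[fun w => f (qbar w)] = (pi f)%:E)%E.
Proof.
move=> dn; have df := dominated1 dn.
have dn' : dominated W (fun x => `|f x|) by have [A fA] := df; exists A => x; rewrite normr_id.
pose g x := f x + `|f x|.
have g0 x : 0 <= g x by rewrite /g -lerBlDr sub0r lerNl -normrN ler_norm.
have dg : dominated W (fun x => g x * (1 + qnorm R x)).
  apply: (dominated_le (dominatedZ 2 dn)) => x.
  rewrite normrM (ger0_norm (g0 x)) ger0_norm ?addr_ge0 // mulrA ler_wpM2r ?addr_ge0 //.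
  by have := ler_norm (f x); rewrite /g; lra.
have ig := integral_steady g0 dg.
have inorm := integral_steady (fun x => normr_ge0 (f x)) dn.
have int h : (forall x, 0 <= h x) -> (\int[P]_w (h (qbar w))%:E = (pi h)%:E)%E ->
    P.-integrable setT (fun w => (h (qbar w))%:E).
  move=> h0 ih; apply/integrableP; split.
    apply/measurable_realfun.measurable_EFinP; exact: (discrete_measurable mq h).
  by under eq_integral do rewrite abse_EFin ger0_norm //; rewrite ih ltry.
have E x : f x = g x - `|f x| by rewrite addrK.
rewrite unlock; under eq_integral do rewrite E EFinB.
rewrite (integralB_EFin measurableT (int _ g0 ig) (int _ (fun x => normr_ge0 (f x)) inorm)).
rewrite ig inorm -EFinB (steadyD mK piP 0 df dn').
by rewrite addrK.
Qed.

End Law.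
End SteadyMass.

(** * A probability space carrying a given discrete law *)

Section Realization.
Variables (R : realType) (C : countType) (c0 : C) (mass : C -> R).
Hypothesis mass_ge0 : forall x, 0 <= mass x.
Hypothesis mass_sum1 : (\esum_(x in [set: C]) (mass x)%:E = 1)%E.

Definition code_mass (k : nat) : R :=
  if @pickle_inv C k is Some x then mass x else 0.

Lemma code_mass_ge0 k : 0 <= code_mass k.
Proof. by rewrite /code_mass; case: pickle_inv. Qed.

(** The mixture of Dirac masses at the codes, which is a measure by construction. *)
Definition code_measure : set nat -> \bar R :=
  mseries (fun k => mscale (NngNum (code_mass_ge0 k)) \d_k) 0.

HB.instance Definition _ := Measure.on code_measure.

Lemma code_measureE (A : set nat) : code_measure A =
  (\esum_(x in [set: C]) (if pickle x \in A then (mass x)%:E else 0))%E.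
Proof.
rewrite esum_pickle => [|x]; last by case: ifP => _ //; rewrite lee_fin.
rewrite /code_measure /mseries ereal_series; apply: eq_eseriesr => k _.
transitivity ((code_mass k)%:E * (\1_A k)%:E)%E; first by [].
rewrite indicE /code_mass; case E : (@pickle_inv C k) => [x|].
  have xk : pickle x = k by have := @pickle_invK C k; rewrite E.
  by rewrite xk; case: ifP => _; rewrite ?mule1 ?mule0.
by rewrite mul0e.
Qed.

Lemma code_measure_setT : code_measure setT = 1%E.
Proof.
rewrite code_measureE -mass_sum1; apply: eq_esum => x _.
by rewrite mem_set.
Qed.

HB.instance Definition _ :=
  Measure_isProbability.Build _ _ _ code_measure code_measure_setT.

(** The default [c0] is taken at numbers that code nothing, which have mass 0. *)
Definition decode (k : nat) : C := odflt c0 (pickle_inv k).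

Lemma decode_law x : code_measure [set k | decode k = x] = (mass x)%:E.
Proof.
rewrite code_measureE.
rewrite (eq_esum (b := fun y => if y == x then (mass x)%:E else 0%E)) => [|y _].
  by rewrite esum_delta ?lee_fin // mem_set.
have -> : (pickle y \in [set k | decode k = x]) = (y == x).
  by apply/idP/eqP; rewrite inE /= /decode pickleK_inv.
by case: eqP => // ->.
Qed.

Lemma discrete_realization : exists (P' : probability nat R) (X : nat -> C),
  forall x, P' [set k | X k = x] = (mass x)%:E.
Proof. by exists code_measure, decode => x; exact: decode_law. Qed.

End Realization.

(** * Convergence, recurrence and steady state of the switch *)

Section SwitchChain.
Context {d : measure_display} {T : measurableType d} {R : realType}.
Variables (P : probability T R) (n : nat).
Variables (S : {set 'M[bool]_n}) (amax : nat) (lambda sigma2 : 'M[R]_n).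
Variables (q a : nat -> T -> 'M[nat]_n) (s : nat -> T -> 'M[bool]_n).
Hypothesis n_gt0 : (0 < n)%N.
Hypothesis hS : S = schedules n \/ S = full_schedules n.
Hypothesis sw : maxweight_switch P S amax lambda sigma2 q a s.
Local Notation p := (@arrival_law _ _ _ P n amax a).
Local Notation K := (queue_op S p).
Local Notation W := (@qweight R n).
Let p0 := arrival_law_ge0 P a : forall i j (l : 'I_amax.+1), 0 <= p i j l.
Let p1 := arrival_law_sum1 sw.
Let mK : markov K := queue_op_markov hS p0 p1.
Let W1 := @qweight_ge1 R n.

Section Limit.
Variable pi : ('M[nat]_n -> R) -> R.
Hypothesis piP : steady_functional K W pi.

Lemma bounded_dominated (f : 'M[nat]_n -> R) M :
  (forall x, `|f x| <= M) -> dominated W f.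
Proof.
move=> fM; exists M => x; apply: le_trans (fM x) _.
by rewrite ler_peMr // (le_trans _ (fM x)).
Qed.

(** Integrals are transferred to iterates of the operator for nonnegative functions; a bounded
    function is reduced to these by adding its bound. *)
Lemma integral_shift (X : T -> R) (M : R) : measurable_fun [set: T] X ->
  (forall w, `|X w| <= M) ->
  (\int[P]_w (X w)%:E = \int[P]_w (X w + M)%:E - M%:E)%E.
Proof.
move=> mX XM.
have iX : P.-integrable setT (EFin \o X).
  apply: measurable_bounded_integrable => //.
    by rewrite (le_lt_trans (probability_le1 P measurableT)) ?ltry.
  exists M; split; first exact: num_real.
  by move=> x xM w _ /=; apply: le_trans (XM w) (ltW xM).
have iM := finite_measure_integrable_cst P M measurableT.
have -> : (\int[P]_w (X w + M)%:E = \int[P]_w (X w)%:E + M%:E)%E.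
  under eq_integral do rewrite EFinD.
  rewrite integralD //; congr (_ + _)%E.
  have := integral_cst P measurableT M%:E; rewrite /= => ->.
  have -> : (P setT = 1)%E := probability_setT P.
  by rewrite mule1.
by rewrite addeK.
Qed.

(** The iterates converge from every initial state; dominated convergence averages this over the
    random initial queues. *)
Lemma queue_cvg (f : 'M[nat]_n -> R) (M : R) : (forall x, `|f x| <= M) ->
  ('E_P[fun w => f (q t w)])%E @[t --> \oo] --> (pi f)%:E.
Proof.
move=> fM; have fM2 x : 0 <= f x + M <= 2 * M.
  by have := fM x; rewrite ler_norml => /andP[? ?]; apply/andP; split; lra.
pose g x := f x + M.
have g0 x : 0 <= g x by have /andP[] := fM2 x.
have E t : ('E_P[fun w => f (q t w)] =
    \int[P]_w (iter t K g (q 0%N w))%:E - M%:E)%E.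
  rewrite unlock (@integral_shift _ M) //.
    by rewrite (integral_queue sw (f := g)).
  exact: (discrete_measurable (q_discrete sw t)).
have -> : (fun t => 'E_P[fun w => f (q t w)])%E =
    (fun t => \int[P]_w (iter t K g (q 0%N w))%:E - M%:E)%E by apply/funext.
have df := bounded_dominated fM; have dM := dominated_cst W1 M.
have -> : ((pi f)%:E = (pi g)%:E - M%:E)%E.
  by rewrite (steadyD mK piP 0 df dM) (steady_cst mK W1 piP 0) EFinD addeK.
apply: cvgeB => //; last exact: cvg_cst.
have gM x t : 0 <= iter t K g x <= 2 * M.
  have mt := markov_iter t mK; apply/andP; split.
    exact: (pl_ge0 mt.1).
  rewrite -(pl_cst (2 * M) mt x); apply: (pl_le mt.1) => y.
  by have /andP[] := fM2 y.
have -> : ((pi g)%:E = \int[P]_w (cst (pi g)%:E w))%E.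
  rewrite (integral_cst P measurableT) -[LHS]mule1; congr (_ * _)%E.
  exact/esym/probability_setT.
have ig := finite_measure_integrable_cst P (2 * M) measurableT.
have [||||] := @dominated_convergence _ _ _ P setT measurableT
  (fun t w => (iter t K g (q 0%N w))%:E) (cst (pi g)%:E) _ _ _ _ ig; last by [].
- move=> t; apply/measurable_realfun.measurable_EFinP.
  exact: (discrete_measurable (q_discrete sw 0%N)).
- exact: measurable_cst.
- apply: nearW => w _; apply: cvg_EFin; first exact: nearW.
  exact: (piP (dominatedD df dM)).
- apply: nearW => w t _ /=; rewrite lee_fin ger0_norm; by have /andP[] := gM (q 0%N w) t.
Qed.

(* A continuous test function isolating the atom [y]. *)
Definition lattice_bump (y x : 'M[R]_n) : R :=
  let u := 1 - \sum_i \sum_j `|x i j - y i j| in (u + `|u|) / 2.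

Lemma lattice_bump_continuous y : continuous (lattice_bump y).
Proof.
pose D := fun x : 'M[R]_n => \sum_i \sum_j `|x i j - y i j|.
have cD : continuous D.
  apply: continuous_sumr => i; apply: continuous_sumr => j x.
  apply: (@continuous_comp _ _ _ (fun x : 'M[R]_n => x i j - y i j) Num.norm).
    by apply: continuousB; [exact: coord_continuous | exact: cst_continuous].
  exact: norm_continuous.
have cu : continuous (fun x => 1 - D x).
  by move=> x; apply: continuousB; [exact: cst_continuous | exact: cD].
have -> : lattice_bump y =
  ((fun x => 1 - D x) \+ (fun x => `|1 - D x|)) \* (fun=> 2^-1) by [].
move=> x; apply: continuousM; last exact: cst_continuous.
apply: continuousD; first exact: cu.
by apply: (@continuous_comp _ _ _ (fun x => 1 - D x) Num.norm); [exact: cu | exact: norm_continuous].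
Qed.

Lemma lattice_bump_bounded y x : `|lattice_bump y x| <= 1.
Proof.
rewrite /lattice_bump; set D := \sum_i _.
have D0 : 0 <= D by do 2![apply: sumr_ge0 => ? _].
have [u0|/ltW u0] := leP 0 (1 - D).
  have E : (1 - D + (1 - D)) / 2 = 1 - D by field.
  by rewrite (ger0_norm u0) E ger0_norm // gerBl.
by rewrite (ler0_norm u0) subrr mul0r normr0.
Qed.

(** Distinct integer matrices differ by at least 1 in the sum of the absolute values of the entries,
    where the bump has fallen to 0. *)
Lemma lattice_bumpE (x y : 'M[nat]_n) : lattice_bump (natmx R y) (natmx R x) = indic R y x.
Proof.
rewrite /lattice_bump /indic; have [->|xy] := eqVneq x y.
  rewrite big1 => [|i _]; last by apply: big1 => j _; rewrite subrr normr0.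
  by rewrite subr0 normr1 ?eqxx mulr1n; field.
have [[i j] /= ij] : exists c : 'I_n * 'I_n, x c.1 c.2 != y c.1 c.2.
  apply/existsP; apply: contraNT xy; rewrite negb_exists => /forallP no.
  apply/eqP/matrixP => i j; apply/eqP; have := no (i, j).
  by rewrite negbK.
have D1 : 1 <= \sum_i \sum_j `|natmx R x i j - natmx R y i j|.
  rewrite (bigD1 i) //= (bigD1 j) //= -addrA ler_wpDr //.
    by rewrite addr_ge0 //; do ?[apply: sumr_ge0 => ? _].
  rewrite !mxE; move: ij; case: ltngtP => // lt _.
    rewrite distrC -natrB ?(ltnW lt) // normr_nat (ler_nat _ 1) subn_gt0 //.
  by rewrite -natrB ?(ltnW lt) // normr_nat (ler_nat _ 1) subn_gt0.
by rewrite ler0_norm ?subr_le0 // subrr mul0r.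
Qed.

(** The expectations of a bump along the chain have two limits, the probability of an atom for
    [qbar] and the value of [pi], which must agree. *)
Lemma limit_law d' (T' : measurableType d') (P' : probability T' R)
    (qbar : T' -> 'M[nat]_n) : nat_random_matrix qbar ->
  cvg_in_distribution P (fun t w => natmx R (q t w)) P' (fun w => natmx R (qbar w)) ->
  forall y, P' [set w | qbar w = y] = (pi (indic R y))%:E.
Proof.
move=> rq cvgd y.
have mq := nat_matrix_discrete rq.
have h := cvgd _ (@lattice_bump_continuous (natmx R y))
  (ex_intro _ 1 (lattice_bump_bounded _)).
have := @queue_cvg (fun x => lattice_bump (natmx R y) (natmx R x)) 1
  (fun x => lattice_bump_bounded _ _).
move=> h'; have := cvg_unique _ h h'.
have -> : pi (fun x => lattice_bump (natmx R y) (natmx R x)) = pi (indic R y).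
  by apply: steady_ext => x; exact: lattice_bumpE.
move=> <- //; rewrite unlock -[X in P' X]setIT -(integral_indic P' measurableT); last exact: mq.
apply: eq_integral => w _; rewrite lattice_bumpE indicE /indic; congr (_%:R)%:E.
by congr nat_of_bool; apply/idP/eqP; rewrite inE.
Qed.

Lemma steady_realization : exists (P' : probability nat R) (qbar : nat -> 'M[nat]_n),
  [/\ nat_random_matrix qbar, stationary_for (queue_kernel P S a) P' qbar &
      cvg_in_distribution P (fun t w => natmx R (q t w)) P' (fun w => natmx R (qbar w))].
Proof.
have [P' [qbar law]] := @discrete_realization R 'M[nat]_n 0
  (fun x => pi (indic R x)) (steady_indic_ge0 mK piP)
  (esum_steady_indic mK piP).
have mq : discrete_rv qbar by move=> x.
exists P', qbar; split=> [i j|y|f cf [M fM]].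
- by move=> _ Y _.
- have K1 x : `|K (indic R y) x| <= 1.
    apply: le_trans (pl_norm mK.1 _ _) _; rewrite -[leRHS](pl_cst 1 mK x).
    by apply: (pl_le mK.1) => z; rewrite /indic normr_nat lern1 leq_b1.
  have Kd := bounded_dominated K1.
  rewrite law -(steady_invariant piP 0 (indic_dominated R y) Kd).
  rewrite -(esum_steady mK piP).
  + apply: eq_esum => x _; rewrite law muleC; congr (_ * _)%E.
    by rewrite (queue_kernelE sw).
  + by apply: (pl_ge0 mK.1) => z; rewrite ler0n.
  apply: (dominated_le (bounded_dominated1 K1)) => x.
  by rewrite normrM [`|1 + _|]ger0_norm // addr_ge0.
rewrite (expectation_steady mK piP mq law (f := fun x => f (natmx R x))); last first.
  exact: bounded_dominated1 (fun x => fM _).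
exact: (queue_cvg (fun x => fM (natmx R x))).
Qed.

End Limit.

Section Recurrence.
Hypothesis lambda_row : forall i, \sum_j lambda i j < 1.
Hypothesis lambda_col : forall j, \sum_i lambda i j < 1.
Local Notation reach := (reachable (queue_kernel P S a)).

Lemma arrival_law_row i : \sum_j rate p i j < 1.
Proof. by rewrite (arrival_law_rate sw). Qed.

Lemma arrival_law_col j : \sum_i rate p i j < 1.
Proof. by rewrite (arrival_law_rate sw). Qed.

(** An arrival that is never 0 would have mean at least 1, while its row has total rate below 1. *)
Lemma arrival_idle i j : 0 < p i j ord0.
Proof.
have rij : rate p i j < 1.
  apply: le_lt_trans (arrival_law_row i); rewrite (bigD1 j) //= lerDl.
  by apply: sumr_ge0 => l _; exact: rate_ge0.
rewrite lt_def p0 andbT; apply/eqP => pz; move: rij; apply/negP; rewrite -leNgt.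
rewrite mxE -[leLHS](p1 i j); apply: ler_sum => l _.
have [->|l0] := eqVneq l ord0; first by rewrite pz mul0r.
by rewrite ler_peMr ?p0 // (ler_nat _ 1) lt0n.
Qed.

(** Only finitely many successors of [x] carry mass: expanding the kernel over outcomes turns the
    sum over all states into a finite one. *)
Lemma kernel_esum (A : set 'M[nat]_n) (g : 'M[nat]_n -> R) x :
  (forall y, 0 <= g y) ->
  (\esum_(y in A) (queue_kernel P S a x y * (g y)%:E) =
   (K (fun y => (y \in A)%:R * g y) x)%:E)%E.
Proof.
move=> g0.
pose w (c : 'M[bool]_n * outcome n amax) := @schedule_prob R n S x c.1 * outcome_prob p c.2.
pose nx (c : 'M[bool]_n * outcome n amax) := next_queue x (arrivals c.2) c.1.
have w0 c : 0 <= w c by exact: outcome_weight_ge0.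
rewrite (eq_esum (b := fun y => (\sum_c (if y == nx c then (w c * g (nx c))%:E else 0))%E)).
  have wg c : (0 <= (w c * g (nx c))%:E)%E.
    by rewrite lee_fin; apply: mulr_ge0; [exact: w0 | exact: g0].
  rewrite esum_sum => [|y c _ _]; last by case: ifP.
  rewrite queue_op_sum -sumEFin; apply: eq_bigr => c _.
  rewrite esum_delta // -/(w c) -/(nx c).
  by case: ifP => _; rewrite ?mul1r // mul0r mulr0.
move=> y _; rewrite (queue_kernelE sw) queue_op_sum -sumEFin ge0_sume_distrl.
  apply: eq_bigr => c _; rewrite -EFinM -/(w c) -/(nx c) /indic eq_sym.
  by case: eqP => [->|_]; rewrite ?mulr1 // mulr0 mul0r.
by move=> c _; rewrite lee_fin; apply: mulr_ge0; [exact: (w0 c) | exact: ler0n].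
Qed.

Definition avoid (A : set 'M[nat]_n) (t : nat) : 'M[nat]_n -> R :=
  iter t (fun f => K (fun y => (y \in ~` A)%:R * f y)) (fun=> 1).

Lemma avoid_ge0 A t x : 0 <= avoid A t x.
Proof.
elim: t x => [|t IH] x; first exact: ler01.
by apply: (pl_ge0 mK.1) => y; rewrite mulr_ge0.
Qed.

Lemma avoidanceE A t x : avoidance (queue_kernel P S a) A t x = (avoid A t x)%:E.
Proof.
elim: t x => [//|t IH] x /=.
under eq_esum do rewrite IH.
by rewrite kernel_esum //; exact: avoid_ge0.
Qed.

Lemma avoid_set1 z t x : avoid [set z] t x = iter t (killed K z) (fun=> 1) x.
Proof.
elim: t x => [//|t IH] x /=; apply: (pl_ext mK.1) => y; rewrite IH.
congr (_%:R * _); congr nat_of_bool; apply/idP/idP => [|/eqP yz].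
  by rewrite inE /= => /eqP.
by rewrite inE.
Qed.

Lemma avoid_mono A z t x : A z -> avoid A t x <= avoid [set z] t x.
Proof.
move=> Az; elim: t x => [//|t IH] x /=; apply: (pl_le mK.1) => y.
rewrite ler_pM ?avoid_ge0 // ler_nat; case: (boolP (y \in ~` A)) => // yA.
rewrite lt0b inE /= => yz; move: yA; rewrite inE /= => yA; apply: yA.
by rewrite yz.
Qed.

Lemma iter_reachable z N x : 0 < iter N K (indic R z) x ->
  reach x z.
Proof.
elim: N x => [|N IH] x /=.
  by rewrite /indic; have [->|_] := eqVneq x z; [exists [::] | rewrite ltxx].
set f := iter N K (indic R z) => Kf.
have f0 y : 0 <= f y by apply: (pl_ge0 (pl_iter mK.1 N)) => v; rewrite ler0n.
have [y [fy Ky]] : exists y, 0 < f y /\ 0 < K (indic R y) x.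
  apply: contrapT => no; suff : K f x <= 0 by rewrite leNgt Kf.
  rewrite queue_op_sum; apply: sumr_le0 => c _.
  set y := next_queue _ _ _; rewrite leNgt; apply/negP => pos; apply: no.
  exists y; have wc := outcome_weight_ge0 P S a x c.
  have fy : 0 < f y.
    by rewrite lt_def f0 andbT; apply: contraTneq pos => ->; rewrite mulr0 ltxx.
  split=> //; rewrite queue_op_sum (bigD1 c) //= ltr_pwDl //.
    rewrite /indic -/y eqxx mulr1 lt_def wc andbT.
    by apply: contraTneq pos => ->; rewrite mul0r ltxx.
  by apply: sumr_ge0 => c' _; rewrite mulr_ge0 ?outcome_weight_ge0 ?ler0n.
have [pth [hp hl]] := IH _ fy; exists (y :: pth); split=> //=.
by rewrite hp andbT (queue_kernelE sw) lte_fin.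
Qed.

Lemma reachable_iter x z : reach x z ->
  exists N, 0 < iter N K (indic R z) x.
Proof.
case=> pth [hp <-]; exists (size pth); elim: pth x hp => [|y pth IH] x /=.
  by rewrite /indic eqxx.
rewrite (queue_kernelE sw) lte_fin => /andP[Kxy hp]; have := IH _ hp.
set f := iter _ _ _ => fy; apply: (@lt_le_trans _ _ (f y * K (indic R y) x)).
  by rewrite mulr_gt0.
have f0 v : 0 <= f v by apply: (pl_ge0 (pl_iter mK.1 _)) => u; rewrite ler0n.
rewrite -(plZ mK.1); apply: (pl_le mK.1) => v; rewrite /indic.
by have [->|_] := eqVneq v y; rewrite ?mulr1 // mulr0.
Qed.

Lemma reachable_trans x y z : reach x y ->
  reach y z -> reach x z.
Proof.
case=> p1' [h1 e1] [p2' [h2 e2]]; exists (p1' ++ p2').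
by rewrite cat_path h1 last_cat e1.
Qed.

Lemma reachable_empty x : reach x 0.
Proof.
apply: (@iter_reachable 0 (\sum_i \sum_j x i j)%N).
apply: lt_le_trans (iter_drain n_gt0 hS p0 p1 arrival_idle (leqnn _)).
by rewrite exprn_gt0 // idle_gt0 // => i j; exact: arrival_idle.
Qed.

(** The contraction of the killed operator on a function [g >= 1] is a geometric tail for the
    hitting time. *)
Lemma avoid_geometric z : reach 0 z ->
  exists rho (g : 'M[nat]_n -> R), [/\ 0 <= rho < 1 &
    forall t x, avoid [set z] t x <= rho ^+ t * g x].
Proof.
move=> /reachable_iter zN.
have [rho [g [rho01 g1 gK]]] := recurrence n_gt0 hS p0 p1 arrival_law_row
  arrival_law_col arrival_idle zN.
exists rho, g; split=> // t x; rewrite avoid_set1; have /andP[r0 _] := rho01.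
have plQ := killed_pl z mK.1.
elim: t x => [|t IH] x; first by rewrite expr0 mul1r /=.
apply: le_trans (pl_le plQ IH x) _; rewrite plZ // exprSr -mulrA.
by rewrite ler_wpM2l // exprn_ge0.
Qed.

(** The class is that of the states reachable from 0. It is closed and irreducible because 0 is
    reachable from everywhere, return times in it have geometric tails, and it is absorbing because
    the state 0 is itself hit at a geometric rate. *)
Lemma switch_positive_recurrent : positive_recurrent (queue_kernel P S a).
Proof.
exists [set z | reach 0 z]; split.
- by exists 0; exists [::].
- move=> x y Cx; split; first exact: reachable_trans.
  exact/reachable_trans/reachable_empty.
- move=> z Cz; have [rho [g [/andP[r0 r1] gP]]] := avoid_geometric Cz.
  have g0 : 0 <= g z by have := gP 0%N z; rewrite expr0 mul1r; apply: le_trans; exact: ler01.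
  rewrite /mean_return_time; apply: (@le_lt_trans _ _ (g z / (1 - rho))%:E); last exact: ltry.
  apply: lime_le; first by apply: is_cvg_nneseries => t _ _; rewrite avoidanceE lee_fin avoid_ge0.
  apply: nearW => m; under eq_bigr do rewrite avoidanceE.
  rewrite sumEFin lee_fin; apply: (@le_trans _ _ (\sum_(0 <= t < m) rho ^+ t * g z)).
    by apply: ler_sum => t _; exact: gP.
  rewrite -mulr_suml mulrC ler_wpM2l //.
  have h : (1 - rho) * \sum_(0 <= t < m) rho ^+ t = 1 - rho ^+ m.
    by rewrite big_mkord -opprB mulNr -subrX1 opprB.
  rewrite -(ler_pM2l (_ : 0 < 1 - rho)) ?subr_gt0 // h divff ?gt_eqF ?subr_gt0 //.
  by rewrite gerBl exprn_ge0.
move=> x; have C0 : reach 0 0 by exists [::].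
have [rho [g [/andP[r0 r1] gP]]] := avoid_geometric C0.
have -> : (avoidance (queue_kernel P S a)
    [set z | reach 0 z])^~ x =
    (fun t => (avoid [set z | reach 0 z] t x)%:E).
  by apply/funext => t; rewrite avoidanceE.
apply: cvg_EFin; first exact: nearW.
apply: (@squeeze_cvgr _ _ _ _ (fun=> 0) (fun t => g x * rho ^+ t)).
- apply: nearW => t; rewrite avoid_ge0 /= mulrC.
  by apply: le_trans (gP t x); exact: avoid_mono.
- exact: cvg_cst.
- by apply: (cvg_geometric (g x)); rewrite ger0_norm.
Qed.

Lemma switch_steady_limit : exists pi, steady_limit S p pi.
Proof.
have [pi piP] := steady_exists n_gt0 hS p0 p1 arrival_law_row arrival_law_col
  arrival_idle.
by exists pi.
Qed.

End Recurrence.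

(** Convergence in distribution does not pass to the unbounded function [<q, alpha>]: it only
    identifies the law of [qbar], and the expectation is then that of this law. *)
Lemma limit_expectation pi (alpha : 'M[R]_n)
    (d' : measure_display) (T' : measurableType d') (P' : probability T' R)
    (qbar : T' -> 'M[nat]_n) :
  steady_limit S p pi -> nat_random_matrix qbar ->
  cvg_in_distribution P (fun t w => natmx R (q t w)) P' (fun w => natmx R (qbar w)) ->
  ('E_P'[fun w => mxdot (natmx R (qbar w)) alpha] =
   (pi (fun x => mxdot (natmx R x) alpha))%:E)%E.
Proof.
move=> [_ _ piP] mq cq.
apply: (expectation_steady mK piP _ _ (linear_dominated1 alpha)).
  exact: nat_matrix_discrete.
exact: (limit_law piP mq cq).
Qed.

End SwitchChain.

(** * Admissible rates and the limits *)

Section RelativeInteriorFacts.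
Variables (R : realType) (n n1 n2 : nat).
Hypotheses (hn1 : (n1 < n)%N) (hn2 : (n2 < n)%N).
Variable nu : 'M[R]_n.
Hypothesis hnu : relint (face n1 n2) nu.
Hypothesis nu_gt0 : forall i j, 0 < nu i j.

(* The point is an affine combination of [x] and [x - c *: delta_mx i j]. *)
Lemma relint_extends (A : set 'M[R]_n) (x : 'M[R]_n) (c : R) (i j : 'I_n) :
  relint A x -> 0 < c -> A (x - c *: delta_mx i j) ->
  exists2 t, 0 < t & A (x + t *: delta_mx i j).
Proof.
move=> [Ax /nbhs_ballP[e /= e0 eA]] c0 Ac; exists (e / 2); first by rewrite divr_gt0.
apply: eA => /=.
  split=> // i' j'; rewrite /ball /= !mxE opprD addNKr normrN normrM normr_nat.
  apply: (@le_lt_trans _ _ (`|e / 2| * 1)).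
    by rewrite ler_wpM2l // lern1 leq_b1.
  by rewrite mulr1 gtr0_norm ?divr_gt0 // ltr_pdivrMr // ltr_pMr // ltr1n.
pose r := e / 2 / c.
exists 2%N, (fun l : 'I_2 => if l == 0 then 1 + r else - r),
  (fun l : 'I_2 => if l == 0 then x else x - c *: delta_mx i j); split.
- by move=> l; case: ifP.
- by rewrite !big_ord_recl big_ord0 /= addr0 addrK.
rewrite !big_ord_recl big_ord0 /= addr0 scalerBr scalerA scaleNr addrA scalerDl scale1r.
by rewrite addrK mulNr scaleNr opprK /r mulfVK // gt_eqF.
Qed.

Lemma row_scale_delta (x : 'M[R]_n) t (i j l : 'I_n) :
  mxdot (x + t *: delta_mx i j) (row_ones R l) = \sum_j' x l j' + t * (l == i)%:R.
Proof. by rewrite mxdotDl mxdotZl !mxdot_row delta_row. Qed.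

Lemma col_scale_delta (x : 'M[R]_n) t (i j l : 'I_n) :
  mxdot (x + t *: delta_mx i j) (col_ones R l) = \sum_i' x i' l + t * (l == j)%:R.
Proof. by rewrite mxdotDl mxdotZl !mxdot_col delta_col. Qed.

(** Lowering the entry [(i, j)] to 0 stays in the face, because neither of its lines is saturated.
    By relative interiority the entry can also be raised a little, which is only possible if both
    lines have slack. *)
Lemma unsaturated_slack (i j : 'I_n) : (n1 <= i)%N -> (n2 <= j)%N ->
  \sum_j' nu i j' < 1 /\ \sum_i' nu i' j < 1.
Proof.
move=> i1 j2; have [[[nu0 nur nuc] satr satc] _] := hnu.
have ni (l : 'I_n) : (l < n1)%N -> (l == i) = false.
  by move=> l1; apply/eqP => li; move: l1; rewrite li ltnNge i1.
have nj (l : 'I_n) : (l < n2)%N -> (l == j) = false.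
  by move=> l1; apply/eqP => li; move: l1; rewrite li ltnNge j2.
have [|t t0 [[_ tr tc] _ _]] := relint_extends (c := nu i j) (i := i) (j := j) hnu (nu_gt0 i j).
  rewrite -scaleNr; split; first split.
  - move=> i' j'; rewrite !mxE mulNr.
    have [/andP[/eqP -> /eqP ->]|_] := boolP ((i' == i) && (j' == j)).
      by rewrite mulr1 subrr.
    by rewrite mulr0 subr0.
  - move=> l; rewrite row_scale_delta -mxdot_row; apply: le_trans (nur l).
    by rewrite gerDl mulNr oppr_le0 mulr_ge0 // ltW.
  - move=> l; rewrite col_scale_delta -mxdot_col; apply: le_trans (nuc l).
    by rewrite gerDl mulNr oppr_le0 mulr_ge0 // ltW.
  - by move=> l l1; rewrite row_scale_delta (ni _ l1) mulr0 addr0 -mxdot_row satr.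
  - by move=> l l1; rewrite col_scale_delta (nj _ l1) mulr0 addr0 -mxdot_col satc.
have := tr i; have := tc j; rewrite row_scale_delta col_scale_delta !eqxx !mulr1.
by move=> *; split; lra.
Qed.

(** The row is crossed with column [n2], which exists and is unsaturated. *)
Lemma unsaturated_row (i : 'I_n) : (n1 <= i)%N -> \sum_j nu i j < 1.
Proof. by move=> i1; have [] := unsaturated_slack i1 (leqnn n2 : (n2 <= Ordinal hn2)%N). Qed.

Lemma unsaturated_col (j : 'I_n) : (n2 <= j)%N -> \sum_i nu i j < 1.
Proof. by move=> j2; have [] := unsaturated_slack (leqnn n1 : (n1 <= Ordinal hn1)%N) j2. Qed.

Lemma face_slack : exists2 delta, 0 < delta & [/\ forall i j, delta <= nu i j,
  forall i : 'I_n, (n1 <= i)%N -> \sum_j nu i j + n%:R * delta <= 1 &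
  forall j : 'I_n, (n2 <= j)%N -> \sum_i nu i j + n%:R * delta <= 1].
Proof.
pose f (c : ('I_n * 'I_n) + ('I_n + 'I_n)) := match c with
  | inl c => nu c.1 c.2
  | inr (inl i) => if (n1 <= i)%N then (1 - \sum_j nu i j) / n%:R else 1
  | inr (inr j) => if (n2 <= j)%N then (1 - \sum_i nu i j) / n%:R else 1 end.
have n0 : 0 < n%:R :> R by rewrite ltr0n (leq_ltn_trans _ hn1).
have [|r r0 rf] := @finite_lower_bound R (('I_n * 'I_n) + ('I_n + 'I_n))%type f.
  case=> [[i j]|[i|j]] /=; first exact: nu_gt0.
    by case: ifP => // i1; rewrite divr_gt0 // subr_gt0 unsaturated_row.
  by case: ifP => // j2; rewrite divr_gt0 // subr_gt0 unsaturated_col.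
exists r => //; split=> [i j|i i1|j j2]; first exact: (rf (inl (i, j))).
  by have := rf (inr (inl i)); rewrite /= i1 ler_pdivlMr //; lra.
by have := rf (inr (inr j)); rewrite /= j2 ler_pdivlMr //; lra.
Qed.

End RelativeInteriorFacts.

(** * Admissibility of the rates for small [eps] *)

Section AdmissibleRates.
Variables (R : realType) (n n1 n2 : nat).
Hypotheses (hn1 : (n1 < n)%N) (hn2 : (n2 < n)%N).
Variables (nu k : 'M[R]_n).
Hypothesis hnu : relint (face n1 n2) nu.
Hypothesis hnu_min : 0 < nu_min nu.
Hypothesis hk_ge0 : forall i j, 0 <= k i j.
Hypothesis hk_sum : mxdot k (const_mx 1) = n%:R.
Hypothesis hkappa : forall i : 'I_n, (i < n1)%N -> 0 < mxdot k (row_ones R i).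
Hypothesis hkappa' : forall j : 'I_n, (j < n2)%N -> 0 < mxdot k (col_ones R j).

Lemma nu_min_le i j : nu_min nu <= nu i j.
Proof.
have [[[nu0 _ _] _ _] _] := hnu.
apply: ge_inf; last by exists i, j.
by exists 0 => _ [i' [j' ->]].
Qed.

Lemma nu_entry_gt0 i j : 0 < nu i j.
Proof. exact: lt_le_trans hnu_min (nu_min_le i j). Qed.

Lemma nu_entry_le1 i j : nu i j <= 1.
Proof.
have [[[nu0 nur _] _ _] _] := hnu; apply: le_trans (nur i).
by rewrite mxdot_row (bigD1 j) //= lerDl; apply: sumr_ge0.
Qed.

Lemma rate_matrix_row e i : 0 < e -> \sum_j (nu - e *: k) i j < 1.
Proof.
move=> e0; rewrite -mxdot_row mxdotBl mxdotZl.
have [[_ satr _] _] := hnu; have [i1|i1] := ltnP i n1.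
  by rewrite satr // gtrBl mulr_gt0 // hkappa.
apply: le_lt_trans (unsaturated_row hn2 hnu nu_entry_gt0 i1).
rewrite mxdot_row gerBl mulr_ge0 ?(ltW e0) // mxdot_row.
exact: sumr_ge0.
Qed.

Lemma rate_matrix_col e j : 0 < e -> \sum_i (nu - e *: k) i j < 1.
Proof.
move=> e0; rewrite -mxdot_col mxdotBl mxdotZl.
have [[_ _ satc] _] := hnu; have [j1|j1] := ltnP j n2.
  by rewrite satc // gtrBl mulr_gt0 // hkappa'.
apply: le_lt_trans (unsaturated_col hn1 hnu nu_entry_gt0 j1).
rewrite mxdot_col gerBl mulr_ge0 ?(ltW e0) // mxdot_col.
exact: sumr_ge0.
Qed.

Lemma k_entry_le i j : k i j <= n%:R.
Proof.
rewrite -hk_sum /mxdot (bigD1 i) //= (bigD1 j) //= mxE mulr1 -addrA lerDl.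
by rewrite addr_ge0 //; do ?[apply: sumr_ge0 => ? _]; rewrite mxE mulr1.
Qed.

Lemma admissible_small delta e : (forall i j, delta <= nu i j) ->
  0 < e < 1 -> e * n%:R <= delta / 2 -> admissible nu k e.
Proof.
move=> nud e01 en; split=> // i j; have /andP[e0 _] := e01.
rewrite !mxE subr_ge0; apply: le_trans (nud i j).
have : e * k i j <= e * n%:R by rewrite ler_wpM2l ?(ltW e0) // k_entry_le.
have : 0 <= e * k i j by rewrite mulr_ge0 // ltW.
lra.
Qed.

(** From [n = <k, 1> <= |k| n] comes [|k| >= 1], so the range forces [2 e <= nu_min <= 1], and
    [e k_ij <= e |k| <= nu_min]. *)
Lemma admissible_range e : 0 < e -> e <= nu_min' n1 n2 nu / (2 * mxnorm2 k) ->
  admissible nu k e.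
Proof.
move=> e0 ele; have n0 := leq_ltn_trans (leq0n _) hn1.
have n0' : 0 < n%:R :> R by rewrite ltr0n.
have k1 : 1 <= mxnorm2 k.
  rewrite -(ler_pM2r n0') mul1r -[leLHS]hk_sum; apply: le_trans (mxdot_le_norm _ _) _.
  rewrite ler_wpM2l // -[leRHS]mulr1.
  by apply: mxnorm2_entries => // i j; rewrite mxE normr1.
have ek : e * (2 * mxnorm2 k) <= nu_min nu.
  rewrite -ler_pdivlMr ?mulr_gt0 //; last by lra.
  apply: le_trans ele _; rewrite ler_wpM2r ?invr_ge0 ?mulr_ge0 //.
  by rewrite /nu_min' ge_min lexx.
pose i0 := Ordinal hn1.
have nu1 : nu_min nu <= 1 := le_trans (nu_min_le i0 i0) (nu_entry_le1 i0 i0).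
have e2 : e * 1 <= e * mxnorm2 k by rewrite ler_wpM2l // ltW.
split=> [|i j]; first by rewrite e0 /=; lra.
rewrite !mxE subr_ge0; apply: le_trans (nu_min_le i j).
have : e * k i j <= e * mxnorm2 k.
  by rewrite ler_wpM2l ?(ltW e0) // (le_trans (ler_norm _)) // entry_le_mxnorm2.
by have := mulr_ge0 (ltW e0) (mxnorm2_ge0 k); lra.
Qed.

End AdmissibleRates.


Lemma sqrt_error_cvg (R : realType) (f g : R -> R) (C l : R) :
  g e @[e --> 0^'+] --> l ->
  (\forall e \near 0^'+, `|f e - g e| <= C * Num.sqrt e) ->
  f e @[e --> 0^'+] --> l.
Proof.
move=> gl fg; have s0 : C * Num.sqrt e @[e --> 0^'+] --> (0 : R).
  have h : Num.sqrt e @[e --> 0^'+] --> (0 : R).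
    rewrite -[X in _ --> X]sqrtr0; apply: cvg_at_right_filter.
    exact: sqrt_continuous.
  by rewrite -[X in _ --> X](mulr0 C); exact: cvgMr.
have fg0 : f e - g e @[e --> 0^'+] --> (0 : R).
  apply/norm_cvg0P; apply: (squeeze_cvgr _ (cvg_cst 0) s0).
  by near do rewrite normr_ge0 /=.
have -> : f = (fun e => (f e - g e) + g e) by apply/funext => e; rewrite subrK.
by rewrite -[l]add0r; exact: cvgD.
Unshelve. all: by end_near. Qed.

Lemma cvg_to_EFin (R : realType) (F : R -> \bar R) (f : R -> R) (l : R) :
  (\forall e \near 0^'+, F e = (f e)%:E) -> f e @[e --> 0^'+] --> l ->
  F e @[e --> 0^'+] --> l%:E.
Proof.
move=> Ff fl; apply: cvg_EFin.
  by near=> e; rewrite (near Ff e).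
apply: cvg_trans fl; apply: near_eq_cvg; near=> e.
by rewrite /= (near Ff e).
Unshelve. all: by end_near. Qed.

Theorem theorem1 (R : realType) (n n1 n2 : nat)
  (hn1 : (n1 < n)%N) (hn2 : (n2 < n)%N)
  (nu k : 'M[R]_n)
  (hnu : relint (face n1 n2) nu)
  (hnu_min : 0 < nu_min nu)
  (hk_ge0 : forall i j, 0 <= k i j)
  (hk_sum : mxdot k (const_mx 1) = n%:R)
  (hkappa : forall i : 'I_n, (i < n1)%N -> 0 < mxdot k (row_ones R i))
  (hkappa' : forall j : 'I_n, (j < n2)%N -> 0 < mxdot k (col_ones R j))
  (amax : nat) (tsigma : R) (sigma2 : R -> 'M[R]_n)
  (S : {set 'M[bool]_n})
  (hS : S = schedules n \/ S = full_schedules n)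
  (d : R -> measure_display) (T : forall e : R, measurableType (d e))
  (P : forall e : R, probability (T e) R)
  (q a : forall e : R, nat -> T e -> 'M[nat]_n)
  (s : forall e : R, nat -> T e -> 'M[bool]_n)
  (hswitch : forall e, admissible nu k e ->
     maxweight_switch (P e) S amax (nu - e *: k) (sigma2 e)
       (q e) (a e) (s e))
  (hsigma : forall e, admissible nu k e ->
     \sum_i \sum_j sigma2 e i j <= tsigma ^+ 2) :
  (forall e, admissible nu k e ->
     positive_recurrent (queue_kernel (P e) S (a e)) /\
     exists (d' : measure_display) (T' : measurableType d')
       (P' : probability T' R) (qbar : T' -> 'M[nat]_n),
       [/\ nat_random_matrix qbar,
           stationary_for (queue_kernel (P e) S (a e)) P' qbar
         & cvg_in_distribution (P e) (fun t w => natmx R (q e t w))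
             P' (fun w => natmx R (qbar w))]) /\
  (forall (d' : R -> measure_display) (T' : forall e : R, measurableType (d' e))
     (P' : forall e : R, probability (T' e) R)
     (qbar : forall e : R, T' e -> 'M[nat]_n),
     (forall e, admissible nu k e ->
        nat_random_matrix (qbar e) /\
        cvg_in_distribution (P e) (fun t w => natmx R (q e t w))
          (P' e) (fun w => natmx R (qbar e w))) ->
     (forall alpha : 'M[R]_n,
        (forall i : 'I_n, (i < n1)%N ->
           mxdot alpha (row_ones R i) = n%:R * mxdot k (row_ones R i)) ->
        (forall j : 'I_n, (j < n2)%N ->
           mxdot alpha (col_ones R j) = n%:R * mxdot k (col_ones R j)) ->
        (exists B1 B2 : R -> R,
           [/\ e * B1 e @[e --> 0^'+] --> 0,
               e * B2 e @[e --> 0^'+] --> 0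
             & forall e, 0 < e -> e <= nu_min' n1 n2 nu / (2 * mxnorm2 k) ->
                 ((1 / (2 * e) * mxdot (sigma2 e) (zeta R n n1 n2) - B1 e)%:E
                    <= 'E_(P' e)[fun w => mxdot (natmx R (qbar e w)) alpha]
                    <= (1 / (2 * e) * mxdot (sigma2 e) (zeta R n n1 n2)
                        + B2 e)%:E)%E]) /\
        (forall sigma2_lim : 'M[R]_n,
           sigma2 e @[e --> 0^'+] --> sigma2_lim ->
           (e%:E * 'E_(P' e)[fun w => mxdot (natmx R (qbar e w)) alpha])%E
             @[e --> 0^'+]
             --> (1 / 2 * mxdot sigma2_lim (zeta R n n1 n2))%:E)) /\
     (forall i j : 'I_n, (n1 <= i)%N -> (n2 <= j)%N ->
        (e%:E * 'E_(P' e)[fun w => (qbar e w i j)%:R])%E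
          @[e --> 0^'+] --> 0%:E)).
Proof.
have n_gt0 := leq_ltn_trans (leq0n _) hn1.
have nu_gt0 := nu_entry_gt0 hnu hnu_min.
have [delta delta0 [nu_ge nu_row nu_col]] := face_slack hn1 hn2 hnu nu_gt0.
have nu_row1 (i : 'I_n) : (i < n1)%N -> \sum_j nu i j = 1.
  by move=> i1; rewrite -mxdot_row; have [[_ + _] _] := hnu; apply.
have nu_col1 (j : 'I_n) : (j < n2)%N -> \sum_i nu i j = 1.
  by move=> j2; rewrite -mxdot_col; have [[_ _ +] _] := hnu; apply.
have lrow e : admissible nu k e -> forall i, \sum_j (nu - e *: k) i j < 1.
  by case=> /andP[e0 _] _ i; exact: (rate_matrix_row hn2 hnu).
have lcol e : admissible nu k e -> forall j, \sum_i (nu - e *: k) i j < 1.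
  by case=> /andP[e0 _] _ j; exact: (rate_matrix_col hn1 hnu).
(* One steady functional for each [e], with an arbitrary value where the rates are not
   admissible. *)
have /choice[pi piP] : forall e, exists st, admissible nu k e ->
    steady_limit S (@arrival_law _ _ _ (P e) n amax (a e)) st.
  move=> e; have [ae|nae] := pselect (admissible nu k e); last by exists (fun=> 0).
  by have [pi piP] := switch_steady_limit n_gt0 hS (hswitch e ae) (lrow e ae) (lcol e ae); exists pi.
split=> [e ae|d' T' P' qbar qbarP].
  split; first exact: (switch_positive_recurrent n_gt0 hS (hswitch e ae) (lrow e ae) (lcol e ae)).
  have [_ _ piPe] := piP e ae.
  have [P' [qbar h]] := steady_realization hS (hswitch e ae) piPe.
  by exists _, nat, P', qbar.
(* The conditions under which the uniform bounds apply; all of them hold for [e] close to 0. *)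
pose regime e := [/\ 0 < e <= 1, e * n%:R <= delta / 2 & admissible nu k e].
have small : \forall e \near 0^'+, regime e.
  have n0 : 0 < n%:R :> R by rewrite ltr0n.
  near=> e; have e0 : 0 < e by near: e; exact: nbhs_right_gt.
  have e1 : e < 1 by near: e; exact: nbhs_right_lt.
  have en : e * n%:R <= delta / 2.
    rewrite -ler_pdivlMr //; apply: ltW; near: e; apply: nbhs_right_lt.
    by rewrite !divr_gt0.
  split=> //; first by rewrite e0 ltW.
  by apply: (admissible_small hk_ge0 hk_sum nu_ge) => //; rewrite e0.
have expect e (ae : admissible nu k e) u := limit_expectation hS (hswitch e ae) u
  (piP e ae) (qbarP e ae).1 (qbarP e ae).2.
pose r alpha e := pi e (fun x => mxdot (natmx R x) alpha).
split=> [alpha alpha_row alpha_col|i j i1 j2].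
  have ar (i : 'I_n) : (i < n1)%N -> rsum alpha i = n%:R * rsum k i.
    by move=> i1; rewrite /rsum -!mxdot_row alpha_row.
  have ac (j : 'I_n) : (j < n2)%N -> csum alpha j = n%:R * csum k j.
    by move=> j1; rewrite /csum -!mxdot_col alpha_col.
  have [C CP] := heavy_traffic_bound amax hn1 hn2 hS delta0 nu_ge nu_row1 nu_col1
    nu_row nu_col hk_ge0 hk_sum ar ac.
  pose z e := mxdot (sigma2 e) (zeta R n n1 n2).
  have close : \forall e \near 0^'+, `|e * r alpha e - 1 / 2 * z e| <= C * Num.sqrt e.
    near=> e; have [e01 en ae] : regime e by near: e.
    have := CP e _ _ (piP e ae) (arrival_law_rate (hswitch e ae)) e01 en.
    by rewrite (arrival_law_var (hswitch e ae)).
  split=> [|sigma2_lim sigma2_cvg].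
    (* B1 and B2 are only constrained near 0: take the error itself. *)
    pose B e := `|1 / (2 * e) * z e - r alpha e|.
    have B0 : e * B e @[e --> 0^'+] --> (0 : R).
      apply: (sqrt_error_cvg (C := C) (g := fun=> 0)); first exact: cvg_cst.
      near=> e; have e0 : 0 < e by near: e; exact: nbhs_right_gt.
      have h : `|e * r alpha e - 1 / 2 * z e| <= C * Num.sqrt e by near: e.
      have -> : e * B e = `|e * r alpha e - 1 / 2 * z e|.
        rewrite /B -[X in X * _](gtr0_norm e0) -normrM -normrN; congr `|_|.
        by field; rewrite gt_eqF.
      by rewrite subr0 normr_id.
    exists B, B; split=> // e e0 ele.
    have ae := admissible_range hn1 hnu hk_sum e0 ele.
    rewrite (expect e ae) !lee_fin -/(r alpha e) -/(z e) /B.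
    have := ler_norm (1 / (2 * e) * z e - r alpha e).
    have := ler_norm (- (1 / (2 * e) * z e - r alpha e)); rewrite normrN.
    by move=> *; apply/andP; split; lra.
  have zc : 1 / 2 * z e @[e --> 0^'+] --> 1 / 2 * mxdot sigma2_lim (zeta R n n1 n2).
    have cm : continuous (fun x : 'M[R]_n => mxdot x (zeta R n n1 n2)).
      apply: continuous_sumr => i; apply: continuous_sumr => j x.
      by apply: continuousM; [exact: coord_continuous | exact: cst_continuous].
    by apply: cvgMr; exact: (cvg_comp _ _ sigma2_cvg (cm sigma2_lim)).
  apply: (cvg_to_EFin (f := fun e => e * r alpha e)); last exact: sqrt_error_cvg zc close.
  near=> e; have [_ _ ae] : regime e by near: e.
  by rewrite (expect e ae) EFinM.
have [C CP] := unsaturated_bound amax hn1 hn2 hS delta0 nu_ge nu_row1 nu_col1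
  nu_row nu_col hk_ge0 hk_sum.
(* A single queue is the linear functional of [u], so the expectation lemma for weight vectors
   applies to it; [e] times a quantity bounded by [C] then tends to 0. *)
pose u : 'M[R]_n := delta_mx i j.
have uE (x : 'M[nat]_n) : mxdot (natmx R x) u = (x i j)%:R.
  by rewrite mxdot_delta mxE.
apply: (cvg_to_EFin (f := fun e => e * r u e)).
  near=> e; have [_ _ ae] : regime e by near: e.
  rewrite EFinM -(expect e ae); congr (_ * 'E_(P' e)[_])%E.
  by apply/funext => w; rewrite uE.
have C0 : e * C @[e --> 0^'+] --> (0 : R).
  rewrite -[X in _ --> X](mul0r C); apply: cvgMl.
  by apply: cvg_at_right_filter; exact: cvg_id.
apply: (squeeze_cvgr _ (cvg_cst 0) C0).
near=> e; have [/andP[e0 _] en ae] : regime e by near: e.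
have [p0 p1 piPe] := piP e ae; have n0 : 0 <= e := ltW e0.
rewrite mulr_ge0 //=.
  rewrite ler_wpM2l // /r (steady_ext _ uE).
  exact: (CP e _ _ (piP e ae) (arrival_law_rate (hswitch e ae))).
apply: (steady_ge0 (queue_op_markov hS p0 p1) (@qweight_ge1 R n) piPe 0 (linear_dominated u)) => x.
by rewrite uE.
Unshelve. all: by end_near. Qed.
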